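(* Let $R$, $Q_R$ be as in the context, let $q\in Q_R$ (in particular $\mathrm{Sc}\,q>1$), and let $$\mathcal H:=\Big\{f=\sum_{k\in\mathbb{Z}}a_kB_q(\cdot-k):\ a_k\in\mathbb{H}_\mathbb{C},\ \sum_k|a_k|^2<\infty\Big\}.$$ Then for every $f\in\mathcal H$, $$f(t)=\lim_{N\to\infty}\sum_{k=-N}^Nf(k)\,L_q(t-k),$$ where the convergence holds in the $L^2(\mathbb{R},\mathbb{H}_\mathbb{C})$ norm, pointwise, and uniformly on compact subsets of $\mathbb{R}$.
   Context: $\mathbb{H}_\mathbb{R}$ denotes the real quaternions $a+v_1e_1+v_2e_2+v_3e_3$ with $e_1^2=e_2^2=e_3^2=-1$, $e_1e_2=e_3$, $e_2e_3=e_1$, $e_3e_1=e_2$; $\mathbb{H}_\mathbb{C}$ the complex quaternions (complex coefficients, $i$ commuting with every $e_j$), $|q_0+\sum q_je_j|=(\sum|q_j|^2)^{1/2}$. For $q=a+v$, $v=\sum v_je_j$, $|v|=(\sum v_j^2)^{1/2}$. Quaternionic power: for $z\in\mathbb{C}\setminus\{0\}$, $z^q:=z^a[\cos(|v|\log z)+\frac{v}{|v|}\sin(|v|\log z)]$ (principal $\log$). $\Xi(\xi):=\frac{1-e^{-i\xi}}{i\xi}$, $\Xi(0):=1$; $\widehat{B_q}:=\Xi^q$ and $B_q$ is its inverse Fourier transform ($\hat f(\xi)=\int f(x)e^{-i\xi x}dx$). Classical Hurwitz zeta: $\zeta(s,a)=\sum_{k\ge0}(a+k)^{-s}$. Standing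 assumption: $R\subset\{w\in\mathbb{C}:\mathrm{Re}\,w>1\}$ with $\overline R=R$ and $\zeta(w,\alpha)+e^{-i\pi w}\zeta(w,1-\alpha)\ne0$ for all $w\in R$, $\alpha\in(0,1)$; $Q_R:=\{q=a+v\in\mathbb{H}_\mathbb{R}: v\ne0,\ a+i|v|\in R\}$. For $q\in Q_R$, $\sum_k\widehat{B_q}(\xi+2\pi k)$ is invertible for every $\xi$, and the fundamental cardinal spline is $L_q(x):=\frac1{2\pi}\int_\mathbb{R}\widehat{B_q}(\xi)\big(\sum_k\widehat{B_q}(\xi+2\pi k)\big)^{-1}e^{i\xi x}d\xi$, which satisfies $L_q(m)=\delta_{m,0}$, $m\in\mathbb{Z}$. *)

(* Defs.v *)
From HB Require Import structures.
From mathcomp Require Import all_boot all_order all_algebra.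
From mathcomp Require Import all_classical all_reals all_analysis.
From mathcomp.real_closed Require Import complex.
Set Implicit Arguments. Unset Strict Implicit. Unset Printing Implicit Defensive.
Import Order.TTheory GRing.Theory Num.Theory.
Import numFieldNormedType.Exports.
Local Open Scope ring_scope.
Local Open Scope classical_set_scope.

Section QuatSpline.
Variable R : realType.
Local Notation C := R[i].

Definition rC (x : R) : C := Complex x 0.
Definition cI : C := Complex 0 1.
Definition cconj (z : C) : C := Complex (complex.Re z) (- complex.Im z).
Definition cmod2 (z : C) : R := complex.Re z ^+ 2 + complex.Im z ^+ 2.
Definition cexp (z : C) : C :=
  Complex (expR (complex.Re z) * cos (complex.Im z))
          (expR (complex.Re z) * sin (complex.Im z)).
(* principal argument, in (-pi, pi] *)
Definition carg (z : C) : R :=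
  let x := complex.Re z in let y := complex.Im z in
  if 0 < x then atan (y / x)
  else if x < 0 then (if 0 <= y then atan (y / x) + pi else atan (y / x) - pi)
  else if 0 < y then pi / 2 else if y < 0 then - (pi / 2) else 0.
Definition clog (z : C) : C := Complex (ln (Num.sqrt (cmod2 z))) (carg z).
Definition ccos (w : C) : C := (cexp (cI * w) + cexp (- (cI * w))) / 2%:R.
Definition csin (w : C) : C := (cexp (cI * w) - cexp (- (cI * w))) / (2%:R * cI).
(* z^a for real a, z <> 0 (principal branch) *)
Definition cpowr (z : C) (a : R) : C := cexp (rC a * clog z).

(* ---------- complex quaternions H_C = C^4 (coefficients of 1,e1,e2,e3) ---------- *)
Definition HC := 'rV[C]_4.
Definition hc (p : HC) (n : nat) : C := p ord0 (inord n).
Definition mkHC (p0 p1 p2 p3 : C) : HC :=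
  \row_(i < 4) nth 0 [:: p0; p1; p2; p3] i.
(* Hamilton product, e1^2=e2^2=e3^2=-1, e1e2=e3, e2e3=e1, e3e1=e2; i central *)
Definition hmul (p q : HC) : HC :=
  let p0 := hc p 0 in let p1 := hc p 1 in let p2 := hc p 2 in let p3 := hc p 3 in
  let q0 := hc q 0 in let q1 := hc q 1 in let q2 := hc q 2 in let q3 := hc q 3 in
  mkHC (p0 * q0 - p1 * q1 - p2 * q2 - p3 * q3)
       (p0 * q1 + p1 * q0 + p2 * q3 - p3 * q2)
       (p0 * q2 + p2 * q0 + p3 * q1 - p1 * q3)
       (p0 * q3 + p3 * q0 + p1 * q2 - p2 * q1).
Definition hnorm (p : HC) : R := Num.sqrt (\sum_(i < 4) cmod2 (p ord0 i)).
(* inverse in H_C: p^{-1} = conj(p) / (p0^2+p1^2+p2^2+p3^2) (when invertible) *)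
Definition hinv (p : HC) : HC :=
  let n := hc p 0 ^+ 2 + hc p 1 ^+ 2 + hc p 2 ^+ 2 + hc p 3 ^+ 2 in
  mkHC (hc p 0 / n) (- hc p 1 / n) (- hc p 2 / n) (- hc p 3 / n).

(* ---------- real quaternions q = a + v1 e1 + v2 e2 + v3 e3 ---------- *)
Definition HR := 'rV[R]_4.
Definition qSc (q : HR) : R := q ord0 (inord 0).
Definition qv (q : HR) (j : nat) : R := q ord0 (inord j).
Definition qvnorm (q : HR) : R := Num.sqrt (qv q 1 ^+ 2 + qv q 2 ^+ 2 + qv q 3 ^+ 2).

(* quaternionic power z^q := z^a [cos(|v| log z) + v/|v| sin(|v| log z)], z <> 0;
   convention: value 0 at z = 0 (not used by the paper's definition) *)
Definition hpow (z : C) (q : HR) : HC :=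
  if z == 0 then 0 else
  let a := qSc q in let nv := qvnorm q in let L := clog z in
  let za := cpowr z a in
  let c := ccos (rC nv * L) in let s := csin (rC nv * L) in
  mkHC (za * c) (za * rC (qv q 1 / nv) * s) (za * rC (qv q 2 / nv) * s)
       (za * rC (qv q 3 / nv) * s).

Definition Xi (xi : R) : C :=
  if xi == 0 then 1 else (1 - cexp (- (cI * rC xi))) / (cI * rC xi).

Definition Bhat (q : HR) (xi : R) : HC := hpow (Xi xi) q.

Definition cint (g : R -> C) : C :=
  Complex (Rintegral lebesgue_measure setT (fun x => complex.Re (g x)))
          (Rintegral lebesgue_measure setT (fun x => complex.Im (g x))).

(* inverse Fourier transform (for fhat(xi) = int f(x) e^{-i xi x} dx) *)
Definition invFT (F : R -> HC) (x : R) : HC :=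
  \row_(i < 4) (cint (fun xi => F xi ord0 i * cexp (cI * rC (xi * x))) / rC (2%:R * pi)).

Definition Bq (q : HR) : R -> HC := invFT (Bhat q).

Definition symsum (N : nat) (F : int -> HC) : HC :=
  \sum_(i < (2 * N).+1) F (i%:Z - N%:Z).

Definition rlim (u : nat -> R) : R := limn u.
Definition hlim (u : nat -> HC) : HC :=
  \row_(i < 4) Complex (rlim (fun N => complex.Re (u N ord0 i)))
                       (rlim (fun N => complex.Im (u N ord0 i))).
Definition hcvg (u : nat -> HC) (l : HC) : Prop :=
  (fun N => hnorm (u N - l)) @ \oo --> (0 : R).

Definition Per (q : HR) (xi : R) : HC :=
  hlim (fun N => symsum N (fun k => Bhat q (xi + 2%:R * pi * k%:~R))).

Definition Lq (q : HR) : R -> HC :=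
  invFT (fun xi => hmul (Bhat q xi) (hinv (Per q xi))).

Definition clim (u : nat -> C) : C :=
  Complex (rlim (fun N => complex.Re (u N))) (rlim (fun N => complex.Im (u N))).
Definition hurwitz (w : C) (alpha : R) : C :=
  clim (fun N => \sum_(k < N) cexp (- w * rC (ln (alpha + k%:R)))).

Definition standing_assumption (Rs : set C) : Prop :=
  [/\ (forall w, Rs w -> 1 < complex.Re w),
      (forall w, Rs (cconj w) <-> Rs w) &
      (forall w alpha, Rs w -> 0 < alpha < 1 ->
         hurwitz w alpha + cexp (- (cI * rC pi * w)) * hurwitz w (1 - alpha) != 0)].

Definition QR (Rs : set C) (q : HR) : Prop :=
  qvnorm q != 0 /\ Rs (Complex (qSc q) (qvnorm q)).

Definition inH (q : HR) (f : R -> HC) : Prop :=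
  exists a : int -> HC,
    (exists M : R, forall N : nat,
        \sum_(i < (2 * N).+1) hnorm (a (i%:Z - N%:Z)) ^+ 2 <= M) /\
    (forall t : R,
        hcvg (fun N => symsum N (fun k => hmul (a k) (Bq q (t - k%:~R)))) (f t)).

Definition cardinal_sum (q : HR) (f : R -> HC) (N : nat) (t : R) : HC :=
  symsum N (fun k => hmul (f k%:~R) (Lq q (t - k%:~R))).

End QuatSpline.

(* Main.v *)
Require Import Defs.
From HB Require Import structures.
From mathcomp Require Import all_boot all_order all_algebra.
From mathcomp Require Import all_classical all_reals all_analysis.
From mathcomp Require Import measurable_realfun.
From mathcomp.real_closed Require Import complex.
From mathcomp Require Import ring lra zify.
Import Order.TTheory GRing.Theory Num.Theory.
Import numFieldNormedType.Exports.
Local Open Scope ring_scope.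
Local Open Scope classical_set_scope.
Set Implicit Arguments. Unset Strict Implicit. Unset Printing Implicit Defensive.

(* In H_C the real unit vector v/|v| of q splits Xi^q into the two complex powers Xi^w
   with w = a +- i|v|, along two orthogonal idempotents; so it suffices to treat scalar
   series with symbol F = Xi^w, periodization P = sum_k F(. + 2 pi k), beta^ = F and
   L^ = F / P.

   Measure a function h by sup_t (sum_m |h(t + m)|^2)^(1/2); this norm dominates both the
   uniform norm and the L^2(R) norm.  For a symbol G whose absolute periodization is
   bounded, d |-> sum_k d_k G^(. - k) is bounded from l^2 into this norm.  Approximating P
   uniformly by trigonometric polynomials shows that f is a limit, in this norm, of finite
   combinations h of integer translates of L, and such h are reproduced exactly by their
   cardinal series because L(m) = delta_(m,0).  Since sampling and h |-> sum h(k) L(. - k)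
   are both bounded, the cardinal series of f converges to f.

   On a period, P is the product of a non-vanishing factor and of
   zeta(w, al) + e^(i pi w) zeta(w, 1 - al), hence |P| is bounded below by compactness. *)

(** * Symmetric sums and periodization *)

(** It is P, not 1 / P, that gets approximated: since F = (F / P) P, a B-spline is close to a finite
    combination of translates of L. Continuity of P and a lower bound on |P| then suffice, without a
    Wiener-type lemma on the Fourier coefficients of 1 / P and without decay estimates for L.
    Replacing P costs only a sup norm, because the l^2 bound sees a symbol solely through its
    absolute periodization. That bound is proved by duality on finite sums, with orthogonality of
    exponentials on one period as the only Fourier analysis. Elements of the space are pointwise
    limits of symmetric sums. Estimates are therefore stated for finitely many integer translates,
    uniformly in their number, and then passed to the limit. Measurability of such a limit is never
    established: the L^2 claim rests on an integral bound valid for every nonnegative function.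
    Coefficients stand to the left of the splines, so the idempotents act by right multiplication.
    Both orders a +- i|v| occur, which is where symmetry of the set of orders under conjugation
    enters. *)

Definition zsum (V : nmodType) N (F : int -> V) : V :=
  \sum_(i < (2 * N).+1) F (i%:Z - N%:Z).

Section ZSum.
Variable V : nmodType.
Implicit Types F G : int -> V.

Lemma zsum0 F : zsum 0 F = F 0.
Proof. by rewrite /zsum big_ord_recl big_ord0 addr0. Qed.

Lemma zsumS N F : zsum N.+1 F = F (- N.+1%:Z) + zsum N F + F N.+1%:Z.
Proof.
rewrite /zsum mulnS addnC addn2 big_ord_recl big_ord_recr /= addrA.
congr (_ + _ + _).
- by congr F; lia.
- by apply: eq_bigr => i _; congr F; rewrite /bump /=; lia.
- by congr F; rewrite /bump /=; lia.
Qed.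

Lemma eq_zsum N F G : (forall k, (`|k| <= N)%N -> F k = G k) -> zsum N F = zsum N G.
Proof.
by move=> FG; apply: eq_bigr => i _; apply: FG; have := ltn_ord i; lia.
Qed.

Lemma zsumD N F G : zsum N (fun k => F k + G k) = zsum N F + zsum N G.
Proof. exact: big_split. Qed.

Lemma exchange_zsum N M (F : int -> int -> V) :
  zsum N (fun i => zsum M (F i)) = zsum M (fun j => zsum N (F ^~ j)).
Proof. exact: exchange_big. Qed.

Lemma zsum_eq0 N F : (forall k, (`|k| <= N)%N -> F k = 0) -> zsum N F = 0.
Proof. by move=> F0; rewrite (eq_zsum F0) /zsum big1. Qed.

Lemma zsum_single N F j : (forall k, k != j -> F k = 0) ->
  zsum N F = if (`|j| <= N)%N then F j else 0.
Proof.
move=> Fj; elim: N => [|N IHN].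
  rewrite zsum0; case: ifPn => h; first by congr F; lia.
  by apply: Fj; apply/eqP => j0; move: h; rewrite -j0.
rewrite zsumS IHN.
have [jN1|jN1] := eqVneq j (N.+1%:Z).
  rewrite [F (- _)]Fj; last by lia.
  by rewrite add0r ifF ?add0r ?ifT -?jN1 //; lia.
have [jN2|jN2] := eqVneq j (- N.+1%:Z).
  rewrite (Fj N.+1%:Z); last by lia.
  by rewrite addr0 ifF ?addr0 ?ifT -?jN2 //; lia.
rewrite [F (- _)]Fj ?[F N.+1%:Z]Fj ?add0r ?addr0; [|by lia..].
by rewrite (_ : (`|j| <= N.+1)%N = (`|j| <= N)%N) //; lia.
Qed.
End ZSum.

Lemma zsumMl (A : pzRingType) N (F : int -> A) c :
  zsum N (fun k => c * F k) = c * zsum N F.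
Proof. by rewrite /zsum mulr_sumr. Qed.

Lemma zsumMr (A : pzRingType) N (F : int -> A) c :
  zsum N (fun k => F k * c) = zsum N F * c.
Proof. by rewrite /zsum mulr_suml. Qed.

Lemma zsumB (V : zmodType) N (F G : int -> V) :
  zsum N (fun k => F k - G k) = zsum N F - zsum N G.
Proof. by rewrite /zsum sumrB. Qed.

Section ZSumOrder.
Variable R : realDomainType.
Implicit Types F G : int -> R.

Lemma ler_zsum N F G : (forall k, F k <= G k) -> zsum N F <= zsum N G.
Proof. by move=> FG; apply: ler_sum. Qed.

Lemma zsum_ge0 N F : (forall k, 0 <= F k) -> 0 <= zsum N F.
Proof. by move=> F0; apply: sumr_ge0. Qed.

Lemma zsum_nd N M F : (forall k, 0 <= F k) -> (N <= M)%N -> zsum N F <= zsum M F.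
Proof.
move=> F0 /subnK <-; elim: (M - N)%N => // n IH; rewrite addSn zsumS.
by apply: (le_trans IH); rewrite -addrA addrCA lerDl addr_ge0.
Qed.

Lemma ler_norm_zsum N F : `|zsum N F| <= zsum N (fun k => `|F k|).
Proof. exact: ler_norm_sum. Qed.
End ZSumOrder.

(** * Folding Lebesgue integrals over the line onto one period *)

Section Periodization.
Variable R : realType.
Notation mu := (@lebesgue_measure R).

Lemma measurable_shift (c : R) : measurable_fun setT (fun x : R => x + c).
Proof. exact: measurable_funD. Qed.

(** Lebesgue measure is determined by its values on half-open intervals, so the pushforward under a
    translation is compared only there. *)
Lemma lebesgue_measure_shift (c : R) (A : set R) : measurable A ->
  pushforward mu (fun x : measurableTypeR R => (x + c : measurableTypeR R)) A = mu A.
Proof.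
move=> mA.
pose phi : measurableTypeR R -> measurableTypeR R := fun x => x + c.
have mphi : measurable_fun setT phi by exact: measurable_shift.
pose mphi_mixin := isMeasurableFun.Build _ _ _ _ _ mphi.
pose phi' : {mfun _ >-> _} := HB.pack phi mphi_mixin.
apply/esym/(lebesgue_measure_unique (mu := pushforward mu phi')) => //= _ [[a b]] _ <-.
rewrite /pushforward.
rewrite (_ : _ @^-1` _ = `]a - c, b - c]%classic); last first.
  by apply/seteqP; split => x /=; rewrite !in_itv /= ltrBlDr lerBrDr.
rewrite !lebesgue_measure_itv/= !lte_fin ltrD2r; case: ifP => // _.
by rewrite -!EFinB; congr EFin; lra.
Qed.

Lemma ge0_integral_shift (c : R) (f : R -> \bar R) : measurable_fun setT f ->
  (forall x, (0 <= f x)%E) ->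
  (\int[mu]_x f (x + c)%R)%E = (\int[mu]_x f x)%E.
Proof.
move=> mf f0.
have := @ge0_integral_pushforward _ _ (measurableTypeR R) (measurableTypeR R) R
  (fun x => x + c) (@measurable_shift c) mu setT f measurableT mf (fun x _ => f0 x).
rewrite preimage_setT => <-.
by apply: eq_measure_integral => [|? A mA _]; [exact: measurable_shift|exact: lebesgue_measure_shift].
Qed.

Lemma ge0_Rintegral_shift (c : R) (f : R -> R) : measurable_fun setT f ->
  (forall x, 0 <= f x) ->
  (\int[mu]_x (f (x + c)%R)%:E)%E = (\int[mu]_x (f x)%:E)%E.
Proof.
move=> mf f0; apply: (@ge0_integral_shift c (fun x => (f x)%:E)) => //.
exact/measurable_EFinP.
Qed.

(** Half-open, so that the translates by multiples of [p] partition the line. *)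
Definition cell (p : R) : set R := `[0, p[%classic.

Lemma measurable_cell p : measurable (cell p : set (measurableTypeR R)). Proof. exact: measurable_itv. Qed.

Variables (p : R) (p0 : 0 < p).

Lemma lebesgue_cell : mu (cell p) = p%:E.
Proof. by rewrite /cell lebesgue_measure_itv /= lte_fin p0 oppr0 adde0. Qed.

Lemma cell_floor (x : R) k : cell p (x - p * k%:~R) <-> k = Num.floor (x / p).
Proof.
rewrite /cell /= in_itv /= subr_ge0 ltrBlDr.
rewrite mulrC -ler_pdivlMr // -{2}[p]mul1r -mulrDl -ltr_pdivrMr // addrC.
split=> [/andP[h1 h2]|->].
  by apply/esym/Num.Theory.floor_def; rewrite h1 /= intrD.
by have := Num.Theory.floor_itv (x / p); rewrite intrD.
Qed.

Lemma indic_cell_shift (x : R) (k : int) :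
  \1_(cell p) (x - p * k%:~R) = (k == Num.floor (x / p))%:R :> R.
Proof.
rewrite indicE; congr ((nat_of_bool _)%:R); apply/idP/eqP => [/set_mem/cell_floor //|kE].
by apply/mem_set/cell_floor.
Qed.

Lemma zsum_indic_cell N (c : R) (x : R) :
  zsum N (fun k => c * \1_(cell p) (x - p * k%:~R)) =
  if (`|Num.floor (x / p)|%N <= N)%N then c else 0.
Proof.
rewrite (@zsum_single _ _ _ (Num.floor (x / p))) ?indic_cell_shift ?eqxx ?mulr1 //.
by move=> k /negPf kE; rewrite indic_cell_shift kE mulr0.
Qed.

Lemma measurable_comp_shift (f : R -> R) (c : R) : measurable_fun setT f ->
  measurable_fun setT (fun x : R => f (x + c)).
Proof. by move=> mf; apply: (measurableT_comp mf); exact: measurable_shift. Qed.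

Lemma measurable_zsum (D : set R) N (F : int -> R -> R) :
  (forall k, measurable_fun D (F k)) -> measurable_fun D (fun x => zsum N (F ^~ x)).
Proof. by move=> mF; apply: measurable_sum. Qed.

Lemma zsum_EFin N (F : int -> R) : (zsum N F)%:E = (\sum_(i < (2 * N).+1) (F (i%:Z - N%:Z))%:E)%E.
Proof. by rewrite -sumEFin. Qed.

(** Cutting [psi] by the indicators of the cells and translating each piece back to [cell p]
    produces the partial integrals; the cut functions increase to [psi], so monotone convergence
    applies. *)
Lemma ge0_integral_cells (psi : R -> R) : measurable_fun setT psi -> (forall x, 0 <= psi x) ->
  (\int[mu]_(x in cell p) (zsum N (fun k => psi (x + p * k%:~R)))%:E)%E @[N --> \oo]
   --> (\int[mu]_x (psi x)%:E)%E.
Proof.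
move=> mpsi psi0.
have mI (k : int) : measurable_fun setT (fun x : R => \1_(cell p) (x - p * k%:~R) : R).
  by apply: (@measurable_comp_shift (\1_(cell p)) (- (p * k%:~R))); apply: measurable_indic; exact: measurable_cell.
pose g N x := (zsum N (fun k => psi x * \1_(cell p) (x - p * k%:~R)))%:E.
have gE N : (\int[mu]_x g N x = \int[mu]_(x in cell p) (zsum N (fun k => psi (x + p * k%:~R)))%:E)%E.
  rewrite /g; under eq_integral do rewrite zsum_EFin.
  under [RHS]eq_integral do rewrite zsum_EFin.
  rewrite ge0_integral_sum //; last 2 first.
  - by move=> i; apply/measurable_EFinP; apply: measurable_funM => //; exact: mI.
  - by move=> i x _; rewrite lee_fin mulr_ge0 // indicE.
  rewrite ge0_integral_sum //; last 3 first.
  - exact: measurable_cell.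
  - by move=> i; apply/measurable_EFinP; apply: measurable_funTS; exact: measurable_comp_shift.
  - by move=> i x _; rewrite lee_fin.
  apply: eq_bigr => i _; set k := (X in X%:~R).
  rewrite -(@ge0_Rintegral_shift (p * k%:~R)); last 2 first.
  - apply: measurable_funM => //; exact: mI.
  - by move=> x; rewrite mulr_ge0 // indicE.
  rewrite [RHS]integral_mkcond; apply: eq_integral => x _.
  by rewrite addrK patchE indicE; case: ifP; rewrite ?mulr1 ?mulr0.
have -> : (\int[mu]_x (psi x)%:E = \int[mu]_x limn (g ^~ x))%E.
  apply: eq_integral => x _; apply/esym/cvg_lim => //.
  apply: cvg_near_cst; exists `|Num.floor (x / p)|%N => // N /= hN.
  by rewrite /g zsum_indic_cell hN.
under eq_fun do rewrite -gE.
apply: cvg_monotone_convergence => //.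
- by move=> N; apply/measurable_EFinP; apply: measurable_zsum => k; apply: measurable_funM => //; exact: mI.
- by move=> N x _; rewrite lee_fin zsum_ge0 // => k; rewrite mulr_ge0 // indicE.
- move=> x _ N M NM; rewrite lee_fin; apply: zsum_nd => // k.
  by rewrite mulr_ge0 // indicE.
Qed.

Lemma integral_cells_le (psi b : R -> R) : measurable_fun setT psi -> (forall x, 0 <= psi x) ->
  measurable_fun (cell p) b ->
  (forall x N, cell p x -> zsum N (fun k => psi (x + p * k%:~R)) <= b x) ->
  (\int[mu]_x (psi x)%:E <= \int[mu]_(x in cell p) (b x)%:E)%E.
Proof.
move=> mpsi psi0 mb psib.
have h := ge0_integral_cells mpsi psi0.
rewrite -(cvg_lim _ h) //; apply: lime_le; first by apply/cvg_ex; eexists; exact: h.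
apply: nearW => N; apply: ge0_le_integral.
- exact: measurable_cell.
- by move=> x _; rewrite lee_fin zsum_ge0.
- apply/measurable_EFinP; apply: measurable_zsum => k.
  by apply: measurable_funTS; exact: measurable_comp_shift.
- exact/measurable_EFinP.
- by move=> x px; rewrite lee_fin psib.
Qed.

Import HBNNSimple.

(* No measurability of [psi] is needed: the integral of a nonnegative function is
   the supremum of the integrals of the simple functions below it. *)
Lemma integral_cells_le_cst (psi : R -> R) C : (forall x, 0 <= psi x) -> 0 <= C ->
  (forall x N, zsum N (fun k => psi (x + p * k%:~R)) <= C) ->
  (\int[mu]_x (psi x)%:E <= (C * p)%:E)%E.
Proof.
move=> psi0 C0 psiC.
rewrite ge0_integralTE; last by move=> x; rewrite lee_fin.
apply: ge_ereal_sup => _ [h /= hpsi <-].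
rewrite -integralT_nnsfun.
apply: (@le_trans _ _ (\int[mu]_(x in cell p) (cst C x)%:E)%E).
  apply: integral_cells_le => //; first exact: (measurable_funP h).
  move=> x N _; apply: (le_trans _ (psiC x N)); apply: ler_zsum => k.
  by rewrite -lee_fin hpsi.
have -> : (\int[mu]_(x in cell p) (cst C x)%:E = C%:E * mu (cell p))%E.
  by rewrite -integral_cst //; exact: measurable_cell.
by rewrite lebesgue_cell EFinM.
Qed.

Lemma integrable_cell_bounded (f : R -> R) C : measurable_fun (cell p) f ->
  (forall x, cell p x -> `|f x| <= C) -> mu.-integrable (cell p) (EFin \o f).
Proof.
move=> mf fC; apply: measurable_bounded_integrable => //.
- exact: measurable_cell.
- by apply: (@le_lt_trans _ _ p%:E); rewrite ?ltry // -lebesgue_cell.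
- exists C; split; first exact: num_real.
  by move=> M CM x px /=; apply: le_trans (fC _ px) (ltW CM).
Qed.
End Periodization.

(** * Complex exponentials *)

Section ComplexBasics.
Variable R : realType.
Local Notation C := R[i].
Local Notation Re := complex.Re.
Local Notation Im := complex.Im.
Implicit Types (z w : C) (x y : R).

Definition cabs z : R := Num.sqrt (cmod2 z).
Definition ce (x : R) : C := Complex (cos x) (sin x).

Lemma cext z w : Re z = Re w -> Im z = Im w -> z = w.
Proof. by case: z => a b; case: w => c d /= -> ->. Qed.

Lemma cReD z w : Re (z + w) = Re z + Re w. Proof. by case: z; case: w. Qed.
Lemma cImD z w : Im (z + w) = Im z + Im w. Proof. by case: z; case: w. Qed.
Lemma cReN z : Re (- z) = - Re z. Proof. by case: z. Qed.
Lemma cImN z : Im (- z) = - Im z. Proof. by case: z. Qed.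
Lemma cReB z w : Re (z - w) = Re z - Re w. Proof. by rewrite cReD cReN. Qed.
Lemma cImB z w : Im (z - w) = Im z - Im w. Proof. by rewrite cImD cImN. Qed.
Lemma cReM z w : Re (z * w) = Re z * Re w - Im z * Im w.
Proof. by case: z; case: w. Qed.
Lemma cImM z w : Im (z * w) = Re z * Im w + Im z * Re w.
Proof. by case: z; case: w. Qed.
Definition cE := (cReD, cImD, cReN, cImN, cReM, cImM).

Lemma cRe_zsum N (F : int -> C) : Re (zsum N F) = zsum N (fun k => Re (F k)).
Proof. by rewrite /zsum; elim/big_ind2 : _ => // ? ? ? ? <- <-; rewrite cReD. Qed.
Lemma cIm_zsum N (F : int -> C) : Im (zsum N F) = zsum N (fun k => Im (F k)).
Proof. by rewrite /zsum; elim/big_ind2 : _ => // ? ? ? ? <- <-; rewrite cImD. Qed.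

Lemma rCM x y : rC (x * y) = rC x * rC y.
Proof. by apply: cext; rewrite !cE /=; ring. Qed.
Lemma rCD x y : rC (x + y) = rC x + rC y.
Proof. by apply: cext; rewrite !cE /=; ring. Qed.
Lemma rCN x : rC (- x) = - rC x.
Proof. by apply: cext; rewrite !cE /=; ring. Qed.
Lemma rC0 : rC 0 = 0 :> C. Proof. by []. Qed.
Lemma rC1 : rC 1 = 1 :> C. Proof. by []. Qed.
Lemma rC_nat n : rC n%:R = n%:R :> C.
Proof. by elim: n => [|n IH]; rewrite ?rC0 // -!natr1 rCD rC1 IH. Qed.
Lemma rC_eq0 x : (rC x == 0) = (x == 0).
Proof. by rewrite eq_complex /= eqxx andbT. Qed.
Lemma rCV x : rC x^-1 = (rC x)^-1.
Proof.
have [->|x0] := eqVneq x 0; first by rewrite rC0 !invr0.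
apply: (mulfI (_ : rC x != 0)); first by rewrite rC_eq0.
by rewrite -rCM !divff ?rC_eq0.
Qed.

Lemma cmod2_ge0 z : 0 <= cmod2 z.
Proof. by rewrite addr_ge0 // sqr_ge0. Qed.
Lemma cmod2M z w : cmod2 (z * w) = cmod2 z * cmod2 w.
Proof. by rewrite /cmod2 !cE; ring. Qed.
Lemma cmod2N z : cmod2 (- z) = cmod2 z.
Proof. by rewrite /cmod2 !cE; ring. Qed.
Lemma cmod2_conj z : cmod2 (cconj z) = cmod2 z.
Proof. by rewrite /cmod2 /=; ring. Qed.
Lemma cmod2_0 : cmod2 (0 : C) = 0. Proof. by rewrite /cmod2 /=; ring. Qed.
Lemma cmod2_eq0 z : (cmod2 z == 0) = (z == 0).
Proof. by rewrite paddr_eq0 ?sqr_ge0 // !sqrf_eq0 eq_complex. Qed.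
Lemma cmod2_rC x : cmod2 (rC x) = x ^+ 2.
Proof. by rewrite /cmod2 /=; ring. Qed.
Lemma cmod2D_le z w : cmod2 (z + w) <= 2 * cmod2 z + 2 * cmod2 w.
Proof.
rewrite /cmod2 !cE.
have := sqr_ge0 (Re z - Re w); have := sqr_ge0 (Im z - Im w); nra.
Qed.
Lemma cmod2B_le z w : cmod2 (z - w) <= 2 * cmod2 z + 2 * cmod2 w.
Proof. by rewrite -(cmod2N w); exact: cmod2D_le. Qed.

Lemma cabsE z : cabs z = ComplexField.Normc.normc z. Proof. by case: z. Qed.
Lemma cabs_ge0 z : 0 <= cabs z. Proof. exact: sqrtr_ge0. Qed.
Lemma sqr_cabs z : cabs z ^+ 2 = cmod2 z.
Proof. by rewrite sqr_sqrtr // cmod2_ge0. Qed.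
Lemma cabsM z w : cabs (z * w) = cabs z * cabs w.
Proof. by rewrite /cabs cmod2M sqrtrM // cmod2_ge0. Qed.
Lemma cabsD z w : cabs (z + w) <= cabs z + cabs w.
Proof. by rewrite !cabsE; apply: le_normcD. Qed.
Lemma cabsN z : cabs (- z) = cabs z. Proof. by rewrite /cabs cmod2N. Qed.
Lemma cabs_sub z w : cabs (z - w) = cabs (w - z). Proof. by rewrite -cabsN opprB. Qed.
Lemma cabs0 : cabs (0 : C) = 0. Proof. by rewrite /cabs cmod2_0 sqrtr0. Qed.
Lemma cabs_eq0 z : (cabs z == 0) = (z == 0).
Proof. by rewrite -cmod2_eq0 -sqr_cabs sqrf_eq0. Qed.
Lemma cabs_gt0 z : (0 < cabs z) = (z != 0).
Proof. by rewrite lt_def cabs_ge0 andbT cabs_eq0. Qed.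
Lemma cabs_rC x : cabs (rC x) = `|x|. Proof. by rewrite /cabs cmod2_rC sqrtr_sqr. Qed.
Lemma cabs1 : cabs (1 : C) = 1. Proof. by rewrite -rC1 cabs_rC normr1. Qed.
Lemma cabsV z : cabs z^-1 = (cabs z)^-1.
Proof.
have [->|z0] := eqVneq z 0; first by rewrite invr0 cabs0 invr0.
apply: (mulfI (_ : cabs z != 0)); first by rewrite cabs_eq0.
by rewrite -cabsM !divff ?cabs_eq0 ?cabs1.
Qed.
Lemma normRe_le z : `|Re z| <= cabs z.
Proof. by rewrite -sqrtr_sqr ler_wsqrtr // lerDl sqr_ge0. Qed.
Lemma normIm_le z : `|Im z| <= cabs z.
Proof. by rewrite -sqrtr_sqr ler_wsqrtr // lerDr sqr_ge0. Qed.
Lemma cabs_le z : cabs z <= `|Re z| + `|Im z|.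
Proof.
rewrite -(@ler_pXn2r _ 2) ?nnegrE ?cabs_ge0 ?addr_ge0 // sqr_cabs sqrrD !real_normK ?num_real //.
by rewrite addrAC lerDl mulrn_wge0 // mulr_ge0.
Qed.
Lemma cabs_zsum N (F : int -> C) : cabs (zsum N F) <= zsum N (fun k => cabs (F k)).
Proof.
rewrite /zsum; elim/big_ind2 : _ => [|? ? ? ? h1 h2|//]; first by rewrite cabs0.
by apply: le_trans (cabsD _ _) _; exact: lerD.
Qed.

Lemma ceD x y : ce (x + y) = ce x * ce y.
Proof. by apply: cext; rewrite !cE /= ?cosD ?sinD; ring. Qed.
Lemma ce0 : ce 0 = 1. Proof. by apply: cext; rewrite /= ?cos0 ?sin0. Qed.
Lemma cmod2_ce x : cmod2 (ce x) = 1. Proof. by rewrite /cmod2 /= cos2Dsin2. Qed.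
Lemma cabs_ce x : cabs (ce x) = 1. Proof. by rewrite /cabs cmod2_ce sqrtr1. Qed.
Lemma ce_neq0 x : ce x != 0. Proof. by rewrite -cmod2_eq0 cmod2_ce oner_eq0. Qed.
Lemma ceN x : ce (- x) = (ce x)^-1.
Proof. by apply: (mulfI (ce_neq0 x)); rewrite -ceD subrr ce0 divff // ce_neq0. Qed.
Lemma ce_conj x : cconj (ce x) = ce (- x).
Proof. by rewrite /ce cosN sinN. Qed.
Lemma cexp_ce x : cexp (cI R * rC x) = ce x.
Proof.
have -> : cI R * rC x = Complex 0 x by apply: cext; rewrite !cE /=; ring.
by rewrite /cexp /= expR0 !mul1r.
Qed.
Lemma cexpE z : cexp z = rC (expR (Re z)) * ce (Im z).
Proof. by apply: cext; rewrite !cE /=; ring. Qed.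
Lemma cexpD z w : cexp (z + w) = cexp z * cexp w.
Proof. by rewrite !cexpE !cE expRD rCM ceD; ring. Qed.
Lemma cexp0 : cexp (0 : C) = 1. Proof. by rewrite cexpE /= expR0 ce0 mulr1. Qed.
Lemma cabs_cexp z : cabs (cexp z) = expR (Re z).
Proof. by rewrite cexpE cabsM cabs_ce mulr1 cabs_rC gtr0_norm // expR_gt0. Qed.
Lemma cexp_neq0 z : cexp z != 0.
Proof. by rewrite -cabs_gt0 cabs_cexp expR_gt0. Qed.
Lemma cexpN z : cexp (- z) = (cexp z)^-1.
Proof.
by apply: (mulfI (cexp_neq0 z)); rewrite -cexpD subrr cexp0 divff // cexp_neq0.
Qed.

Lemma cconjD z w : cconj (z + w) = cconj z + cconj w.
Proof. by apply: cext; rewrite /= ?cE /=; ring. Qed.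
Lemma cconjM z w : cconj (z * w) = cconj z * cconj w.
Proof. by apply: cext; rewrite /= ?cE /=; ring. Qed.
Lemma cconj_zsum N (F : int -> C) : cconj (zsum N F) = zsum N (fun k => cconj (F k)).
Proof.
by rewrite /zsum; elim/big_ind2 : _ => [|? ? ? ? <- <-|//]; rewrite ?cconjD // /cconj /= oppr0.
Qed.
Lemma mul_conj z : z * cconj z = rC (cmod2 z).
Proof. by apply: cext; rewrite !cE /= /cmod2; ring. Qed.

Lemma ce_2pi_int (k : int) : ce (2%:R * pi * k%:~R) = 1.
Proof.
have h n : ce (2%:R * pi * n%:R) = 1.
  elim: n => [|n IH]; first by rewrite mulr0 ce0.
  rewrite -[n.+1%:R]natr1 mulrDr ceD IH mul1r mulr1 mulr_natl.
  by apply: cext; rewrite /= ?cos2pi ?sin2pi.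
case: k => n; first by rewrite h.
by rewrite NegzE mulrNz mulrN ceN h invr1.
Qed.
Lemma ce_period x k : ce (x + 2%:R * pi * k%:~R) = ce x.
Proof. by rewrite ceD ce_2pi_int mulr1. Qed.
Lemma ce_int_period (k j : int) x : ce (j%:~R * (x + 2%:R * pi * k%:~R)) = ce (j%:~R * x).
Proof.
rewrite mulrDr (_ : j%:~R * (_ * _) = 2%:R * pi * (j * k)%:~R) ?ce_period //.
by rewrite intrM; ring.
Qed.
End ComplexBasics.

(** * Complex-valued integrals *)

Section ComplexIntegral.
Variable R : realType.
Local Notation C := R[i].
Local Notation Re := complex.Re.
Local Notation Im := complex.Im.
Notation mu := (@lebesgue_measure R).
Implicit Types (f g : R -> C) (D : set R).

Definition cmeas D f := measurable_fun D (fun x => Re (f x)) /\ measurable_fun D (fun x => Im (f x)).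
Definition cinteg D f := mu.-integrable D (EFin \o (fun x => Re (f x))) /\
  mu.-integrable D (EFin \o (fun x => Im (f x))).
Definition cintS D f : C := Complex (\int[mu]_(x in D) Re (f x)) (\int[mu]_(x in D) Im (f x)).

Lemma cmeasD D f g : cmeas D f -> cmeas D g -> cmeas D (fun x => f x + g x).
Proof.
move=> [f1 f2] [g1 g2]; split.
  by under eq_fun do rewrite cReD; exact: measurable_funD.
by under eq_fun do rewrite cImD; exact: measurable_funD.
Qed.

Lemma cmeasM D f g : cmeas D f -> cmeas D g -> cmeas D (fun x => f x * g x).
Proof.
move=> [f1 f2] [g1 g2]; split.
  by under eq_fun do rewrite cReM; apply: measurable_funB; exact: measurable_funM.
by under eq_fun do rewrite cImM; apply: measurable_funD; exact: measurable_funM.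
Qed.

Lemma cmeas_cst D (c : C) : cmeas D (fun=> c). Proof. by split; exact: measurable_cst. Qed.

Lemma cmeasN D f : cmeas D f -> cmeas D (fun x => - f x).
Proof.
move=> [f1 f2]; split.
  by under eq_fun do rewrite cReN; exact: measurable_funN.
by under eq_fun do rewrite cImN; exact: measurable_funN.
Qed.

Lemma cmeasB D f g : cmeas D f -> cmeas D g -> cmeas D (fun x => f x - g x).
Proof. by move=> cf cg; apply: cmeasD => //; exact: cmeasN. Qed.

Lemma cmeas_zsum D N (F : int -> R -> C) : (forall k, cmeas D (F k)) ->
  cmeas D (fun x => zsum N (F ^~ x)).
Proof.
move=> cF; split.
  by under eq_fun do rewrite cRe_zsum; apply: measurable_zsum => k; apply: (cF k).1.
by under eq_fun do rewrite cIm_zsum; apply: measurable_zsum => k; apply: (cF k).2.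
Qed.

Lemma measurable_cmod2 D f : cmeas D f -> measurable_fun D (fun x => cmod2 (f x)).
Proof. by move=> [f1 f2]; apply: measurable_funD; exact: measurable_funX. Qed.

Lemma measurable_inv : measurable_fun setT (@GRing.inv R).
Proof.
have -> : @GRing.inv R = (fun x => if 0 < x then expR (- ln x) else
    if x < 0 then - expR (- ln (- x)) else 0).
  apply/funext => x; case: ltgtP => [x0|x0|<-]; last by rewrite invr0.
    by rewrite expRN lnK // posrE.
  by rewrite expRN lnK ?posrE ?oppr_gt0 // invrN opprK.
apply: measurable_fun_ifT; first exact: measurable_fun_ltr.
  apply: (measurableT_comp (@measurable_expR R)).
  by apply: measurable_funN; exact: measurable_ln.
apply: measurable_fun_ifT; [exact: measurable_fun_ltr| |exact: measurable_cst].
apply: measurable_funN; apply: (measurableT_comp (@measurable_expR R)).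
apply: measurable_funN; apply: (measurableT_comp (@measurable_ln R)).
exact: measurable_funN.
Qed.

Lemma measurable_sqrt : measurable_fun setT (@Num.sqrt R).
Proof. exact: (continuous_measurable_fun (@sqrt_continuous R)). Qed.

Lemma measurable_cabs D f : cmeas D f -> measurable_fun D (fun x => cabs (f x)).
Proof.
move=> cf; apply: (measurableT_comp measurable_sqrt); exact: measurable_cmod2.
Qed.

Lemma cmeas_rC D (f : R -> R) : measurable_fun D f -> cmeas D (fun x => rC (f x)).
Proof. by move=> mf; split => //=; exact: measurable_cst. Qed.

Lemma cmeas_ce D (f : R -> R) : measurable_fun D f -> cmeas D (fun x => ce (f x)).
Proof.
move=> mf; split => /=.
  by apply: (measurableT_comp (continuous_measurable_fun (@continuous_cos R))).
by apply: (measurableT_comp (continuous_measurable_fun (@continuous_sin R))).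
Qed.

Lemma cmeas_conj D f : cmeas D f -> cmeas D (fun x => cconj (f x)).
Proof. by move=> [f1 f2]; split => //=; exact: measurable_funN. Qed.

Lemma cmeasV D f : cmeas D f -> cmeas D (fun x => (f x)^-1).
Proof.
move=> cf.
have -> : (fun x => (f x)^-1) = (fun x => cconj (f x) * rC ((cmod2 (f x))^-1)).
  apply/funext => x; rewrite rCV -mul_conj.
  have [->|fx0] := eqVneq (f x) 0; first by rewrite mul0r invr0 mulr0.
  have h : cconj (f x) != 0 by rewrite -cmod2_eq0 cmod2_conj cmod2_eq0.
  by rewrite invfM mulrCA divff ?mulr1.
apply: cmeasM; first exact: cmeas_conj.
apply: cmeas_rC; apply: (measurableT_comp measurable_inv).
exact: measurable_cmod2.
Qed.

Variables (D : set (measurableTypeR R)) (mD : measurable D).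

Lemma cinteg_add f g : cinteg D f -> cinteg D g -> cinteg D (fun x => f x + g x).
Proof.
move=> [f1 f2] [g1 g2]; split.
  apply: (eq_integrable mD _ _ _ (integrableD mD f1 g1)) => x _ /=.
  by rewrite cReD.
apply: (eq_integrable mD _ _ _ (integrableD mD f2 g2)) => x _ /=.
by rewrite cImD.
Qed.

Lemma integrableZ_real (f : R -> R) (c : R) : mu.-integrable D (EFin \o f) ->
  mu.-integrable D (EFin \o (fun x => c * f x)).
Proof. by move=> fi; exact: (integrableZl mD c fi). Qed.

Lemma cinteg_Zl f c : cinteg D f -> cinteg D (fun x => c * f x).
Proof.
move=> [f1 f2]; split.
  apply: (eq_integrable mD _ _ _ (integrableB mD (integrableZ_real (Re c) f1)
    (integrableZ_real (Im c) f2))) => x _ /=.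
  by rewrite cReM.
apply: (eq_integrable mD _ _ _ (integrableD mD (integrableZ_real (Re c) f2)
  (integrableZ_real (Im c) f1))) => x _ /=.
by rewrite cImM.
Qed.

Lemma cinteg0 : cinteg D (fun=> 0).
Proof. by split; exact: integrable0. Qed.

Lemma cintS_add f g : cinteg D f -> cinteg D g ->
  cintS D (fun x => f x + g x) = cintS D f + cintS D g.
Proof.
move=> [f1 f2] [g1 g2]; apply: cext; rewrite !cE /=.
  by under eq_Rintegral do rewrite cReD; rewrite RintegralD.
by under eq_Rintegral do rewrite cImD; rewrite RintegralD.
Qed.

Lemma cintS_Zl f c : cinteg D f -> cintS D (fun x => c * f x) = c * cintS D f.
Proof.
move=> [f1 f2]; apply: cext; rewrite !cE /=.
  under eq_Rintegral do rewrite cReM.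
  by rewrite RintegralB ?RintegralZl //; exact: integrableZ_real.
under eq_Rintegral do rewrite cImM.
by rewrite RintegralD ?RintegralZl //; exact: integrableZ_real.
Qed.

Lemma cinteg_zsum N (F : int -> R -> C) : (forall k, cinteg D (F k)) ->
  cinteg D (fun x => zsum N (F ^~ x)).
Proof.
move=> iF; rewrite /zsum; elim: (index_enum _) => [|i s IHs].
  by under eq_fun do rewrite big_nil; exact: cinteg0.
by under eq_fun do rewrite big_cons; exact: cinteg_add.
Qed.

Lemma cintS_zsum N (F : int -> R -> C) : (forall k, cinteg D (F k)) ->
  cintS D (fun x => zsum N (F ^~ x)) = zsum N (fun k => cintS D (F k)).
Proof.
move=> iF; rewrite /zsum.
elim: (index_enum _) => [|i s IHs].
  rewrite big_nil; under [X in cintS _ X]eq_fun do rewrite big_nil.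
  by apply: cext; rewrite /= /Rintegral integral0.
rewrite big_cons -IHs; under [X in cintS _ X]eq_fun do rewrite big_cons.
rewrite cintS_add //.
have : cinteg D (fun x => \sum_(j <- s) F (Posz j - Posz N) x).
  elim: s {IHs} => [|j s IHs].
    by under eq_fun do rewrite big_nil; exact: cinteg0.
  by under eq_fun do rewrite big_cons; exact: cinteg_add.
by [].
Qed.
End ComplexIntegral.

(** * Orthogonality of the exponentials on a period *)

Section Orthogonality.
Variable R : realType.
Local Notation C := R[i].
Local Notation Re := complex.Re.
Local Notation Im := complex.Im.
Notation mu := (@lebesgue_measure R).

Lemma Rintegral_cell_FTC (p : R) (f F : R -> R) : 0 < p -> continuous f ->
  (forall x : R, is_derive x (1 : R) F (f x)) -> \int[mu]_(x in cell p) f x = F p - F 0.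
Proof.
move=> p0 cf dF.
have cF x : {for x, continuous F}.
  by apply: differentiable_continuous; apply/derivable1_diffP; exact: @ex_derive.
have wcf : {within `[0, p], continuous f} by apply: continuous_subspaceT.
have fi : mu.-integrable `[0, p] (EFin \o f).
  by apply: continuous_compact_integrable => //; exact: segment_compact.
rewrite Rintegral_itv_bndo_bndc; last first.
  by apply: integrableS fi => //; apply: subset_itvl; rewrite bnd_simp.
rewrite /Rintegral (@continuous_FTC2 _ f F 0 p) //.
  split => [x _| |].
  - exact: @ex_derive.
  - exact: (cvg_at_right_filter (cF 0)).
  - exact: (cvg_at_left_filter (cF p)).
by move=> x _; rewrite derive1E; apply: derive_val.
Qed.

Local Notation tpi := (2%:R * pi : R).
Lemma tpi_gt0 : 0 < tpi. Proof. by rewrite mulr_gt0 // pi_gt0. Qed.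

Lemma Rintegral_cell_cst (c : R) : \int[mu]_(x in cell tpi) c = c * tpi.
Proof.
rewrite (Rintegral_cst mu (@measurable_cell R tpi)); congr (c * _).
by rewrite [X in fine X](@lebesgue_cell R _ tpi_gt0).
Qed.

Lemma cintS_cell_ce (n : int) :
  cintS (cell tpi) (fun x => ce (n%:~R * x)) = if n == 0 then rC tpi else 0.
Proof.
case: eqVneq => [->|n0].
  apply: cext => /=.
    by under eq_Rintegral do rewrite mul0r cos0; rewrite Rintegral_cell_cst mul1r.
  by under eq_Rintegral do rewrite mul0r sin0; rewrite Rintegral_cell_cst mul0r.
have nR0 : n%:~R != 0 :> R by rewrite intr_eq0.
have e1 : ce (n%:~R * tpi) = 1 :> C by rewrite mulrC ce_2pi_int.
have dM (x : R) : is_derive x (1 : R) (fun y : R => n%:~R * y) (n%:~R).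
  by apply: is_derive_eq; rewrite /= /GRing.scale /= mulr1.
have dS (x : R) : is_derive x (1 : R) (fun y : R => n%:~R^-1 * sin (n%:~R * y)) (cos (n%:~R * x)).
  apply: is_derive_eq; rewrite /= /GRing.scale /= ?mulr1 mulrCA mulVf ?mulr1 //.
have dC (x : R) : is_derive x (1 : R) (fun y : R => - n%:~R^-1 * cos (n%:~R * y)) (sin (n%:~R * x)).
  apply: is_derive_eq; rewrite /= /GRing.scale /=.
  by rewrite mulNr mulNr mulrN opprK mulrCA mulVf ?mulr1.
apply: cext => /=.
  rewrite (Rintegral_cell_FTC tpi_gt0 _ dS).
  - have /= -> := congr1 (@complex.Im R) e1; by rewrite !mulr0 sin0 !mulr0 subrr.
  - move=> x; apply: continuous_comp; last exact: continuous_cos.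
    exact: mulrl_continuous.
rewrite (Rintegral_cell_FTC tpi_gt0 _ dC).
- have /= -> := congr1 (@complex.Re R) e1; by rewrite mulr0 cos0 subrr.
- move=> x; apply: continuous_comp; last exact: continuous_sin.
  exact: mulrl_continuous.
Qed.
End Orthogonality.

(** * Stability of integer translates *)

Section Bessel.
Variable R : realType.
Local Notation C := R[i].
Local Notation Re := complex.Re.
Local Notation Im := complex.Im.
Notation mu := (@lebesgue_measure R).
Local Notation tpi := (2%:R * pi : R).
Implicit Types (G : R -> C) (d : int -> C).

Definition trigpoly N d (xi : R) : C := zsum N (fun k => d k * ce (- (k%:~R * xi))).

(** The inverse Fourier transform, normalized as in [invFT]; applied to Xi^w it is the scalar
    B-spline of complex order w. *)
Definition ft G (t : R) : C := cintS setT (fun xi => G xi * ce (xi * t)) / rC tpi.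

(* [K] bounds the periodization of |G|; summability at infinity and Young-type bounds on
   the translates of [ft G] all follow from this single condition. *)
Definition adm G (K : R) := cmeas setT G /\
  forall x N, cell tpi x -> zsum N (fun k => cabs (G (x + tpi * k%:~R))) <= K.

Lemma adm_ge0 G K : adm G K -> 0 <= K.
Proof.
case=> _ /(_ 0 0%N) h; apply: le_trans (h _); first by rewrite zsum_ge0 // => k; exact: cabs_ge0.
by rewrite /cell /= in_itv /= lexx tpi_gt0.
Qed.

Lemma adm_mul G K h B : adm G K -> cmeas setT h -> (forall x, cabs (h x) <= B) ->
  adm (fun x => G x * h x) (K * B).
Proof.
move=> [mG bG] mh hB; split; first exact: cmeasM.
have B0 : 0 <= B by exact: le_trans (cabs_ge0 _) (hB 0).
move=> x N cx; apply: (@le_trans _ _ (zsum N (fun k => cabs (G (x + tpi * k%:~R)) * B))).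
  by apply: ler_zsum => k; rewrite cabsM ler_wpM2l ?cabs_ge0.
by rewrite zsumMr ler_wpM2r ?bG.
Qed.

Lemma adm_div G K P c : adm G K -> cmeas setT P -> 0 < c -> (forall x, c <= cabs (P x)) ->
  adm (fun x => G x * (P x)^-1) (K / c).
Proof.
move=> aG mP c0 Pc; apply: adm_mul => //; first exact: cmeasV.
by move=> x; rewrite cabsV lef_pV2 // posrE // (lt_le_trans c0).
Qed.

Lemma trigpoly_period N d x k : trigpoly N d (x + tpi * k%:~R) = trigpoly N d x.
Proof.
by apply: eq_zsum => j _; rewrite !ceN ce_int_period.
Qed.

Lemma cabs_trigpoly N d x : cabs (trigpoly N d x) <= zsum N (fun k => cabs (d k)).
Proof.
apply: le_trans (cabs_zsum _ _) _; apply: ler_zsum => k.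
by rewrite cabsM cabs_ce mulr1.
Qed.

Lemma cmeas_trigpoly D N d : cmeas D (trigpoly N d).
Proof.
apply: (@cmeas_zsum _ _ _ (fun k x => d k * ce (- (k%:~R * x)))) => k.
apply: cmeasM; first exact: cmeas_cst.
by apply: cmeas_ce; apply: measurable_funN; apply: measurable_funM => //; exact: measurable_cst.
Qed.

Lemma cmod2_le z (B : R) : cabs (z : C) <= B -> cmod2 z <= B ^+ 2.
Proof. by move=> zB; rewrite -sqr_cabs ler_pXn2r // nnegrE ?cabs_ge0 // (le_trans (cabs_ge0 _) zB). Qed.

(** Parseval: the squared modulus is a double sum of exponentials of integer frequency j - k, and
    only the diagonal survives integration over a period. *)
Lemma integral_cmod2_trigpoly N d :
  \int[mu]_(x in cell tpi) cmod2 (trigpoly N d x) = tpi * zsum N (fun k => cmod2 (d k)).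
Proof.
have mc := @measurable_cell R tpi.
pose F k j x : C := (d k * cconj (d j)) * ce ((j - k)%:~R * x).
have iF k j : cinteg (cell tpi) (fun x => ce ((j - k)%:~R * x) : C).
  have [m1 m2] : cmeas (cell tpi) (fun x => ce ((j - k)%:~R * x) : C).
    by apply: cmeas_ce; apply: measurable_funM => //; exact: measurable_cst.
  split; (apply: (@integrable_cell_bounded _ _ (tpi_gt0 R) _ 1) => // x _).
    by apply: le_trans (normRe_le _) _; rewrite cabs_ce.
  by apply: le_trans (normIm_le _) _; rewrite cabs_ce.
have E x : rC (cmod2 (trigpoly N d x)) = zsum N (fun k => zsum N (fun j => F k j x)).
  rewrite -mul_conj {1}/trigpoly -zsumMr; apply: eq_zsum => k _.
  rewrite /trigpoly cconj_zsum -zsumMl; apply: eq_zsum => j _.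
  rewrite cconjM ce_conj opprK /F intrB mulrBl ceD; ring.
have -> : \int[mu]_(x in cell tpi) cmod2 (trigpoly N d x) =
    Re (cintS (cell tpi) (fun x => zsum N (fun k => zsum N (fun j => F k j x)))).
  by rewrite /=; apply: eq_Rintegral => x _; rewrite -E.
rewrite (@cintS_zsum _ _ mc N (fun k x => zsum N (fun j => F k j x))); last first.
  move=> k; apply: (@cinteg_zsum _ _ mc N (F k)) => j.
  exact: cinteg_Zl.
rewrite cRe_zsum -zsumMl; apply: eq_zsum => k kN.
rewrite (@cintS_zsum _ _ mc N (F k)); last by move=> j; exact: cinteg_Zl.
rewrite (@zsum_single _ _ _ k) => [|j jk].
  by rewrite kN cintS_Zl // cintS_cell_ce subrr eqxx mul_conj !cE /= mulr0 subr0 mulrC.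
by rewrite cintS_Zl // cintS_cell_ce subr_eq0 (negPf jk) mulr0.
Qed.

(** A periodic weight factors out of the periodization of |G| psi, leaving at most [K * psi] on one
    cell. Integrals over the line thus become period integrals, where Parseval is available. *)
Lemma adm_dominated G K (phi psi : R -> R) B : adm G K ->
  measurable_fun setT phi -> measurable_fun setT psi -> (forall x, 0 <= psi x <= B) ->
  (forall x k, psi (x + tpi * k%:~R) = psi x) ->
  (forall x, `|phi x| <= cabs (G x) * psi x) ->
  mu.-integrable setT (EFin \o phi) /\
  `|\int[mu]_x phi x| <= K * \int[mu]_(x in cell tpi) psi x.
Proof.
move=> aG mphi mpsi psiB psip phipsi.
have K0 := adm_ge0 aG; case: aG => mG aG.
have mc := @measurable_cell R tpi.
have ipsi : mu.-integrable (cell tpi) (EFin \o psi).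
  apply: (@integrable_cell_bounded _ _ (tpi_gt0 R) _ B) => [|x _]; first exact: measurable_funTS.
  by have /andP[h1 h2] := psiB x; rewrite ger0_norm.
have iKpsi := integrableZ_real mc K ipsi.
have le1 : (\int[mu]_x (`|phi x|)%:E <= \int[mu]_(x in cell tpi) (K * psi x)%:E)%E.
  apply: (integral_cells_le (tpi_gt0 R)) => //.
  - exact: measurableT_comp.
  - by apply: measurable_funTS; exact: measurable_funM.
  - move=> x N cx; apply: le_trans (_ : zsum N (fun k => cabs (G (x + tpi * k%:~R)) * psi x) <= _).
      by apply: ler_zsum => k; rewrite -(psip x k).
    by rewrite zsumMr ler_wpM2r //; [have /andP[] := psiB x|exact: aG].
have iphi : mu.-integrable setT (EFin \o phi).
  apply/integrableP; split; first exact/measurable_EFinP.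
  apply: le_lt_trans le1 _.
  by have := integrable_fin_num mc iKpsi; rewrite fin_numE ltey => /andP[].
split => //.
apply: le_trans (le_normr_Rintegral _ iphi) _ => //.
rewrite -RintegralZl // /Rintegral fine_le //.
  exact: (integrable_fin_num measurableT (integrable_norm iphi)).
exact: (integrable_fin_num mc iKpsi).
Qed.

Lemma adm_cinteg G K (h : R -> C) B : adm G K -> cmeas setT h ->
  (forall x, cabs (h x) <= B) -> cinteg setT (fun x => G x * h x).
Proof.
move=> aG mh hB.
have B0 : 0 <= B by exact: le_trans (cabs_ge0 _) (hB 0).
have [m1 m2] : cmeas setT (fun x => G x * h x) by apply: cmeasM => //; case: aG.
split.
  apply: (adm_dominated (psi := fun=> B) (B := B) aG _ _ _ _ _).1 => // [x|x].
    by rewrite B0 lexx.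
  apply: le_trans (normRe_le _) _; rewrite cabsM ler_wpM2l //; exact: cabs_ge0.
apply: (adm_dominated (psi := fun=> B) (B := B) aG _ _ _ _ _).1 => // [x|x].
  by rewrite B0 lexx.
apply: le_trans (normIm_le _) _; rewrite cabsM ler_wpM2l //; exact: cabs_ge0.
Qed.

Lemma cmeas_ce_mul D (t : R) : cmeas D (fun xi => ce (xi * t) : C).
Proof. by apply: cmeas_ce; apply: measurable_funM => //; exact: measurable_cst. Qed.

Lemma adm_cinteg_ce G K t : adm G K -> cinteg setT (fun xi => G xi * ce (xi * t)).
Proof.
move=> aG; apply: (adm_cinteg (B := 1) aG); first exact: cmeas_ce_mul.
by move=> x; rewrite cabs_ce.
Qed.

(** The weight is chosen so that, after multiplication by the constant [K] of [adm_dominated], the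
    term in y has coefficient exactly 1/2 and can be absorbed. *)
Lemma amgm (K x y : R) : 0 < K -> x * y <= (K * x ^+ 2 + K^-1 * y ^+ 2) / 2%:R.
Proof.
move=> K0; rewrite ler_pdivlMr ?ltr0n // -subr_ge0.
have -> : K * x ^+ 2 + K^-1 * y ^+ 2 - x * y * 2%:R = K * (x - K^-1 * y) ^+ 2.
  by field; rewrite gt_eqF.
by rewrite mulr_ge0 ?sqr_ge0 // ltW.
Qed.

(* Duality: the left-hand sum X is the integral of [G] against the product of the
   trigonometric polynomials of [d] and of the conjugated samples, and AM-GM weighted
   by [K] bounds this integral by [(K^2 ||d||^2 + X) / 2]. *)
Lemma sum_samples_le G K N d (t : R) M : 0 < K -> adm G K ->
  zsum M (fun m => cmod2 (zsum N (fun k => d k * ft G (t + m%:~R - k%:~R))))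
  <= K ^+ 2 * zsum N (fun k => cmod2 (d k)).
Proof.
move=> K0 aG; have [h hE] : exists h : int -> C,
    forall m, h m = zsum N (fun k => d k * ft G (t + m%:~R - k%:~R)) by eexists.
rewrite (_ : zsum M _ = zsum M (fun m => cmod2 (h m))); last first.
  by apply: eq_zsum => m _; rewrite hE.
set X := zsum M _.
pose Phi m k xi : C := (cconj (h m) * d k) * (G xi * ce (xi * (t + m%:~R - k%:~R))).
pose phi xi := zsum M (fun m => zsum N (fun k => Phi m k xi)).
have iPhi m k : cinteg setT (Phi m k).
  by apply: cinteg_Zl => //; apply: adm_cinteg_ce aG.
have tpi0 : rC tpi != 0 :> C by rewrite rC_eq0 gt_eqF // tpi_gt0.
have XE : rC (X * tpi) = cintS setT phi.
  rewrite /phi (@cintS_zsum _ _ measurableT M (fun m xi => zsum N (fun k => Phi m k xi))); last first.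
    by move=> m; apply: (@cinteg_zsum _ _ measurableT N (Phi m)).
  have -> : rC (X * tpi) = zsum M (fun m => cconj (h m) * h m * rC tpi).
    rewrite zsumMr rCM; congr (_ * _); apply: cext; rewrite ?cRe_zsum ?cIm_zsum /=.
      by apply: eq_zsum => m _; rewrite mulrC mul_conj.
    by apply/esym/zsum_eq0 => m _; rewrite mulrC mul_conj.
  apply: eq_zsum => m _; rewrite (@cintS_zsum _ _ measurableT N (Phi m)) //.
  rewrite [X in _ * X * _]hE -zsumMl -zsumMr; apply: eq_zsum => k _.
  rewrite /Phi cintS_Zl //; last exact: adm_cinteg_ce aG.
  by rewrite /ft !mulrA divfK.
have phiE xi : phi xi = G xi * (ce (xi * t) * cconj (trigpoly M h xi) * trigpoly N d xi).
  have -> (a b c : C) : G xi * (a * b * c) = b * (c * (G xi * a)) by ring.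
  rewrite /phi /trigpoly cconj_zsum -zsumMr; apply: eq_zsum => m _.
  rewrite -zsumMr -zsumMl; apply: eq_zsum => k _; rewrite cconjM ce_conj opprK /Phi.
  rewrite mulrBr mulrDr !ceD (mulrC xi m%:~R) (mulrC xi k%:~R); ring.
pose psi xi := (K * cmod2 (trigpoly N d xi) + K^-1 * cmod2 (trigpoly M h xi)) / 2%:R.
pose B1 := zsum N (fun k => cabs (d k)); pose B2 := zsum M (fun k => cabs (h k)).
have mphi : cmeas setT phi.
  have -> : phi = (fun xi => G xi * (ce (xi * t) * cconj (trigpoly M h xi) * trigpoly N d xi)).
    by apply/funext => xi; rewrite phiE.
  apply: cmeasM; first by case: aG.
  apply: cmeasM; last exact: cmeas_trigpoly.
  by apply: cmeasM; [exact: cmeas_ce_mul|apply: cmeas_conj; exact: cmeas_trigpoly].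
have mtp D N' d' : measurable_fun D (fun xi => cmod2 (trigpoly N' d' xi)).
  by apply: measurable_cmod2; exact: cmeas_trigpoly.
have KV0 : 0 < K^-1 by rewrite invr_gt0.
have psi1 : measurable_fun setT psi.
  by apply: measurable_funM => //; apply: measurable_funD; apply: measurable_funM.
have psi2 x : 0 <= psi x <= (K * B1 ^+ 2 + K^-1 * B2 ^+ 2) / 2%:R.
  apply/andP; split.
    by rewrite divr_ge0 ?ler0n // addr_ge0 // mulr_ge0 ?cmod2_ge0 // ltW.
  rewrite ler_pM2r ?invr_gt0 ?ltr0n //.
  by apply: lerD; (rewrite ler_pM2l //; apply: cmod2_le; exact: cabs_trigpoly).
have psi3 x k : psi (x + tpi * k%:~R) = psi x by rewrite /psi !trigpoly_period.
have psi4 x : `|Re (phi x)| <= cabs (G x) * psi x.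
  apply: le_trans (normRe_le _) _.
  rewrite phiE cabsM ler_wpM2l ?cabs_ge0 // !cabsM cabs_ce mul1r /psi -!sqr_cabs mulrC.
  rewrite [cabs (cconj _)]/cabs cmod2_conj; exact: amgm.
have [_] := adm_dominated aG mphi.1 psi1 psi2 psi3 psi4.
move=> /(le_trans (ler_norm _)).
have -> : \int[mu]_x Re (phi x) = X * tpi by have /= := congr1 (@complex.Re R) XE.
have ic a N' d' : mu.-integrable (cell tpi) (EFin \o (fun xi => a * cmod2 (trigpoly N' d' xi))).
  apply: integrableZ_real; first exact: measurable_cell.
  apply: (@integrable_cell_bounded _ _ (tpi_gt0 R) _ (zsum N' (fun k => cabs (d' k)) ^+ 2)) => // x _.
  by rewrite ger0_norm ?cmod2_ge0 //; apply: cmod2_le; exact: cabs_trigpoly.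
have mc := @measurable_cell R tpi.
have ic1 N' d' : mu.-integrable (cell tpi) (EFin \o (fun xi => cmod2 (trigpoly N' d' xi))).
  by have := ic 1 N' d'; under eq_fun do rewrite mul1r.
rewrite /psi RintegralZr //; last exact: (integrableD mc (ic _ _ _) (ic _ _ _)).
rewrite RintegralD // !RintegralZl // !integral_cmod2_trigpoly.
rewrite -/X; set Y := zsum N _.
have -> : K * ((K * (tpi * Y) + K^-1 * (tpi * X)) / 2%:R) = (K ^+ 2 * Y + X) / 2%:R * tpi.
  by field; rewrite gt_eqF.
(* X stands on both sides; being a finite sum it may be absorbed, which leaves X <= K^2 Y. *)
rewrite ler_pM2r ?tpi_gt0 // ler_pdivlMr ?ltr0n //; lra.
Qed.
End Bessel.

(** * Periodization of signed integrands and values at the integers *)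

Section SignedPeriodization.
Variable R : realType.
Local Notation C := R[i].
Local Notation Re := complex.Re.
Local Notation Im := complex.Im.
Notation mu := (@lebesgue_measure R).

Section Real.
Variables (p : R) (p0 : 0 < p) (phi s : R -> R) (K : R).
Hypothesis mphi : measurable_fun setT phi.
Hypothesis phiK : forall x N, cell p x -> zsum N (fun k => `|phi (x + p * k%:~R)|) <= K.

Let mcell := @measurable_cell R p.

Let integrable_ge0 (psi : R -> R) B : measurable_fun setT psi -> (forall x, 0 <= psi x) ->
  (forall x N, cell p x -> zsum N (fun k => psi (x + p * k%:~R)) <= B) ->
  mu.-integrable setT (EFin \o psi).
Proof.
move=> mpsi psi0 psiB; apply/integrableP; split; first exact/measurable_EFinP.
under eq_integral do rewrite /= ger0_norm //.
apply: le_lt_trans (integral_cells_le p0 mpsi psi0 (b := fun=> B) _ _) _ => //.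
have -> : (\int[mu]_(x in cell p) B%:E = B%:E * mu (cell p))%E.
  by rewrite -integral_cst.
by rewrite (lebesgue_cell p0) -EFinM ltry.
Qed.

Let cvg_ge0 (psi : R -> R) B : measurable_fun setT psi -> (forall x, 0 <= psi x) ->
  (forall x N, cell p x -> zsum N (fun k => psi (x + p * k%:~R)) <= B) ->
  \int[mu]_(x in cell p) (zsum N (fun k => psi (x + p * k%:~R))) @[N --> \oo] --> \int[mu]_x psi x.
Proof.
move=> mpsi psi0 psiB; apply: fine_cvg; rewrite fineK; first exact: ge0_integral_cells.
exact: (integrable_fin_num measurableT (integrable_ge0 mpsi psi0 psiB)).
Qed.

Let mzs (psi : R -> R) N : measurable_fun setT psi ->
  measurable_fun (cell p) (fun x => zsum N (fun k => psi (x + p * k%:~R))).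
Proof.
move=> mpsi; apply: (@measurable_zsum _ _ _ (fun k x => psi (x + p * k%:~R))) => k.
by apply: measurable_funTS; exact: measurable_comp_shift.
Qed.

(** Reduced to nonnegative integrands by phi = (phi + |phi|) - |phi|. *)
Lemma cvg_Rintegral_cells :
  \int[mu]_(x in cell p) (zsum N (fun k => phi (x + p * k%:~R))) @[N --> \oo] --> \int[mu]_x phi x.
Proof.
have m1 : measurable_fun setT (fun x => `|phi x|) by exact: measurableT_comp.
have m2 : measurable_fun setT (fun x => phi x + `|phi x|) by exact: measurable_funD.
have p2 x : 0 <= phi x + `|phi x| by rewrite -lerBlDl sub0r ler_normr lexx orbT.
have b2 x N : cell p x -> zsum N (fun k => phi (x + p * k%:~R) + `|phi (x + p * k%:~R)|) <= K + K.
  move=> cx; rewrite zsumD lerD ?phiK //; apply: le_trans (phiK N cx).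
  by apply: ler_zsum => k; exact: ler_norm.
have i1 := integrable_ge0 m1 (fun x => normr_ge0 _) phiK.
have i2 := integrable_ge0 m2 p2 b2.
have -> : \int[mu]_x phi x = \int[mu]_x (phi x + `|phi x|) - \int[mu]_x `|phi x|.
  by rewrite -RintegralB //; apply: eq_Rintegral => x _; rewrite addrK.
have icell (psi : R -> R) (B : R) N : measurable_fun setT psi ->
    (forall x, cell p x -> `|zsum N (fun k => psi (x + p * k%:~R))| <= B) ->
    mu.-integrable (cell p) (EFin \o (fun x => zsum N (fun k => psi (x + p * k%:~R)))).
  by move=> mpsi b; apply: (@integrable_cell_bounded _ _ p0 _ B) => //; exact: mzs.
have -> : (fun N => \int[mu]_(x in cell p) (zsum N (fun k => phi (x + p * k%:~R)))) =
    (fun N => \int[mu]_(x in cell p) (zsum N (fun k => phi (x + p * k%:~R) + `|phi (x + p * k%:~R)|))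
     - \int[mu]_(x in cell p) (zsum N (fun k => `|phi (x + p * k%:~R)|))).
  apply/funext => N; rewrite -RintegralB //.
  - by apply: eq_Rintegral => x _; rewrite zsumD addrK.
  - apply: (icell (fun x => phi x + `|phi x|) (K + K)) => // x cx.
    by rewrite ger0_norm ?b2 // zsum_ge0.
  - apply: (icell (fun x => `|phi x|) K) => // x cx.
    by rewrite ger0_norm ?phiK // zsum_ge0.
apply: cvgB; first exact: (cvg_ge0 m2 p2 b2).
exact: (cvg_ge0 m1 (fun x => normr_ge0 _) phiK).
Qed.

(** The partial periodizations are bounded by the constant [K], integrable over a cell, so dominated
    convergence moves the limit inside. *)
Lemma Rintegral_cells : measurable_fun (cell p) s ->
  (forall x, cell p x -> zsum N (fun k => phi (x + p * k%:~R)) @[N --> \oo] --> s x) ->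
  \int[mu]_x phi x = \int[mu]_(x in cell p) s x.
Proof.
move=> ms cs.
have [|||||ints _ h] := @dominated_convergence _ _ _ mu (cell p) mcell
  (fun N x => (zsum N (fun k => phi (x + p * k%:~R)))%:E) (EFin \o s) (EFin \o (fun=> K)).
- by move=> N; apply/measurable_EFinP; exact: mzs.
- exact/measurable_EFinP.
- by apply: aeW => x cx; apply/fine_cvgP; split; [exact: nearW|exact: cs].
- by apply: (@integrable_cell_bounded _ _ p0 _ `|K|).
- apply: aeW => x N cx; rewrite /= lee_fin; apply: le_trans (ler_norm_zsum _ _) _; exact: phiK.
have h2 : \int[mu]_(x in cell p) (zsum N (fun k => phi (x + p * k%:~R))) @[N --> \oo]
    --> \int[mu]_(x in cell p) s x.
  apply: fine_cvg; rewrite fineK; first exact: h.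
  exact: (integrable_fin_num mcell ints).
by apply: (cvg_unique _ cvg_Rintegral_cells h2).
Qed.
End Real.

Local Notation tpi := (2%:R * pi : R).

Lemma cvg_cabs (u : nat -> C) (l : C) : cabs (u n - l) @[n --> \oo] --> (0 : R) ->
  Re (u n) @[n --> \oo] --> Re l /\ Im (u n) @[n --> \oo] --> Im l.
Proof.
move=> h; split; apply/cvgrPdist_le => e e0; move/cvgrPdist_le : h => /(_ e e0);
  apply: filterS => n; rewrite sub0r normrN ger0_norm ?cabs_ge0 // cabs_sub;
  apply: le_trans; rewrite -?cReB -?cImB; [exact: normRe_le|exact: normIm_le].
Qed.

(** For integer m the factor e^(i m xi) is 2 pi-periodic, so the integral folds onto one period with
    G replaced by its periodization 1; orthogonality finishes. *)
Lemma ft_delta (G : R -> C) K (m : int) : adm G K ->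
  (forall x, cell tpi x ->
     cabs (zsum N (fun k => G (x + tpi * k%:~R)) - 1) @[N --> \oo] --> (0 : R)) ->
  ft G m%:~R = if m == 0 then 1 else 0.
Proof.
move=> [mG aG] sG.
pose phi xi := G xi * ce (xi * m%:~R).
have mphi : cmeas setT phi by apply: cmeasM => //; exact: cmeas_ce_mul.
have phiE x k : phi (x + tpi * k%:~R) = G (x + tpi * k%:~R) * ce (x * m%:~R).
  by rewrite /phi mulrC mulrC; congr (_ * _); rewrite ![_ * m%:~R]mulrC ce_int_period.
have bphi x N : cell tpi x -> zsum N (fun k => cabs (phi (x + tpi * k%:~R))) <= K.
  move=> cx; apply: le_trans (aG x N cx); apply: ler_zsum => k.
  by rewrite phiE cabsM cabs_ce mulr1.
have sphi x : cell tpi x -> cabs (zsum N (fun k => phi (x + tpi * k%:~R)) - ce (m%:~R * x))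
    @[N --> \oo] --> (0 : R).
  move=> cx; apply: cvg_trans (sG x cx); apply: near_eq_cvg; apply: nearW => N.
  rewrite (eq_zsum (G := fun k => G (x + tpi * k%:~R) * ce (x * m%:~R))) => [|k _]; last exact: phiE.
  by rewrite zsumMr [m%:~R * x]mulrC -{2}[ce _]mul1r -mulrBl cabsM cabs_ce mulr1.
have mce : cmeas (cell tpi) (fun x => ce (m%:~R * x) : C).
  by apply: cmeas_ce; apply: measurable_funM => //; exact: measurable_cst.
have -> : ft G m%:~R = cintS (cell tpi) (fun x => ce (m%:~R * x)) / rC tpi.
  congr (_ / _); apply: cext => /=.
    apply: (@Rintegral_cells _ (tpi_gt0 R) _ _ K mphi.1 _ mce.1) => [x N cx|x cx].
      by apply: le_trans (bphi x N cx); apply: ler_zsum => k; exact: normRe_le.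
    have [+ _] := cvg_cabs (sphi x cx).
    by under eq_fun do rewrite cRe_zsum.
  apply: (@Rintegral_cells _ (tpi_gt0 R) _ _ K mphi.2 _ mce.2) => [x N cx|x cx].
    by apply: le_trans (bphi x N cx); apply: ler_zsum => k; exact: normIm_le.
  have [_ +] := cvg_cabs (sphi x cx).
  by under eq_fun do rewrite cIm_zsum.
rewrite cintS_cell_ce; case: ifP => _; last by rewrite mul0r.
by rewrite divff // rC_eq0 gt_eqF // tpi_gt0.
Qed.
End SignedPeriodization.

(** * The cardinal series over a scalar symbol *)

Lemma zsum_trunc (V : nmodType) n N (f : int -> V) : (n <= N)%N ->
  zsum N (fun k => if (`|k| <= n)%N then f k else 0) = zsum n f.
Proof.
move=> /subnK <-; elim: (N - n)%N => [|i IH].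
  by rewrite add0n; apply: eq_zsum => k ->.
rewrite addSn zsumS IH !ifF ?add0r ?addr0 //; lia.
Qed.

Lemma zsum_tail (R : realType) (m : int -> R) B e : (forall k, 0 <= m k) ->
  (forall N, zsum N m <= B) -> 0 < e -> exists n, forall N, (n <= N)%N -> zsum N m - zsum n m <= e.
Proof.
move=> m0 mB e0; pose u N := zsum N m.
have nd : nondecreasing_seq u by move=> N M NM; apply: zsum_nd.
have cu : cvgn u.
  by apply: nondecreasing_is_cvgn => //; exists B => _ [N _ <-]; exact: mB.
have /cvgrPdist_le /(_ e e0) [n _ hn] := cu.
exists n => N nN; have := hn n (leqnn n).
have h1 : u N <= limn u by exact: nondecreasing_cvgn_le.
move=> /(le_trans (ler_norm _)); apply: le_trans.
by rewrite lerD2r.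
Qed.

Section Core.
Variable R : realType.
Local Notation C := R[i].
Notation mu := (@lebesgue_measure R).
Local Notation tpi := (2%:R * pi : R).

Lemma cvg_zsum0 M (F : int -> nat -> R) : (forall k, F k n @[n --> \oo] --> (0 : R)) ->
  zsum M (fun k => F k n) @[n --> \oo] --> (0 : R).
Proof.
move=> cF; elim: M => [|M IH]; first by under eq_fun do rewrite zsum0; exact: cF.
under eq_fun do rewrite zsumS.
have h := cvgD (cvgD (cF (- M.+1%:Z)) IH) (cF M.+1%:Z).
by rewrite !addr0 in h; exact: h.
Qed.

Lemma cvg_cmod2 (u : nat -> C) l : cabs (u n - l) @[n --> \oo] --> (0 : R) ->
  cmod2 (l - u n) @[n --> \oo] --> (0 : R).
Proof.
move=> h; have h2 := cvgM h h; rewrite mulr0 in h2.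
have -> : (fun n => cmod2 (l - u n)) = (fun n => cabs (u n - l) * cabs (u n - l)).
  by apply/funext => n; rewrite -sqr_cabs cabs_sub expr2.
exact: h2.
Qed.

Variables (F P : R -> C) (K c : R).
Hypotheses (K0 : 0 < K) (c0 : 0 < c) (aF : adm F K) (mP : cmeas setT P).
Hypothesis Pc : forall x, c <= cabs (P x).
Hypothesis Pper : forall x k, P (x + tpi * k%:~R) = P x.
Hypothesis PF : forall x, cell tpi x ->
  cabs (zsum N (fun k => F (x + tpi * k%:~R)) - P x) @[N --> \oo] --> (0 : R).
Hypothesis Papprox : forall e, 0 < e -> exists n b, forall x, cabs (P x - trigpoly n b x) <= e.

Let L x := F x * (P x)^-1.
Let P_neq0 x : P x != 0.
Proof. by rewrite -cabs_gt0; exact: lt_le_trans (Pc x). Qed.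

Let aL : adm L (K / c). Proof. exact: adm_div. Qed.

Let KL0 : 0 < K / c. Proof. exact: divr_gt0. Qed.

Let L_delta (m : int) : ft L m%:~R = if m == 0 then 1 else 0.
Proof.
apply: ft_delta aL _ => x cx.
have h := cvgM (PF cx) (cvg_cst ((cabs (P x))^-1)); rewrite mul0r in h.
rewrite (_ : (fun N => _) = (fun N => cabs (zsum N (fun k => F (x + tpi * k%:~R)) - P x) *
    (cabs (P x))^-1)); first exact: h.
apply/funext => N.
rewrite -cabsV -cabsM mulrBl mulfV // -zsumMr; congr (cabs (_ - 1)).
by apply: eq_zsum => k _; rewrite /L Pper.
Qed.

(** L P = F, and a factor e^(-i j xi) in the symbol translates the transform by j. *)
Let ft_sub n b t :
  ft (fun x => L x * (P x - trigpoly n b x)) t = ft F t - zsum n (fun j => b j * ft L (t - j%:~R)).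
Proof.
have tpi0 : rC tpi != 0 :> C by rewrite rC_eq0 gt_eqF // tpi_gt0.
have iL s := adm_cinteg_ce s aL; have iF s := adm_cinteg_ce s aF.
rewrite /ft.
have -> : (fun xi => L xi * (P xi - trigpoly n b xi) * ce (xi * t)) =
    (fun xi => F xi * ce (xi * t) + -1 * zsum n (fun j => b j * (L xi * ce (xi * (t - j%:~R))))).
  apply/funext => xi.
  have -> : zsum n (fun j => b j * (L xi * ce (xi * (t - j%:~R)))) = L xi * trigpoly n b xi * ce (xi * t).
    rewrite /trigpoly mulrAC -zsumMl; apply: eq_zsum => j _.
    by rewrite mulrBr ceD [xi * j%:~R]mulrC; ring.
  have -> : F xi = L xi * P xi by rewrite /L mulfVK.
  ring.
have iz : cinteg setT (fun xi => zsum n (fun j => b j * (L xi * ce (xi * (t - j%:~R))))).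
  apply: (@cinteg_zsum _ _ measurableT n (fun j xi => b j * (L xi * ce (xi * (t - j%:~R))))) => j.
  exact: cinteg_Zl.
rewrite cintS_add //; last exact: cinteg_Zl.
rewrite cintS_Zl // mulN1r mulrBl; congr (_ - _).
rewrite (@cintS_zsum _ _ measurableT n (fun j xi => b j * (L xi * ce (xi * (t - j%:~R))))).
  by rewrite -zsumMr; apply: eq_zsum => j _; rewrite cintS_Zl // mulrA.
by move=> j; exact: cinteg_Zl.
Qed.

Variables (a : int -> C) (A : R) (g : R -> C).
Hypothesis aA : forall N, zsum N (fun k => cmod2 (a k)) <= A.
Hypothesis ag : forall t,
  cabs (zsum N (fun k => a k * ft F (t - k%:~R)) - g t) @[N --> \oo] --> (0 : R).

Let gN n t := zsum n (fun k => a k * ft F (t - k%:~R)).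

(** The tail of [a] is small in l^2, and [sum_samples_le] carries this over to samples uniformly in
    t and M, so that n can be chosen before them. *)
Let gN_close e : 0 < e -> exists n, forall t M,
  zsum M (fun m => cmod2 (g (t + m%:~R) - gN n (t + m%:~R))) <= e.
Proof.
(* A tail below e / (4 K^2) yields an error e / 4; the pointwise limit costs another e / 4, and both
   are doubled by |x + y|^2 <= 2 |x|^2 + 2 |y|^2. *)
move=> e0; have K2 : 0 < 4 * K ^+ 2 by rewrite mulr_gt0 // exprn_gt0.
have [n hn] := zsum_tail (fun k => cmod2_ge0 (a k)) aA (divr_gt0 e0 K2); exists n => t M.
have b1 N : (n <= N)%N ->
    zsum M (fun m => cmod2 (gN N (t + m%:~R) - gN n (t + m%:~R))) <= e / 4.
  move=> nN; pose d k := if (`|k| <= n)%N then 0 else a k.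
  have dE s : gN N s - gN n s = zsum N (fun k => d k * ft F (s - k%:~R)).
    rewrite /gN -(zsum_trunc (fun k => a k * ft F (s - k%:~R)) nN) -zsumB.
    by apply: eq_zsum => k _; rewrite /d; case: ifP => _; rewrite ?subrr ?mul0r ?subr0.
  under eq_zsum => ? _ do rewrite dE.
  apply: le_trans (sum_samples_le _ _ _ _ K0 aF) _.
  have -> : zsum N (fun k => cmod2 (d k)) =
     zsum N (fun k => cmod2 (a k)) - zsum n (fun k => cmod2 (a k)).
    rewrite -(zsum_trunc (fun k => cmod2 (a k)) nN) -zsumB.
    by apply: eq_zsum => k _; rewrite /d; case: ifP => _; rewrite ?subrr ?subr0 // cmod2_0.
  have := hn N nN; rewrite ler_pdivlMr // => h.
  rewrite ler_pdivlMr //; apply: le_trans h; rewrite le_eqVlt; apply/orP; left; apply/eqP.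
  ring.
(* With t and M fixed, finitely many pointwise limits suffice; the resulting N depends on t and M,
   whereas n does not. *)
have c1 : zsum M (fun m => cmod2 (g (t + m%:~R) - gN N (t + m%:~R))) @[N --> \oo] --> (0 : R).
  apply: (@cvg_zsum0 M (fun m N => cmod2 (g (t + m%:~R) - gN N (t + m%:~R)))) => m.
  exact: (cvg_cmod2 (ag _)).
have e4 : 0 < e / 4 by rewrite divr_gt0.
move/cvgrPdist_le : c1 => /(_ _ e4) [N0 _ hN0].
pose N := maxn n N0.
have h1 := b1 N (leq_maxl _ _); have h2 := hN0 N (leq_maxr _ _).
rewrite /= sub0r normrN in h2; move: h2 => /(le_trans (ler_norm _)) h2.
apply: (@le_trans _ _ (2 * zsum M (fun m => cmod2 (g (t + m%:~R) - gN N (t + m%:~R)))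
   + 2 * zsum M (fun m => cmod2 (gN N (t + m%:~R) - gN n (t + m%:~R))))); last lra.
rewrite -!zsumMl -zsumD; apply: ler_zsum => m.
set x := g _; set y := gN N _; set z := gN n _.
by rewrite (_ : x - z = (x - y) + (y - z)); [exact: cmod2D_le|ring].
Qed.

(** The difference is a series of translates with symbol L (P - p), where p is a trigonometric
    polynomial uniformly close to P. *)
Let h_close e n : 0 < e -> exists n1 b, forall t M,
  zsum M (fun m => cmod2 (gN n (t + m%:~R) -
    zsum n (fun k => a k * zsum n1 (fun j => b j * ft L (t + m%:~R - k%:~R - j%:~R))))) <= e.
Proof.
move=> e0.
have A0 : 0 <= A by apply: le_trans (aA 0); rewrite zsum_ge0 // => k; exact: cmod2_ge0.
(* Approximating P within sqrt(e / B) gives a squared error of at most (K / c)^2 A e / B <= e; the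
   summand 1 keeps B positive. *)
pose B := (K / c) ^+ 2 * A + 1.
have B0 : 0 < B by rewrite ltr_wpDl // mulr_ge0 // exprn_ge0 // ltW.
have eB : 0 < Num.sqrt (e / B) by rewrite sqrtr_gt0 divr_gt0.
have [n1 [b hb]] := Papprox eB.
exists n1, b => t M.
have aW := adm_mul aL (cmeasB mP (cmeas_trigpoly _ _ _)) hb.
have := sum_samples_le n a t M (mulr_gt0 KL0 eB) aW.
rewrite [X in X <= _](_ : _ = zsum M (fun m => cmod2 (gN n (t + m%:~R) -
    zsum n (fun k => a k * zsum n1 (fun j => b j * ft L (t + m%:~R - k%:~R - j%:~R))))));
  last first.
  apply: eq_zsum => m _; congr cmod2; rewrite -zsumB; apply: eq_zsum => k _.
  by rewrite ft_sub mulrBr.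
move=> /le_trans; apply.
have eB1 : 0 <= e / B by apply/ltW/divr_gt0.
rewrite exprMn sqr_sqrtr //.
apply: (@le_trans _ _ ((K / c) ^+ 2 * (e / B) * A)).
  by rewrite ler_wpM2l ?aA // mulr_ge0 ?exprn_ge0 ?divr_ge0 ?ltW.
have -> : (K / c) ^+ 2 * (e / B) * A = e * (((K / c) ^+ 2 * A) / B) by ring.
by rewrite ger_pMr // ler_pdivrMr // mul1r lerDl.
Qed.

Let sample_L N (l : int) s : (`|l| <= N)%N ->
  zsum N (fun m => ft L (m%:~R - l%:~R) * ft L (s - m%:~R)) = ft L (s - l%:~R).
Proof.
move=> lN; rewrite (@zsum_single _ _ _ l) => [|k kl].
  by rewrite lN subrr -[0]/(0%:~R) L_delta eqxx mul1r.
by rewrite -intrB L_delta subr_eq0 (negPf kl) mul0r.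
Qed.

(** With S_N the truncated cardinal series and S_N h = h, one has g - S_N g = (g - h) - S_N (g - h),
    and S_N is bounded by K / c uniformly in N. *)
Lemma cardinal_series_cvg e : 0 < e -> exists N0, forall N, (N0 <= N)%N -> forall t M,
  zsum M (fun m => cmod2 (g (t + m%:~R) -
    zsum N (fun k => g k%:~R * ft L (t + m%:~R - k%:~R)))) <= e.
Proof.
move=> e0.
(* Total cost of an error e / q in g - h: twice itself, plus twice its image under S_N, that is q (e
   / q) = e. *)
pose q := 2 * (1 + (K / c) ^+ 2).
have q0 : 0 < q by rewrite mulr_gt0 // ltr_pwDl // exprn_ge0 // ltW.
have e1 : 0 < e / q / 4 by rewrite !divr_gt0.
have [n hn] := gN_close e1; have [n1 [b hb]] := h_close n e1.
pose h s := zsum n (fun k => a k * zsum n1 (fun j => b j * ft L (s - k%:~R - j%:~R))).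
have gh t M : zsum M (fun m => cmod2 (g (t + m%:~R) - h (t + m%:~R))) <= e / q.
  apply: (@le_trans _ _ (2 * zsum M (fun m => cmod2 (g (t + m%:~R) - gN n (t + m%:~R)))
     + 2 * zsum M (fun m => cmod2 (gN n (t + m%:~R) - h (t + m%:~R))))).
    rewrite -!zsumMl -zsumD; apply: ler_zsum => m.
    set x := g _; set y := gN n _; set z := h _.
    by rewrite (_ : x - z = (x - y) + (y - z)); [exact: cmod2D_le|ring].
  have := hn t M; have := hb t M; rewrite -/(h _); lra.
(* [h] involves translates of L by k + j with |k| <= n and |j| <= n1; all these nodes must lie in
   the summation window. *)
exists (n + n1)%N => N nN t M.
have hU s : zsum N (fun l => h l%:~R * ft L (s - l%:~R)) = h s.
  rewrite /h.
  transitivity (zsum N (fun l => zsum n (fun k => zsum n1 (fun j =>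
      (a k * b j) * (ft L (l%:~R - (k + j)%:~R) * ft L (s - l%:~R)))))).
    apply: eq_zsum => l _; rewrite -zsumMr; apply: eq_zsum => k _.
    rewrite -mulrA -zsumMr -zsumMl; apply: eq_zsum => j _.
    by rewrite intrD opprD addrA; ring.
  rewrite exchange_zsum; apply: eq_zsum => k kn.
  rewrite exchange_zsum -zsumMl; apply: eq_zsum => j jn.
  rewrite zsumMl sample_L; last by lia.
  by rewrite intrD opprD addrA -mulrA.
have bE s : g s - zsum N (fun k => g k%:~R * ft L (s - k%:~R)) =
    (g s - h s) - zsum N (fun k => (g k%:~R - h k%:~R) * ft L (s - k%:~R)).
  under [X in _ = _ - X]eq_zsum => ? _ do rewrite mulrBl.
  by rewrite zsumB hU; ring.
under eq_zsum => ? _ do rewrite bE.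
apply: (@le_trans _ _ (2 * zsum M (fun m => cmod2 (g (t + m%:~R) - h (t + m%:~R))) +
    2 * zsum M (fun m => cmod2 (zsum N (fun k => (g k%:~R - h k%:~R) * ft L (t + m%:~R - k%:~R)))))).
  by rewrite -!zsumMl -zsumD; apply: ler_zsum => m; exact: cmod2B_le.
have s1 := sum_samples_le N (fun k => g k%:~R - h k%:~R) t M KL0 aL.
(* Sampling at the integers is the case t = 0 of the bound on g - h. *)
have s2 : zsum N (fun k => cmod2 (g k%:~R - h k%:~R)) <= e / q.
  by have := gh 0 N; under eq_zsum => ? _ do rewrite add0r.
have s3 : (K / c) ^+ 2 * zsum N (fun k => cmod2 (g k%:~R - h k%:~R)) <= (K / c) ^+ 2 * (e / q).
  by rewrite ler_wpM2l // exprn_ge0 // ltW.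
have s4 := gh t M.
have -> : e = 2 * (e / q) + 2 * ((K / c) ^+ 2 * (e / q)).
  have hq : q * (e / q) = e by rewrite mulrC divfK // gt_eqF.
  by set z := e / q in hq *; rewrite -[LHS]hq /q; ring.
apply: lerD; rewrite ler_pM2l //.
by apply: le_trans s1 s3.
Qed.
End Core.

(** * Uniform trigonometric approximation *)

(** Gives the ratio (2n + 1) / (2n + 2) of the mean values of consecutive kernels [ker], used in
    [kcoef_rec]. *)
Lemma central_bin_rec n :
  (n.+1 * 'C(n.+1.*2, n.+1) = 2 * n.*2.+1 * 'C(n.*2, n))%N.
Proof.
have e1 := mul_bin_diag n.+1.*2 n.
have e2 := mul_bin_diag n.*2.+1 n.
have e3 : ('C(n.*2.+1, n) = 'C(n.*2.+1, n.+1))%N.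
  by rewrite -bin_sub; [congr binomial; lia|lia].
rewrite doubleS /= in e1; rewrite /= in e2; rewrite doubleS -e1 e3.
apply/eqP; rewrite -(eqn_pmul2l (ltn0Sn n)); apply/eqP.
rewrite mulnCA -e2; lia.
Qed.

Section TrigApprox.
Variable R : realType.
Local Notation C := R[i].
Local Notation tpi := (2%:R * pi : R).

Lemma cos_half (x : R) : cos x = 1 - 2%:R * sin (x / 2%:R) ^+ 2.
Proof.
have {1}-> : x = (x / 2%:R) *+ 2 by rewrite -mulr_natr divfK.
rewrite cos_mulr2n cos2sin2 -mulr_natl; ring.
Qed.

Lemma cos_lt1 (x : R) : x != 0 -> `|x| < tpi -> cos x < 1.
Proof.
move=> x0 xpi; rewrite -cos_norm cos_half ltrBlDr ltrDl mulr_gt0 // exprn_gt0 //.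
apply: sin_gt0_pi; rewrite divr_gt0 ?normr_gt0 //=.
by rewrite ltr_pdivrMr // mulrC.
Qed.

Lemma ce_neq1 (x : R) : x != 0 -> `|x| < tpi -> ce x != 1.
Proof.
move=> x0 xpi; apply/eqP => /(congr1 (@complex.Re R)) /= h.
by have := cos_lt1 x0 xpi; rewrite h ltxx.
Qed.

Lemma ceX (x : R) n : ce x ^+ n = ce (n%:R * x).
Proof.
elim: n => [|n IH]; first by rewrite mul0r ce0 expr0.
by rewrite exprSr IH -[n.+1%:R]natr1 mulrDl mul1r ceD.
Qed.

(** A geometric sum over the powers of a Q-th root of unity, which differs from 1 when 0 < |k| <
    Q. *)
Lemma sum_ce_nodes Q (k : int) : (`|k| < Q)%N ->
  \sum_(j < Q) ce (k%:~R * (tpi * j%:R / Q%:R)) = if k == 0 then Q%:R else 0 :> C.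
Proof.
move=> kQ; have Q0 : (0 < Q)%N by exact: leq_ltn_trans kQ.
case: eqVneq => [->|k0].
  under eq_bigr do rewrite mul0r ce0.
  by rewrite sumr_const card_ord.
have QR0 : 0 < Q%:R :> R by rewrite ltr0n.
pose z : C := ce (k%:~R * tpi / Q%:R).
have z1 : z != 1.
  apply: ce_neq1.
    apply: mulf_neq0; last by rewrite invr_eq0 gt_eqF.
    by apply: mulf_neq0; rewrite ?intr_eq0 // gt_eqF // tpi_gt0.
  rewrite normrM normfV (gtr0_norm QR0) normrM (gtr0_norm (tpi_gt0 R)).
  rewrite ltr_pdivrMr // mulrC ltr_pM2l ?tpi_gt0 //.
  by rewrite -intr_norm -[Q%:R]/((Q%:Z)%:~R) ltr_int -abszE.
have -> : \sum_(j < Q) ce (k%:~R * (tpi * j%:R / Q%:R)) = \sum_(j < Q) z ^+ j.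
  by apply: eq_bigr => j _; rewrite ceX; congr ce; ring.
apply: (mulfI (_ : z - 1 != 0)); first by rewrite subr_eq0.
rewrite -subrX1 mulr0 ceX.
have -> : Q%:R * (k%:~R * tpi / Q%:R) = tpi * k%:~R by field; rewrite gt_eqF.
by rewrite ce_2pi_int subrr.
Qed.

Lemma rCX (x : R) n : rC (x ^+ n) = rC x ^+ n.
Proof. by elim: n => [|n IH]; rewrite ?expr0 // !exprS rCM IH. Qed.

(** The unnormalized de la Vallee Poussin kernel cos(x / 2)^(2n). *)
Definition ker n (x : R) : R := ((1 + cos x) / 2%:R) ^+ n.
(** Fourier coefficients of [ker n]; the absolute value only converts k + n to a natural number, and
    the coefficients are summed over |k| <= n. *)
Definition kcoef n (k : int) : R := 'C(n.*2, `|k + n%:Z|)%:R / 4%:R ^+ n.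

Lemma ker_ge0 n x : 0 <= ker n x.
Proof.
rewrite exprn_ge0 // divr_ge0 //; have := cos_geN1 x; lra.
Qed.

(** Binomial expansion of ((1 + e^(-i x))^2 e^(i x) / 4)^n, with exponents recentred by n. *)
Lemma ker_expand n x : rC (ker n x) = zsum n (fun k => rC (kcoef n k) * ce (- (k%:~R * x))).
Proof.
have e1 : rC ((1 + cos x) / 2%:R) = (1 + ce (- x)) ^+ 2 * ce x / 4%:R :> C.
  have h : ce x * ce (- x) = 1 :> C by rewrite -ceD subrr ce0.
  have -> : (1 + ce (- x)) ^+ 2 * ce x = ce x + 2%:R * (ce x * ce (- x)) + (ce x * ce (- x)) * ce (- x) :> C by ring.
  rewrite h mulr1 mul1r.
  have -> : ce x + 2%:R + ce (- x) = rC (2%:R * (1 + cos x)).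
    by apply: cext; rewrite -rC_nat !cE /= ?cosN ?sinN; ring.
  have -> : (4%:R : C) = rC 4%:R by rewrite rC_nat.
  rewrite -rCV -rCM; congr rC; lra.
have -> : rC (ker n x) = ((1 + ce (- x)) ^+ 2 * ce x / 4%:R) ^+ n.
  by rewrite -e1 /ker rCX.
rewrite exprMn exprMn -exprM mul2n exprDn /zsum mul2n !mulr_suml.
apply: eq_bigr => i _; rewrite expr1n mul1r !ceX /kcoef subrK absz_nat.
have -> : ce (- ((i%:Z - n%:Z)%:~R * x)) = ce (i%:R * - x) * ce (n%:R * x) :> C.
  by rewrite -ceD intrB; congr ce; ring.
by rewrite rCM rCV rCX !rC_nat -mulr_natl exprVn; ring.
Qed.

(** The kernel has degree n < Q, so equally spaced nodes cause no aliasing and only the mean value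
    survives. *)
Lemma sum_ker_nodes n Q (x : R) : (n < Q)%N ->
  \sum_(j < Q) ker n (x - tpi * j%:R / Q%:R) = Q%:R * kcoef n 0.
Proof.
move=> nQ.
have h : rC (\sum_(j < Q) ker n (x - tpi * j%:R / Q%:R)) = rC (Q%:R * kcoef n 0).
  have -> : rC (\sum_(j < Q) ker n (x - tpi * j%:R / Q%:R)) =
      \sum_(j < Q) rC (ker n (x - tpi * j%:R / Q%:R)) :> C.
    by elim/big_ind2 : _ => [|? ? ? ? <- <-|//]; rewrite ?rCD.
  under eq_bigr do rewrite ker_expand.
  rewrite /zsum exchange_big /= -/(zsum n (fun k => \sum_(j < Q)
    rC (kcoef n k) * ce (- (k%:~R * (x - tpi * j%:R / Q%:R))))).
  have E k : (`|k| <= n)%N -> \sum_(j < Q) rC (kcoef n k) * ce (- (k%:~R * (x - tpi * j%:R / Q%:R))) =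
      rC (kcoef n k) * ce (- (k%:~R * x)) * (if k == 0 then Q%:R else 0) :> C.
    move=> kn; rewrite -sum_ce_nodes; last exact: leq_ltn_trans kn nQ.
    rewrite mulr_sumr; apply: eq_bigr => j _.
    by rewrite -[RHS]mulrA -ceD; congr (_ * ce _); ring.
  rewrite (eq_zsum E) (@zsum_single _ _ _ 0) => [|k /negPf ->]; last by rewrite mulr0.
  by rewrite /= mul0r oppr0 ce0 mulr1 rCM rC_nat mulrC.
by have /= := congr1 (@complex.Re R) h.
Qed.

Lemma kcoef_gt0 n : 0 < kcoef n 0.
Proof.
rewrite /kcoef add0r absz_nat divr_gt0 ?exprn_gt0 // ltr0n bin_gt0 -addnn; exact: leq_addr.
Qed.

(** The left side is half the mean value of (1 - cos) [ker n]: this is the source of the rate 1 / (n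
    + 1). *)
Lemma kcoef_rec n : kcoef n 0 - kcoef n.+1 0 = kcoef n 0 / (2%:R * n.+1%:R).
Proof.
rewrite /kcoef !add0r !absz_nat.
have := congr1 (fun m : nat => m%:R : R) (central_bin_rec n).
rewrite !natrM => h.
have n1 : n.+1%:R != 0 :> R by rewrite pnatr_eq0.
have f0 : 4%:R ^+ n != 0 :> R by rewrite expf_neq0 // pnatr_eq0.
have -> : 'C(n.+1.*2, n.+1)%:R = 2%:R * n.*2.+1%:R * 'C(n.*2, n)%:R / n.+1%:R :> R.
  by rewrite -h mulrC mulKf.
have -> : n.*2.+1%:R = 2%:R * n.+1%:R - 1 :> R.
  by rewrite -natrM mul2n doubleS -[n.*2.+2%:R]natr1 addrK.
rewrite exprS; move: n1 f0.
move: (n.+1%:R : R) (4%:R ^+ n : R) => N1 f n1 f0.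
by field; rewrite n1 f0.
Qed.

(* Korovkin-type argument: average [P] over equally spaced nodes with the positive kernel
   [ker n].  Sums of [ker n] over more than n nodes are exact, and since
   (1 - cos) ker n = 2 (ker n - ker n.+1) the modulus of continuity contributes M / n.+1. *)
Lemma trig_approx (P : R -> C) :
  (forall e, 0 < e -> exists M, forall u s, cabs (P u - P s) <= e + M * (1 - cos (u - s))) ->
  forall e, 0 < e -> exists n b, forall x, cabs (P x - trigpoly n b x) <= e.
Proof.
move=> mod e e0; have e20 : 0 < e / 2%:R by rewrite divr_gt0.
have [M hM] := mod _ e20.
pose n := `|Num.ceil (M / (e / 2%:R))|%N.
have nM : M / n.+1%:R <= e / 2%:R.
  rewrite ler_pdivrMr ?ltr0n // mulrC -ler_pdivrMr //.
  apply: le_trans (Num.Theory.ceil_ge _) _.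
  rewrite -[n.+1%:R]/((n.+1%:Z)%:~R) ler_int.
  by apply: le_trans (lez_abs _) _; rewrite lez_nat leqnSn.
(* n + 2 nodes, because [ker n.+1] must also be summed exactly. *)
pose Q := n.+2; pose s j : R := tpi * j%:R / Q%:R.
have QR0 : Q%:R != 0 :> R by rewrite pnatr_eq0.
have w0 := kcoef_gt0 n.
pose W := Q%:R * kcoef n 0.
have W0 : 0 < W by rewrite mulr_gt0 // ltr0n.
have sK x : \sum_(j < Q) ker n (x - s j) = W by rewrite sum_ker_nodes.
have sK1 x : \sum_(j < Q) (1 - cos (x - s j)) * ker n (x - s j) = W / n.+1%:R.
  have -> : \sum_(j < Q) (1 - cos (x - s j)) * ker n (x - s j) =
      2%:R * (\sum_(j < Q) ker n (x - s j) - \sum_(j < Q) ker n.+1 (x - s j)).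
    rewrite -sumrB mulr_sumr; apply: eq_bigr => j _.
    by rewrite [ker n.+1 _]exprS -/(ker n _); field.
  rewrite sK sum_ker_nodes // /W -mulrBr kcoef_rec.
  have n1 : n.+1%:R != 0 :> R by rewrite pnatr_eq0.
  by move: (n.+1%:R : R) n1 => N1 n1; field.
exists n, (fun k => \sum_(j < Q) P (s j) * (rC (kcoef n k) * ce (k%:~R * s j)) / rC W) => x.
have -> : trigpoly n (fun k => \sum_(j < Q) P (s j) * (rC (kcoef n k) * ce (k%:~R * s j)) / rC W) x =
    \sum_(j < Q) P (s j) * rC (ker n (x - s j) / W).
  rewrite /trigpoly /zsum; under eq_bigr do rewrite mulr_suml.
  rewrite exchange_big /=; apply: eq_bigr => j _.
  rewrite rCM rCV ker_expand /zsum mulr_suml mulr_sumr; apply: eq_bigr => i _.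
  set k := (_ - _ : int).
  have -> : ce (- (k%:~R * (x - s j))) = ce (k%:~R * s j) * ce (- (k%:~R * x)) :> C.
    by rewrite -ceD; congr ce; ring.
  ring.
have -> : P x - \sum_(j < Q) P (s j) * rC (ker n (x - s j) / W) =
    \sum_(j < Q) (P x - P (s j)) * rC (ker n (x - s j) / W).
  under [RHS]eq_bigr do rewrite mulrBl.
  rewrite sumrB -mulr_sumr; congr (_ - _).
  have -> : \sum_(j < Q) rC (ker n (x - s j) / W) = rC (\sum_(j < Q) ker n (x - s j) / W) :> C.
    by elim/big_ind2 : _ => [|? ? ? ? -> ->|//]; rewrite ?rCD.
  by rewrite -mulr_suml sK divff ?mulr1 // gt_eqF.
apply: (@le_trans _ _ (\sum_(j < Q) cabs ((P x - P (s j)) * rC (ker n (x - s j) / W)))).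
  elim/big_ind2 : _ => [|? ? ? ? h1 h2|//]; first by rewrite cabs0.
  by apply: le_trans (cabsD _ _) _; exact: lerD.
apply: (@le_trans _ _ (\sum_(j < Q) (e / 2%:R * ker n (x - s j) +
   M * ((1 - cos (x - s j)) * ker n (x - s j))) / W)).
  apply: ler_sum => j _; have k0 := ker_ge0 n (x - s j).
  rewrite cabsM cabs_rC ger0_norm; last by rewrite divr_ge0 // ltW.
  rewrite mulrA ler_pM2r ?invr_gt0 // mulrA -mulrDl ler_wpM2r //.
rewrite -mulr_suml big_split /= -!mulr_sumr sK sK1.
have -> : (e / 2%:R * W + M * (W / n.+1%:R)) / W = e / 2%:R + M / n.+1%:R.
  have n1 : n.+1%:R != 0 :> R by rewrite pnatr_eq0.
  by move: (n.+1%:R : R) n1 => N1 n1; field; rewrite n1 gt_eqF.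
by rewrite [leRHS](splitr e) lerD2l.
Qed.
End TrigApprox.

(** * Absolutely convergent symmetric sums *)

Section Summability.
Variable R : realType.
Local Notation C := R[i].
Local Notation Re := complex.Re.
Local Notation Im := complex.Im.

Section Majorant.
Variables (m : int -> R) (B : R).
Hypotheses (m0 : forall k, 0 <= m k) (mB : forall N, zsum N m <= B).

Lemma zsum_vanish e : 0 < e -> exists n, forall k, (n < `|k|)%N -> m k <= e.
Proof.
move=> e0; have [n hn] := zsum_tail m0 mB e0; exists n => k nk.
case E : `|k|%N nk => [//|N] nN.
apply: le_trans (hn N.+1 (ltnW nN)).
apply: (@le_trans _ _ (zsum N.+1 m - zsum N m)); last by rewrite lerD2l lerN2 zsum_nd.
rewrite zsumS.
have [->|->] : k = N.+1%:Z \/ k = - N.+1%:Z by lia.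
  have := m0 (- N.+1%:Z); lra.
have := m0 (N.+1%:Z); lra.
Qed.

(** Writing f = (m + f) - m leaves two series with nonnegative terms and bounded sums. *)
Lemma is_cvg_zsum_real (f : int -> R) : (forall k, `|f k| <= m k) -> cvgn (fun N => zsum N f).
Proof.
move=> fm.
have c1 : cvgn (fun N => zsum N m).
  apply: nondecreasing_is_cvgn; first by move=> N M NM; exact: zsum_nd.
  by exists B => _ [N _ <-]; exact: mB.
have p0 k : 0 <= m k + f k by have := fm k; rewrite ler_norml => /andP[h _]; lra.
have c2 : cvgn (fun N => zsum N (fun k => m k + f k)).
  apply: nondecreasing_is_cvgn; first by move=> N M NM; exact: zsum_nd.
  exists (B + B) => _ [N _ <-]; rewrite zsumD; apply: lerD => //.
  by apply: le_trans (mB N); apply: ler_zsum => k; exact: le_trans (ler_norm _) (fm k).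
have -> : (fun N => zsum N f) = (fun N => zsum N (fun k => m k + f k) - zsum N m).
  by apply/funext => N; rewrite zsumD addrC addKr.
exact: is_cvgB.
Qed.

Lemma cvg_clim (u : nat -> C) : cvgn (fun N => Re (u N)) -> cvgn (fun N => Im (u N)) ->
  cabs (u N - clim u) @[N --> \oo] --> (0 : R).
Proof.
move=> c1 c2; apply/cvgrPdist_le => e e0.
have e20 : 0 < e / 2 by rewrite divr_gt0.
move/cvgrPdist_le : c1 => /(_ _ e20) h1; move/cvgrPdist_le : c2 => /(_ _ e20) h2.
near=> N; rewrite sub0r normrN ger0_norm ?cabs_ge0 //.
apply: le_trans (cabs_le _) _; rewrite [e](splitr e) cReB cImB /=; apply: lerD.
  by rewrite distrC; near: N.
by rewrite distrC; near: N.
Unshelve. all: by end_near. Qed.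

Variables (f : int -> C).
Hypothesis fm : forall k, cabs (f k) <= m k.

Lemma cvg_zsum_clim :
  cabs (zsum N f - clim (fun N => zsum N f)) @[N --> \oo] --> (0 : R).
Proof.
apply: cvg_clim.
  under eq_fun do rewrite cRe_zsum.
  by apply: is_cvg_zsum_real => k; exact: le_trans (normRe_le _) (fm k).
under eq_fun do rewrite cIm_zsum.
by apply: is_cvg_zsum_real => k; exact: le_trans (normIm_le _) (fm k).
Qed.

Lemma zsum_diff_le n N : (n <= N)%N -> cabs (zsum N f - zsum n f) <= zsum N m - zsum n m.
Proof.
move=> nN; rewrite -(zsum_trunc f nN) -(zsum_trunc m nN) -!zsumB.
apply: le_trans (cabs_zsum _ _) _; apply: ler_zsum => k.
by case: ifP => _; rewrite ?subrr ?cabs0 // !subr0.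
Qed.
End Majorant.

Lemma cvg_cabs_unique (u : nat -> C) (l l' : C) : cabs (u n - l) @[n --> \oo] --> (0 : R) ->
  cabs (u n - l') @[n --> \oo] --> (0 : R) -> l = l'.
Proof.
move=> /cvg_cabs[r1 i1] /cvg_cabs[r2 i2].
by apply: cext; [exact: (cvg_unique _ r1 r2)|exact: (cvg_unique _ i1 i2)].
Qed.

Lemma cvg_clim_eq (u : nat -> C) (l : C) : cabs (u n - l) @[n --> \oo] --> (0 : R) -> clim u = l.
Proof.
move=> /cvg_cabs[r1 i1]; apply: cext; rewrite /= /rlim.
  by rewrite (cvg_lim _ r1).
by rewrite (cvg_lim _ i1).
Qed.

Definition vanish (f : int -> C) := forall e, 0 < e ->
  exists n, forall k, (n < `|k|)%N -> cabs (f k) <= e.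

Lemma zsum_shift1 N (f : int -> C) :
  zsum N (fun k => f (k + 1)) = zsum N f + (f N.+1%:Z - f (- N%:Z)).
Proof.
elim: N => [|N IH]; first by rewrite !zsum0 add0r oppr0 addrC subrK.
rewrite !zsumS IH.
have -> : - N.+1%:Z + 1 = - N%:Z by lia.
have -> : N.+1%:Z + 1 = N.+2%:Z by lia.
ring.
Qed.

Lemma vanish_shift f j : vanish f -> vanish (fun k => f (k + j)).
Proof.
move=> vf e e0; have [n hn] := vf e e0; exists (n + `|j|)%N => k nk.
by apply: hn; lia.
Qed.

(** A shift of the index changes a symmetric sum by two boundary terms, which tend to 0. The
    equivalence is read forwards for positive shifts and backwards for negative ones. *)
Lemma cvg_zsum_shift1 f (l : C) : vanish f ->
  (cabs (zsum N f - l) @[N --> \oo] --> (0 : R)) <->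
  (cabs (zsum N (fun k => f (k + 1)) - l) @[N --> \oo] --> (0 : R)).
Proof.
move=> vf.
have d e : 0 < e -> \forall N \near \oo,
    cabs (zsum N (fun k => f (k + 1)) - zsum N f) <= e.
  move=> e0; have e20 : 0 < e / 2 by rewrite divr_gt0.
  have [n hn] := vf _ e20; exists n.+1 => // N /= nN.
  rewrite zsum_shift1 addrC addKr [e](splitr e).
  apply: le_trans (cabsD _ _) _; rewrite cabsN; apply: lerD; apply: hn; lia.
split=> h; apply/cvgrPdist_le => e e0; have e20 : 0 < e / 2 by rewrite divr_gt0.
  have h1 := d _ e20; move/cvgrPdist_le : h => /(_ _ e20) h2.
  near=> N; rewrite sub0r normrN ger0_norm ?cabs_ge0 //.
  rewrite -(subrK (zsum N f) (zsum N _)) -addrA [e](splitr e).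
  apply: le_trans (cabsD _ _) _; apply: lerD; first by near: N.
  suff : `|0 - cabs (zsum N f - l)| <= e / 2 by rewrite sub0r normrN ger0_norm ?cabs_ge0.
  by near: N.
have h1 := d _ e20; move/cvgrPdist_le : h => /(_ _ e20) h2.
near=> N; rewrite sub0r normrN ger0_norm ?cabs_ge0 //.
rewrite -(subrK (zsum N (fun k => f (k + 1))) (zsum N f)) -addrA [e](splitr e).
apply: le_trans (cabsD _ _) _; apply: lerD; first by rewrite cabs_sub; near: N.
suff : `|0 - cabs (zsum N (fun k => f (k + 1)) - l)| <= e / 2.
  by rewrite sub0r normrN ger0_norm ?cabs_ge0.
by near: N.
Unshelve. all: by end_near. Qed.

Lemma cvg_zsum_shift f j (l : C) : vanish f ->
  cabs (zsum N f - l) @[N --> \oo] --> (0 : R) ->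
  cabs (zsum N (fun k => f (k + j)) - l) @[N --> \oo] --> (0 : R).
Proof.
move=> vf h; have up n : cabs (zsum N (fun k => f (k + n%:Z)) - l) @[N --> \oo] --> (0 : R).
  elim: n => [|n IH]; first by under eq_fun do under eq_zsum => ? _ do rewrite addr0.
  have /(cvg_zsum_shift1 l (vanish_shift n%:Z vf)) := IH.
  rewrite (_ : (fun k => f (k + 1 + n%:Z)) = (fun k => f (k + n.+1%:Z))) //.
  by apply/funext => k; congr f; lia.
case: j => n; first exact: up.
have dn i : cabs (zsum N (fun k => f (k - i%:Z)) - l) @[N --> \oo] --> (0 : R).
  elim: i => [|i IH]; first by under eq_fun do under eq_zsum => ? _ do rewrite subr0.
  apply/(cvg_zsum_shift1 l (vanish_shift (- i.+1%:Z) vf)).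
  rewrite (_ : (fun k => f (k + 1 - i.+1%:Z)) = (fun k => f (k - i%:Z))) //.
  by apply/funext => k; congr f; lia.
by have := dn n.+1.
Qed.

End Summability.

(** * A summable majorant of the type n^(-a), a > 1 *)

Section ZetaBound.
Variables (R : realType) (a : R).
Hypothesis a1 : 1 < a.

Definition rpow (n : nat) : R := expR (- a * ln n%:R).

Lemma rpow_le1 n : (0 < n)%N -> rpow n <= 1.
Proof.
move=> n0; rewrite -expR0 ler_expR mulNr oppr_le0 mulr_ge0 //.
  by apply: ltW; exact: lt_trans a1.
by apply: ln_ge0; rewrite ler1n.
Qed.

(** The comparison of (n + 1)^(-a) with the integral of x^(-a) over [n, n + 1], obtained from two
    uses of 1 + x <= e^x instead of integration. *)
Lemma rpow_telescope n : (0 < n)%N ->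
  rpow n.+1 <= (expR ((1 - a) * ln n%:R) - expR ((1 - a) * ln n.+1%:R)) / (a - 1).
Proof.
move=> n0; set x := ln n%:R; set y := ln n.+1%:R.
have n0' : 0 < n%:R :> R by rewrite ltr0n.
have n1' : 0 < n.+1%:R :> R by rewrite ltr0n.
have ex : expR x = n%:R by rewrite lnK // posrE.
have ey : expR y = n.+1%:R by rewrite lnK // posrE.
have h1 : expR (- y) <= y - x.
  have h : 1 + (x - y) <= expR (x - y) := expR_ge1Dx _.
  have e : expR (x - y) = 1 - expR (- y).
    rewrite expRD ex expRN ey -[n%:R](addrK 1) natr1 mulrBl mulfV ?gt_eqF // mul1r //.
  by rewrite e in h; lra.
rewrite ler_pdivlMr ?subr_gt0 //.
have -> : rpow n.+1 = expR ((1 - a) * y) * expR (- y).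
  by rewrite -expRD /rpow -/y; congr expR; ring.
have -> : expR ((1 - a) * x) = expR ((1 - a) * y) * expR ((a - 1) * (y - x)).
  by rewrite -expRD; congr expR; ring.
rewrite -mulrA -{3}[expR _]mulr1 -mulrBr ler_pM2l ?expR_gt0 //.
have h2 := expR_ge1Dx ((a - 1) * (y - x)).
have h3 : expR (- y) * (a - 1) <= (y - x) * (a - 1) by rewrite ler_pM2r // subr_gt0.
lra.
Qed.

Lemma sum_rpow_le n : \sum_(i < n) rpow i.+1 <= 1 + (a - 1)^-1.
Proof.
have p0 : 0 < a - 1 by rewrite subr_gt0.
have pV : 0 < (a - 1)^-1 by rewrite invr_gt0.
case: n => [|n]; first by rewrite big_ord0 addr_ge0 // ltW.
suff : \sum_(i < n.+1) rpow i.+1 <= 1 + (1 - expR ((1 - a) * ln n.+1%:R)) / (a - 1).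
  move/le_trans; apply; rewrite lerD2l -[leRHS]mul1r ler_pM2r //.
elim: n => [|n IH].
  by rewrite big_ord_recl big_ord0 addr0 ln1 mulr0 expR0 subrr mul0r addr0 rpow_le1.
rewrite big_ord_recr /=; apply: le_trans (lerD IH (rpow_telescope (ltn0Sn n))) _.
by rewrite -addrA -mulrDl addrA subrK.
Qed.

(* On the k-th period, |xi| / 2 >= pi * kap k (for k = 0, -1 only |Xi| <= 1 is used). *)
Definition kap (k : int) : nat :=
  match k with Posz 0 => 1 | Posz n => n | Negz 0 => 1 | Negz n => n end.

Lemma kap_gt0 k : (0 < kap k)%N. Proof. by case: k => -[]. Qed.

Lemma zsum_kap_le N : zsum N (fun k => rpow (kap k)) <= 2 + 2 * (1 + (a - 1)^-1).
Proof.
have r1 : rpow 1 <= 1 by exact: rpow_le1.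
have S0 : 0 <= 1 + (a - 1)^-1 by rewrite addr_ge0 // invr_ge0 subr_ge0 ltW.
(* The 2 covers k = 0 and k = -1; the first sum comes from 1 <= k <= n + 1 and the second from -(n +
   1) <= k <= -2. *)
suff h n : zsum n.+1 (fun k => rpow (kap k)) <=
    2 + \sum_(i < n.+1) rpow i.+1 + \sum_(i < n) rpow i.+1.
  case: N => [|n]; first by rewrite zsum0 -[rpow _]/(rpow 1); lra.
  apply: le_trans (h n) _; have := sum_rpow_le n; have := sum_rpow_le n.+1; lra.
elim: n => [|n IH].
  rewrite zsumS zsum0 big_ord_recl !big_ord0 /=.
  lra.
have e1 : \sum_(i < n.+2) rpow i.+1 = \sum_(i < n.+1) rpow i.+1 + rpow n.+2 by rewrite big_ord_recr.
have e2 : \sum_(i < n.+1) rpow i.+1 = \sum_(i < n) rpow i.+1 + rpow n.+1 by rewrite big_ord_recr.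
rewrite zsumS /= e1; lra.
Qed.
End ZetaBound.

(** * The cardinal sine *)

Section Sinc.
Variable R : realType.

Definition sinc (x : R) : R := if x == 0 then 1 else sin x / x.

Lemma sincN x : sinc (- x) = sinc x.
Proof. by rewrite /sinc oppr_eq0 sinN invrN mulrNN. Qed.

(** The mean value theorem for sin on [0, x]; it yields both the bound by 1 and continuity at 0. *)
Lemma sinc_cos x : exists2 c, `|c| <= `|x| & sinc x = cos c.
Proof.
wlog x0 : x / 0 <= x.
  move=> H; case: (leP 0 x) => [/H //|/ltW x0].
  have [|c cx e] := H (- x); first by rewrite oppr_ge0.
  by exists c; [rewrite -[`|x|]normrN|rewrite -sincN].
rewrite /sinc; case: eqVneq => [->|xn0]; first by exists 0; rewrite ?cos0.
have {}x0 : 0 < x by rewrite lt_def xn0.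
have [c cI e] := @MVT _ sin cos 0 x x0 (fun y _ => is_derive_sin y)
  (continuous_subspaceT (@continuous_sin R)).
move: e; rewrite sin0 !subr0 => ->; move: cI; rewrite in_itv /= => /andP[c0 cx].
exists c; first by rewrite !gtr0_norm // ltW.
by rewrite mulfK.
Qed.

Lemma sinc_le1 x : `|sinc x| <= 1.
Proof. by have [c _ ->] := sinc_cos x; exact: cos_max. Qed.

Lemma abs_sin_le (x : R) : `|sin x| <= `|x|.
Proof.
have [->|x0] := eqVneq x 0; first by rewrite sin0.
have := sinc_le1 x; rewrite /sinc (negPf x0) normrM normfV ler_pdivrMr ?normr_gt0 //.
by rewrite mul1r.
Qed.

Lemma sinc_sub1 x : `|sinc x - 1| <= x ^+ 2.
Proof.
have [c cx ->] := sinc_cos x; rewrite cos_half.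
have -> : 1 - 2%:R * sin (c / 2%:R) ^+ 2 - 1 = - (2%:R * sin (c / 2%:R) ^+ 2) by ring.
have h2 : 0 <= 2%:R * sin (c / 2%:R) ^+ 2 by rewrite mulr_ge0 // sqr_ge0.
rewrite normrN ger0_norm // -(real_normK (num_real (sin (c / 2%:R)))).
have h1 := abs_sin_le (c / 2%:R); rewrite -(real_normK (num_real x)).
rewrite normrM [`|2^-1|]ger0_norm // in h1.
have := normr_ge0 (sin (c / 2%:R)); have := normr_ge0 c; nra.
Qed.

Lemma continuous_sinc : continuous sinc.
Proof.
move=> x; have [->|x0] := eqVneq x 0.
  have s0 : sinc 0 = 1 by rewrite /sinc eqxx.
  apply/cvgrPdist_le => e e0; rewrite s0.
  have h : (fun x : R => x ^+ 2) @ (0 : R) --> (0 : R) ^+ 2 by exact: exprn_continuous.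
  move: h; rewrite expr0n /= => /cvgrPdist_le /(_ e e0); apply: filterS => y.
  rewrite sub0r normrN ger0_norm ?sqr_ge0 // distrC; exact: le_trans (sinc_sub1 y).
have : (fun y => sin y / y) @ x --> sin x / x.
  by apply: cvgM; [exact: continuous_sin|apply: cvgV].
rewrite (_ : sin x / x = sinc x); last by rewrite /sinc (negPf x0).
apply: cvg_trans; apply: near_eq_cvg.
have : \forall y \near x, y != 0 by exact: (@open_nbhs_nbhs _ _ [set y : R | y != 0]).
apply: filterS => y /negPf yn0; by rewrite /sinc yn0.
Qed.

Lemma mul_sinc x : x * sinc x = sin x.
Proof.
rewrite /sinc; case: eqVneq => [->|x0]; first by rewrite mul0r sin0.
by rewrite mulrC divfK.
Qed.
End Sinc.

(** * The principal logarithm in polar coordinates *)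

Section Polar.
Variable R : realType.
Local Notation C := R[i].

Lemma tanBpi (x : R) : tan (x - pi) = tan x.
Proof. by rewrite -[in RHS](subrK pi x) tanDpi. Qed.

(** The branches of [carg] follow the signs of cos t and sin t; where cos t is nonzero, t lies
    within pi / 2 of 0, pi or -pi, so atan inverts tan up to a shift by pi. *)
Lemma carg_polar (r t : R) : 0 < r -> - pi < t <= pi -> carg (rC r * ce t) = t.
Proof.
move=> r0 /andP[t1 t2]; have pi0 := pi_gt0 R; have rn0 : r != 0 by rewrite gt_eqF.
have eRe : complex.Re (rC r * ce t) = r * cos t by rewrite cReM /= mul0r subr0.
have eIm : complex.Im (rC r * ce t) = r * sin t by rewrite cImM /= mul0r addr0.
rewrite /carg eRe eIm.
have e0 x : (0 < r * x) = (0 < x) by rewrite pmulr_rgt0.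
have e1 x : (r * x < 0) = (x < 0) by rewrite pmulr_rlt0.
have e2 x : (0 <= r * x) = (0 <= x) by rewrite pmulr_rge0.
have -> : r * sin t / (r * cos t) = tan t by rewrite -mulf_div divff // mul1r.
rewrite !e0 !e1 !e2.
have sneg : t < 0 -> sin t < 0.
  by move=> tn; rewrite -oppr_gt0 -sinN sin_gt0_pi //; apply/andP; split; lra.
have spos : 0 <= t -> 0 <= sin t by move=> tp; rewrite sin_ge0_pi // tp t2.
have [c0|c0|c0] := ltgtP 0 (cos t).
- apply: tanK; rewrite in_itv /=; apply/andP; split.
  + rewrite ltNge; apply/negP => h.
    have : 0 <= cos (t + pi) by apply: cos_ge0_pihalf; apply/andP; split; lra.
    by rewrite cosDpi; lra.
  + rewrite ltNge; apply/negP => h.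
    have : 0 <= cos (t - pi) by apply: cos_ge0_pihalf; apply/andP; split; lra.
    by have := cosDpi (t - pi); rewrite subrK; lra.
- case: ifPn => [s0|]; last rewrite -ltNge => s0.
  + have tp : 0 <= t by rewrite leNgt; apply/negP => /sneg; lra.
    rewrite -tanBpi tanK ?subrK // in_itv /=; apply/andP; split; last lra.
    rewrite ltNge; apply/negP => h.
    have : 0 <= cos t by apply: cos_ge0_pihalf; apply/andP; split; lra.
    lra.
  + have tn : t < 0 by rewrite ltNge; apply/negP => /spos; lra.
    rewrite -tanDpi tanK ?addrK // in_itv /=; apply/andP; split; first lra.
    rewrite ltNge; apply/negP => h.
    have : 0 <= cos t by apply: cos_ge0_pihalf; apply/andP; split; lra.
    lra.
- have cp (x : R) : 0 <= x <= pi -> cos x = 0 -> x = pi / 2.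
    move=> xI cx; apply: cos_inj; rewrite ?in_itv //= ?cos_pihalf //.
    by apply/andP; split; lra.
  have [s0|s0|s0] := ltgtP 0 (sin t).
  + by rewrite (cp t) // t2 andbT leNgt; apply/negP => /sneg; lra.
  + have tn : t < 0 by rewrite ltNge; apply/negP => /spos; lra.
    rewrite -[RHS]opprK; congr (- _); apply/esym/cp; last by rewrite cosN.
    by apply/andP; split; lra.
  + by have := cos2Dsin2 t; rewrite -c0 -s0 expr0n addr0 => /eqP; rewrite eq_sym oner_eq0.
Qed.

Lemma clog_polar (r t : R) : 0 < r -> - pi < t <= pi -> clog (rC r * ce t) = Complex (ln r) t.
Proof.
move=> r0 tI; rewrite /clog carg_polar //; congr Complex.
by rewrite -/(cabs _) cabsM cabs_ce mulr1 cabs_rC gtr0_norm.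
Qed.
End Polar.

(** * Powers of Xi *)

Section XiPower.
Variable R : realType.
Local Notation C := R[i].
Local Notation Re := complex.Re.
Local Notation Im := complex.Im.
Local Notation tpi := (2%:R * pi : R).
Implicit Types (w : C) (u x : R) (k : int).

(** Value 0 at z = 0, in agreement with the convention of [hpow]. *)
Definition cpw (z w : C) : C := if z == 0 then 0 else cexp (w * clog z).
Definition Fw w (xi : R) : C := cpw (Xi xi) w.

(** Factoring e^(-i xi / 2) out of 1 - e^(-i xi) leaves 2 i sin(xi / 2). *)
Lemma XiE (xi : R) : Xi xi = rC (sinc (xi / 2)) * ce (- (xi / 2)) :> C.
Proof.
rewrite /Xi; case: eqVneq => [->|x0].
  by rewrite mul0r oppr0 ce0 /sinc eqxx mulr1.
rewrite -mulrN -rCN cexp_ce.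
have cI0 : cI R * rC xi != 0.
  by apply: mulf_neq0; rewrite ?rC_eq0 // eq_complex /= oner_eq0 andbF.
apply: (mulIf cI0); rewrite divfK //.
have -> : rC (sinc (xi / 2)) * ce (- (xi / 2)) * (cI R * rC xi) =
    ce (- (xi / 2)) * cI R * rC (2 * (xi / 2 * sinc (xi / 2))).
  by rewrite [2 * _]mulrA [2 * (_ / _)]mulrC divfK // rCM; ring.
rewrite mul_sinc.
have -> : - xi = - (xi / 2) + - (xi / 2) by lra.
rewrite ceD; move: (xi / 2) => h; have := cos2Dsin2 h => e.
by apply: cext; rewrite !cE /= !cosN !sinN; nra.
Qed.

Lemma sin_pik k : sin (pi * k%:~R) = 0 :> R.
Proof.
have h n : sin (pi * n%:R) = 0 :> R.
  elim: n => [|n IH]; first by rewrite mulr0 sin0.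
  by rewrite -[n.+1%:R]natr1 mulrDr mulr1 sinDpi IH oppr0.
case: k => n; first exact: h.
by rewrite NegzE mulrNz mulrN sinN h oppr0.
Qed.

Lemma cos_pik_sqr k : cos (pi * k%:~R) ^+ 2 = 1 :> R.
Proof. by rewrite cos2sin2 sin_pik expr0n subr0. Qed.

Definition rr k u : R := `|sinc (u / 2 + pi * k%:~R)|.
(** The argument of [Xi] on the k-th period. The parity sign of sin(u / 2 + pi k) cancels against
    e^(-i pi k); what remains is the sign of u / 2 + pi k, hence the extra pi for k < 0. *)
Definition theta k u : R := (if (k < 0)%R then pi else 0) - u / 2.

Lemma cos_sinc_sign k u : 0 <= u <= tpi ->
  cos (pi * k%:~R) * sinc (u / 2 + pi * k%:~R) = (if (k < 0)%R then -1 else 1) * rr k u.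
Proof.
move=> /andP[u0 u1]; have pi0 := pi_gt0 R.
set y := u / 2 + _; set s := cos _.
have s2 : s ^+ 2 = 1 by exact: cos_pik_sqr.
have sn : `|s| = 1 by apply/eqP; rewrite -sqr_norm_eq1 s2.
have e : y * (s * sinc y) = sin (u / 2).
  by rewrite mulrCA mul_sinc /y sinD sin_pik mulr0 addr0 mulrCA -/s -expr2 s2 mulr1.
have sp : 0 <= sin (u / 2) by apply: sin_ge0_pi; apply/andP; split; lra.
have nE : `|s * sinc y| = rr k u by rewrite normrM sn mul1r.
have kk : if (k < 0)%R then k%:~R <= -1 :> R else 0 <= k%:~R :> R.
  by case: ifP => h; [rewrite -[-1]/((-1)%:~R) ler_int; lia|rewrite ler0z; lia].
move: kk; case: ifPn => k0 kk.
  have y0 : y <= 0 by rewrite /y; nra.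
  rewrite mulN1r -nE ler0_norm ?opprK //.
  (* y = 0 forces k = -1 and u = 2 pi, where sinc y = 1 and cos(pi k) = -1. *)
  have [yE|yn0] := eqVneq y 0; last first.
    by rewrite -(@nmulr_rge0 _ y) ?e // lt_def eq_sym yn0.
  have k1 : k = -1.
    suff : -1 <= k%:~R :> R by rewrite -[-1]/((-1)%:~R) ler_int; lia.
    by move: yE; rewrite /y; nra.
  by rewrite yE /sinc eqxx mulr1 /s k1 mulrN1 cosN cospi lerN10.
have y0 : 0 <= y by rewrite /y addr_ge0 // ?divr_ge0 // mulr_ge0 // ltW.
rewrite mul1r -nE ger0_norm //.
have [yE|yn0] := eqVneq y 0; last first.
  by rewrite -(@pmulr_rge0 _ y) ?e // lt_def yn0.
have k1 : k%:~R = 0 :> R by move: yE; rewrite /y; nra.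
by rewrite yE /sinc eqxx mulr1 /s k1 mulr0 cos0.
Qed.

Lemma Xi_cell k u : 0 <= u <= tpi -> Xi (u + tpi * k%:~R) = rC (rr k u) * ce (theta k u) :> C.
Proof.
move=> uI; rewrite XiE.
have -> : (u + tpi * k%:~R) / 2 = u / 2 + pi * k%:~R by field.
have -> : ce (- (u / 2 + pi * k%:~R)) = rC (cos (pi * k%:~R)) * ce (- (u / 2)) :> C.
  rewrite opprD ceD mulrC; congr (_ * _).
  by apply: cext; rewrite /= ?cosN ?sinN ?sin_pik ?oppr0.
rewrite mulrA -rCM mulrC [X in rC X]mulrC cos_sinc_sign // rCM /theta ceD.
case: ifP => _; last by rewrite ce0 rC1; ring.
have -> : ce pi = rC (-1) :> C by apply: cext; rewrite /= ?cospi ?sinpi.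
ring.
Qed.

Definition Phi w (r : R) : C := if 0 < r then cexp (w * rC (ln r)) else 0.
(** The k-th term of the periodization on the closed period. The explicit angle makes continuity in
    u and the bound by [maj] accessible without the branch cut of [clog]. *)
Definition Tk w k u : C := Phi w (rr k u) * cexp (w * (cI R * rC (theta k u))).

Lemma rr_ge0 k u : 0 <= rr k u. Proof. exact: normr_ge0. Qed.

Lemma theta_itv k u : 0 <= u <= tpi -> - pi <= theta k u <= pi.
Proof.
by move=> /andP[h1 h2]; have := pi_gt0 R; rewrite /theta; case: ifP => _ p0; apply/andP; split; lra.
Qed.

Lemma Fw_cell w k u : 0 <= u <= tpi -> Fw w (u + tpi * k%:~R) = Tk w k u.
Proof.
move=> uI; rewrite /Fw /cpw Xi_cell // /Tk /Phi.
have := rr_ge0 k u; rewrite le_eqVlt => /predU1P[r0|r0].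
  by rewrite -r0 rC0 mul0r eqxx ltxx mul0r.
rewrite r0 mulf_eq0 rC_eq0 gt_eqF // (negPf (ce_neq0 _)) /=.
rewrite clog_polar // -?cexpD ?mulrDr -?mulrDr.
  by congr cexp; congr (_ * _); apply: cext; rewrite !cE /=; ring.
(* The angle -pi, excluded from the principal range, occurs only for k >= 0 and u = 2 pi, where the
   modulus vanishes. *)
have /andP[t1 t2] := theta_itv k uI; rewrite t2 andbT lt_def t1 andbT.
apply/eqP => tE; move: r0; rewrite /rr.
have pi0 := pi_gt0 R; move: tE; rewrite /theta; case: ifPn => k0 tE.
  by move/andP: uI => [_ h]; move: tE; lra.
have uE : u = tpi by move: tE; lra.
have -> : u / 2 + pi * k%:~R = pi * (k + 1)%:~R by rewrite uE intrD; field.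
have kp : 0 < (k + 1)%:~R :> R by rewrite ltr0z; lia.
by rewrite /sinc sin_pik mul0r gt_eqF ?mulr_gt0 // normr0 ltxx.
Qed.

Lemma rr_le k u : 0 <= u <= tpi -> rr k u <= (kap k)%:R^-1.
Proof.
move=> /andP[u0 u1].
have h (n : nat) : (0 < n)%N -> n%:R <= `|u / 2 + pi * k%:~R| -> rr k u <= n%:R^-1.
  move=> n0; set y := _ + _ => ny; have n0' : 0 < n%:R :> R by rewrite ltr0n.
  have y0 : 0 < `|y| by exact: lt_le_trans ny.
  rewrite /rr -/y /sinc; rewrite normr_gt0 in y0; rewrite (negPf y0) normrM normfV.
  rewrite ler_pdivrMr ?normr_gt0 // mulrC -ler_pdivrMr ?invr_gt0 // invrK.
  apply: le_trans ny; rewrite -[leRHS]mul1r ler_wpM2r // ?ler0n //; exact: sin_max.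
have p1 : 1 <= pi :> R by apply: le_trans (pi_ge2 R); rewrite ler1n.
case: k h => [[|n]|[|n]] h.
- by rewrite /= invr1; exact: sinc_le1.
- apply: h => //=; apply: le_trans (ler_norm _).
  by have : 0 <= n.+1%:R :> R by []; rewrite -[_%:~R]/(n.+1%:R); nra.
- by rewrite /= invr1; exact: sinc_le1.
- apply: h => //=; rewrite -normrN; apply: le_trans (ler_norm _).
  rewrite NegzE mulrNz -[_%:~R]/(n.+2%:R) -[n.+2%:R]natr1.
  by have : 0 <= n.+1%:R :> R by []; nra.
Qed.

(** The exponential bounds |e^(i w theta)| for |theta| <= pi; the other factor is (kap k)^(-Re w),
    from [rr_le]. *)
Definition maj w k : R := expR (pi * `|Im w|) * rpow (Re w) (kap k).

Lemma maj_ge0 w k : 0 <= maj w k. Proof. by rewrite mulr_ge0 // expR_ge0. Qed.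

Lemma cabs_Tk w k u : 1 < Re w -> 0 <= u <= tpi -> cabs (Tk w k u) <= maj w k.
Proof.
move=> a1 uI; rewrite cabsM mulrC; apply: ler_pM; rewrite ?cabs_ge0 //.
  rewrite cabs_cexp ler_expR.
  have -> : Re (w * (cI R * rC (theta k u))) = - (Im w * theta k u) by rewrite !cE /=; ring.
  apply: le_trans (ler_norm _) _; rewrite normrN normrM mulrC ler_wpM2r //.
  by rewrite ler_norml; exact: theta_itv.
have k0 : 0 < (kap k)%:R :> R by rewrite ltr0n kap_gt0.
rewrite /Phi; case: ifPn => r0; last by rewrite cabs0 expR_ge0.
rewrite cabs_cexp ler_expR cReM /= mulr0 subr0 mulNr -mulrN.
rewrite ler_pM2l; last exact: lt_trans a1.
by rewrite -lnV ?posrE // ler_ln ?posrE ?invr_gt0 // rr_le.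
Qed.

Definition ccont (f : R -> C) x := {for x, continuous (fun y => Re (f y))} /\
  {for x, continuous (fun y => Im (f y))}.

Lemma ccontM f g x : ccont f x -> ccont g x -> ccont (fun y => f y * g y) x.
Proof.
move=> [f1 f2] [g1 g2]; split.
  rewrite (_ : (fun y => _) = (fun y => Re (f y) * Re (g y) - Im (f y) * Im (g y))).
    by apply: cvgB; apply: cvgM.
  by apply/funext => y; rewrite cReM.
rewrite (_ : (fun y => _) = (fun y => Re (f y) * Im (g y) + Im (f y) * Re (g y))).
  by apply: cvgD; apply: cvgM.
by apply/funext => y; rewrite cImM.
Qed.

Lemma ccontD f g x : ccont f x -> ccont g x -> ccont (fun y => f y + g y) x.
Proof.
move=> [f1 f2] [g1 g2]; split.
  rewrite (_ : (fun y => _) = (fun y => Re (f y) + Re (g y))); first exact: cvgD.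
  by apply/funext => y; rewrite cReD.
rewrite (_ : (fun y => _) = (fun y => Im (f y) + Im (g y))); first exact: cvgD.
by apply/funext => y; rewrite cImD.
Qed.

Lemma ccont_cst (c : C) x : ccont (fun=> c) x.
Proof. by split; exact: cvg_cst. Qed.

Lemma ccont_rC (f : R -> R) x : {for x, continuous f} -> ccont (fun y => rC (f y)) x.
Proof. by move=> cf; split => //=; exact: cvg_cst. Qed.

Lemma ccont_cexp f x : ccont f x -> ccont (fun y => cexp (f y)) x.
Proof.
move=> [f1 f2]; split => /=.
  apply: (@cvgM _ _ _ _ (fun y => expR (Re (f y))) (fun y => cos (Im (f y)))).
    by apply: (continuous_comp f1); exact: continuous_expR.
  by apply: (continuous_comp f2); exact: continuous_cos.
apply: (@cvgM _ _ _ _ (fun y => expR (Re (f y))) (fun y => sin (Im (f y)))).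
  by apply: (continuous_comp f1); exact: continuous_expR.
by apply: (continuous_comp f2); exact: continuous_sin.
Qed.

Lemma ccont_zsum N (F : int -> R -> C) x : (forall k, ccont (F k) x) ->
  ccont (fun y => zsum N (F ^~ y)) x.
Proof.
move=> cF; elim: N => [|N IH]; first by under eq_fun do rewrite zsum0.
by under eq_fun do rewrite zsumS; apply: ccontD => //; apply: ccontD.
Qed.

Lemma ccont_near (f : R -> C) x e : ccont f x -> 0 < e ->
  \forall y \near x, cabs (f y - f x) <= e.
Proof.
move=> [f1 f2] e0; have e2 : 0 < e / 2 by rewrite divr_gt0.
move/cvgrPdist_le : f1 => /(_ _ e2) h1; move/cvgrPdist_le : f2 => /(_ _ e2) h2.
apply: filterS2 h1 h2 => y h1 h2.
apply: le_trans (cabs_le _) _; rewrite [e](splitr e) cReB cImB; apply: lerD.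
  by rewrite distrC.
by rewrite distrC.
Qed.

Lemma near_ccont (f g : R -> C) x : (\forall y \near x, f y = g y) -> f x = g x ->
  ccont g x -> ccont f x.
Proof.
move=> fg fgx [g1 g2]; split; rewrite /prop_for /continuous_at fgx.
  by apply: cvg_trans g1; apply: near_eq_cvg; apply: filterS fg => y ->.
by apply: cvg_trans g2; apply: near_eq_cvg; apply: filterS fg => y ->.
Qed.

(** At a zero of [g], |r^w| = r^(Re w) <= r for 0 < r <= 1, so the extension by 0 is continuous. *)
Lemma ccont_Phi w (g : R -> R) x : 1 < Re w -> (forall y, 0 <= g y) ->
  {for x, continuous g} -> ccont (fun y => Phi w (g y)) x.
Proof.
move=> a1 g0 cg; have := g0 x; rewrite le_eqVlt => /predU1P[gx|gx].
  have Px0 : Phi w (g x) = 0 by rewrite -gx /Phi ltxx.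
  have sm e : 0 < e -> \forall y \near x, cabs (Phi w (g y)) <= e.
    move=> e0; pose e' := Num.min e 1.
    have e'0 : 0 < e' by rewrite lt_min e0 ltr01.
    move/cvgrPdist_le : cg => /(_ _ e'0); apply: filterS => y.
    rewrite -gx sub0r normrN ger0_norm // le_min => /andP[ge g1].
    rewrite /Phi; case: ifPn => gy; last by rewrite cabs0 ltW.
    apply: le_trans ge; rewrite cabs_cexp cReM /= mulr0 subr0.
    rewrite -[leRHS]lnK ?posrE // ler_expR.
    have : ln (g y) <= 0 by exact: ln_le0.
    nra.
  split; rewrite /prop_for /continuous_at Px0; apply/cvgrPdist_le => e e0; have := sm e e0;
    apply: filterS => y; rewrite sub0r normrN; apply: le_trans.
    exact: normRe_le.
  exact: normIm_le.
apply: (@near_ccont _ (fun y => cexp (w * rC (ln (g y))))).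
- have : \forall y \near x, 0 < g y by exact: (cvgr_gt _ cg).
  by apply: filterS => y gy; rewrite /Phi gy.
- by rewrite /Phi gx.
- apply: ccont_cexp; apply: ccontM; first exact: ccont_cst.
  by apply: ccont_rC; apply: (continuous_comp cg); exact: continuous_ln.
Qed.

Lemma ccont_Tk w k x : 1 < Re w -> ccont (Tk w k) x.
Proof.
move=> a1; have c2 : {for x, continuous (fun y : R => y / 2)} by apply: mulrr_continuous.
apply: ccontM.
  apply: ccont_Phi => // [y|]; first exact: rr_ge0.
  apply: (@continuous_comp _ _ _ (fun y : R => sinc (y / 2 + pi * k%:~R)) (fun z : R => `|z|)).
    apply: (@continuous_comp _ _ _ (fun y : R => y / 2 + pi * k%:~R) (@sinc R)).
      by apply: cvgD => //; exact: cvg_cst.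
    exact: continuous_sinc.
  exact: norm_continuous.
apply: ccont_cexp; apply: ccontM; first exact: ccont_cst.
apply: ccontM; first exact: ccont_cst.
by apply: ccont_rC; apply: cvgB => //; exact: cvg_cst.
Qed.
End XiPower.

(** * The periodized symbol: periodicity, modulus of continuity, lower bound *)

Section Symbol.
Variables (R : realType) (w : R[i]).
Local Notation C := R[i].
Local Notation Re := complex.Re.
Local Notation Im := complex.Im.
Local Notation tpi := (2%:R * pi : R).
Hypothesis a1 : 1 < Re w.
Implicit Types (u x : R) (k : int).

Definition Pw (xi : R) : C := clim (fun N => zsum N (fun k => Fw w (xi + tpi * k%:~R))).

Definition majB : R := expR (pi * `|Im w|) * (2 + 2 * (1 + (Re w - 1)^-1)).

Lemma zsum_maj_le N : zsum N (maj w) <= majB.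
Proof. by rewrite /maj zsumMl ler_wpM2l ?expR_ge0 // zsum_kap_le. Qed.

Lemma majB_gt0 : 0 < majB.
Proof.
rewrite mulr_gt0 ?expR_gt0 //.
have : 0 < (Re w - 1)^-1 by rewrite invr_gt0 subr_gt0.
lra.
Qed.

Lemma cell_itv x : cell tpi x -> 0 <= x <= tpi.
Proof. by rewrite /cell /= in_itv /= => /andP[-> /ltW ->]. Qed.

Lemma vanish_Tk u : 0 <= u <= tpi -> vanish (fun k => Tk w k u).
Proof.
move=> uI e e0; have [n hn] := zsum_vanish (maj_ge0 w) zsum_maj_le e0.
by exists n => k nk; apply: le_trans (hn k nk); exact: cabs_Tk.
Qed.

Lemma real_cell x : exists u j, cell tpi u /\ x = u + tpi * j%:~R.
Proof.
exists (x - tpi * (Num.floor (x / tpi))%:~R), (Num.floor (x / tpi)).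
by rewrite subrK; split=> //; apply/cell_floor => //; exact: tpi_gt0.
Qed.

(** On the j-th period the partial sums are those of [Tk] with index shifted by j; the terms vanish
    at infinity, so the limit ignores the shift. Periodicity of P follows. *)
Lemma cvg_Pw_shift u j : 0 <= u <= tpi ->
  cabs (zsum N (fun k => Fw w (u + tpi * j%:~R + tpi * k%:~R)) -
    clim (fun N => zsum N (fun k => Tk w k u))) @[N --> \oo] --> (0 : R).
Proof.
move=> uI.
have -> : (fun N => cabs (zsum N (fun k => Fw w (u + tpi * j%:~R + tpi * k%:~R)) -
    clim (fun N => zsum N (fun k => Tk w k u)))) =
  (fun N => cabs (zsum N (fun k => Tk w (k + j) u) - clim (fun N => zsum N (fun k => Tk w k u)))).
  apply/funext => N; congr (cabs (_ - _)); apply: eq_zsum => k _.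
  by rewrite -Fw_cell // -addrA -mulrDr -intrD [j + k]addrC.
apply: (cvg_zsum_shift j (vanish_Tk uI)).
by apply: (cvg_zsum_clim (maj_ge0 w) zsum_maj_le) => k; exact: cabs_Tk.
Qed.

Lemma Pw_shift u j : 0 <= u <= tpi -> Pw (u + tpi * j%:~R) = clim (fun N => zsum N (fun k => Tk w k u)).
Proof. by move=> uI; apply: cvg_clim_eq; exact: cvg_Pw_shift. Qed.

Lemma cvg_Pw x :
  cabs (zsum N (fun k => Fw w (x + tpi * k%:~R)) - Pw x) @[N --> \oo] --> (0 : R).
Proof.
have [u [j [/cell_itv uI ->]]] := real_cell x.
by rewrite Pw_shift //; exact: cvg_Pw_shift.
Qed.

Lemma Pw_period x j : Pw (x + tpi * j%:~R) = Pw x.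
Proof.
have [u [l [/cell_itv uI ->]]] := real_cell x.
by rewrite -addrA -mulrDr -intrD !Pw_shift.
Qed.

Lemma cvg_Pw_cell u : 0 <= u <= tpi ->
  cabs (zsum N (fun k => Tk w k u) - Pw u) @[N --> \oo] --> (0 : R).
Proof.
move=> uI; have := cvg_Pw u.
rewrite (_ : (fun N => cabs (zsum N (fun k => Fw w (u + tpi * k%:~R)) - Pw u)) =
  (fun N => cabs (zsum N (fun k => Tk w k u) - Pw u))) //.
by apply/funext => N; congr (cabs (_ - _)); apply: eq_zsum => k _; exact: Fw_cell.
Qed.

Opaque Pw.

Lemma measurable_carg (f : R -> C) : cmeas setT f -> measurable_fun setT (fun x => carg (f x)).
Proof.
move=> [f1 f2].
have m1 : measurable_fun setT (fun x => atan (Im (f x) / Re (f x))).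
  apply: (measurableT_comp (continuous_measurable_fun (@continuous_atan R))).
  by apply: measurable_funM => //; exact: (measurableT_comp (@measurable_inv R)).
apply: measurable_fun_ifT => //; first exact: measurable_fun_ltr.
apply: measurable_fun_ifT; first exact: measurable_fun_ltr.
  apply: measurable_fun_ifT; first exact: measurable_fun_ler.
    by apply: measurable_funD => //; exact: measurable_cst.
  by apply: measurable_funB => //; exact: measurable_cst.
apply: measurable_fun_ifT; [exact: measurable_fun_ltr|exact: measurable_cst|].
by apply: measurable_fun_ifT; [exact: measurable_fun_ltr|exact: measurable_cst|exact: measurable_cst].
Qed.

Lemma cmeas_cexp (f : R -> C) : cmeas setT f -> cmeas setT (fun x => cexp (f x)).
Proof.
move=> [f1 f2].
have -> : (fun x => cexp (f x)) = (fun x => rC (expR (Re (f x))) * ce (Im (f x))).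
  by apply/funext => x; rewrite cexpE.
apply: cmeasM; last exact: cmeas_ce.
by apply: cmeas_rC; apply: (measurableT_comp (@measurable_expR R)).
Qed.

Lemma cmeas_Xi : cmeas setT (@Xi R).
Proof.
have -> : @Xi R = (fun xi => rC (sinc (xi / 2)) * ce (- (xi / 2))).
  by apply/funext => xi; exact: XiE.
have h : measurable_fun setT (fun xi : R => xi / 2) by apply: measurable_funM => //; exact: measurable_cst.
apply: cmeasM; last by apply: cmeas_ce; exact: measurable_funN.
apply: cmeas_rC; exact: (measurableT_comp (continuous_measurable_fun (@continuous_sinc R))).
Qed.

Lemma cmeas_Fw : cmeas setT (Fw w).
Proof.
have mX := cmeas_Xi.
have mL : cmeas setT (fun x => clog (Xi x) : C).
  split => /=; last exact: measurable_carg.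
  by apply: (measurableT_comp (@measurable_ln R)); exact: measurable_cabs.
have [m1 m2] : cmeas setT (fun x => cexp (w * clog (Xi x))).
  by apply: cmeas_cexp; apply: cmeasM => //; exact: cmeas_cst.
have mb : measurable_fun setT (fun x : R => Xi x == 0 :> C).
  rewrite (_ : (fun x => _) = (fun x => cmod2 (Xi x) == 0)); last first.
    by apply/funext => x; rewrite cmod2_eq0.
  by apply: measurable_fun_eqr => //; exact: measurable_cmod2.
split.
  rewrite (_ : (fun x => _) = (fun x => if Xi x == 0 then 0 else Re (cexp (w * clog (Xi x))))).
    by apply: measurable_fun_ifT.
  by apply/funext => x; rewrite /Fw /cpw; case: ifP.
rewrite (_ : (fun x => _) = (fun x => if Xi x == 0 then 0 else Im (cexp (w * clog (Xi x))))).
  by apply: measurable_fun_ifT.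
by apply/funext => x; rewrite /Fw /cpw; case: ifP.
Qed.

Lemma adm_Fw : adm (Fw w) majB.
Proof.
split; first exact: cmeas_Fw.
move=> x N /cell_itv xI; apply: le_trans (zsum_maj_le N); apply: ler_zsum => k.
by rewrite Fw_cell //; exact: cabs_Tk.
Qed.

Lemma cmeas_Pw : cmeas setT Pw.
Proof.
have mN N : cmeas setT (fun x => zsum N (fun k => Fw w (x + tpi * k%:~R))).
  apply: (@cmeas_zsum _ _ _ (fun k x => Fw w (x + tpi * k%:~R))) => k.
  have [m1 m2] := cmeas_Fw.
  by split; [exact: (measurable_comp_shift _ m1)|exact: (measurable_comp_shift _ m2)].
split.
  apply: (measurable_fun_cvg (fun N => (mN N).1)) => x _.
  by have [] := cvg_cabs (cvg_Pw x).
apply: (measurable_fun_cvg (fun N => (mN N).2)) => x _.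
by have [] := cvg_cabs (cvg_Pw x).
Qed.

Lemma Pw_uniform e : 0 < e -> exists n, forall u, 0 <= u <= tpi ->
  cabs (Pw u - zsum n (fun k => Tk w k u)) <= e.
Proof.
move=> e0; have e2 : 0 < e / 2 by rewrite divr_gt0.
have [n hn] := zsum_tail (maj_ge0 w) zsum_maj_le e2.
exists n => u uI; have /cvgrPdist_le /(_ _ e2) [N0 _ hN0] := cvg_Pw_cell uI.
pose N := maxn n N0.
have h1 := hN0 N (leq_maxr _ _); rewrite /= sub0r normrN ger0_norm ?cabs_ge0 // in h1.
have h2 := hn N (leq_maxl _ _).
have h3 := zsum_diff_le (fun k => cabs_Tk k a1 uI) (leq_maxl n N0).
rewrite -(subrK (zsum N (fun k => Tk w k u)) (Pw u)) -addrA [e](splitr e).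
apply: le_trans (cabsD _ _) _; apply: lerD; first by rewrite cabs_sub.
exact: le_trans h3 h2.
Qed.

Lemma cabs_tri (x y z : C) : cabs (x - z) <= cabs (x - y) + cabs (y - z).
Proof. by rewrite -{1}(subrK y x) -addrA; exact: cabsD. Qed.

(** Relative to the closed period, where [Tk] represents the terms and the Weierstrass test applies;
    the two ends are joined in [Pw_wrap]. *)
Lemma Pw_cont x e : 0 <= x <= tpi -> 0 < e ->
  \forall y \near x, 0 <= y <= tpi -> cabs (Pw y - Pw x) <= e.
Proof.
move=> xI e0; have e3 : 0 < e / 3 by rewrite divr_gt0.
have [n hn] := Pw_uniform e3.
have := @ccont_near _ (fun y => zsum n (fun k => Tk w k y)) x _
  (@ccont_zsum _ n (Tk w) x (fun k => ccont_Tk k x a1)) e3.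
apply: filterS => y hy yI.
apply: le_trans (cabs_tri _ (zsum n (fun k => Tk w k y)) _) _.
apply: le_trans (lerD (hn y yI) (cabs_tri _ (zsum n (fun k => Tk w k x)) _)) _.
have h2 := hn x xI; rewrite cabs_sub in h2.
move: hy h2; set s := cabs _; set t := cabs _ => hy h2; lra.
Qed.

Let K : set R := `[0, tpi]%classic.
Let KE x : K x <-> 0 <= x <= tpi. Proof. by rewrite /K /= in_itv /=. Qed.

Let near_K (P : R -> R -> Prop) :
  (forall x, K x -> \forall x' \near x & i \near 0^'+, K x' -> P i x') ->
  \forall i \near (0 : R)^'+, K `<=` P i.
Proof.
move=> h; have : near_covering_within K.
  by apply/near_covering_withinP/compact_near_coveringP; exact: segment_compact.
by apply.
Qed.

Lemma Pw_unif_cont e : 0 < e -> exists2 d, 0 < d & forall x y, 0 <= x <= tpi -> 0 <= y <= tpi ->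
  `|x - y| < d -> cabs (Pw x - Pw y) <= e.
Proof.
move=> e0; have e2 : 0 < e / 2 by rewrite divr_gt0.
pose P d x := forall y, 0 <= y <= tpi -> `|x - y| < d -> cabs (Pw x - Pw y) <= e.
have : \forall d \near (0 : R)^'+, K `<=` P d.
  apply: near_K => x /KE xI.
  have /nbhs_ballP [r /= r0 hr] := Pw_cont xI e2.
  have r2 : 0 < r / 2 by rewrite divr_gt0.
  exists (ball x (r / 2), [set d | d < r / 2]) => /=.
    split; first exact: nbhsx_ballx.
    exact: nbhs_right_lt.
  case=> x' d [/= xx' dr] /KE x'I y yI xy.
  have b1 : ball x r x' by apply: (le_ball _ xx'); lra.
  have b2 : ball x r y.
    rewrite /ball /=; rewrite /ball /= in xx'.
    have -> : x - y = (x - x') + (x' - y) by ring.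
    apply: le_lt_trans (ler_normD _ _) _; lra.
  have h1 := hr _ b1 x'I; have h2 := hr _ b2 yI.
  apply: le_trans (cabs_tri _ (Pw x) _) _; rewrite (splitr e).
  by apply: lerD; [exact: h1|rewrite cabs_sub; exact: h2].
move=> h; have : \forall d \near (0 : R)^'+, 0 < d /\ K `<=` P d.
  near=> d; split; first by near: d; exact: nbhs_right_gt.
  by near: d.
move=> /filter_ex [d [d0 hd]]; exists d => // x y xI yI xy.
exact: (hd x (proj2 (KE x) xI)).
Unshelve. all: by end_near. Qed.

Lemma Pw_tpi : Pw tpi = Pw 0.
Proof. by have := Pw_period 0 1; rewrite add0r mulr1. Qed.

(** Points near opposite ends of the period are compared through P(2 pi) = P(0). *)
Lemma Pw_wrap d d' e : d' <= d ->
  (forall x y, 0 <= x <= tpi -> 0 <= y <= tpi -> `|x - y| < d -> cabs (Pw x - Pw y) <= e / 2) ->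
  forall x y, 0 <= x <= tpi -> 0 <= y <= tpi -> tpi - d' < `|x - y| -> cabs (Pw x - Pw y) <= e.
Proof.
move=> dd hd x y; wlog xy : x y / y <= x.
  move=> H xI yI h; case: (leP y x) => yx; first exact: H.
  by rewrite cabs_sub; apply: H => //; [exact: ltW|rewrite distrC].
move=> xI yI; rewrite ger0_norm ?subr_ge0 // => h.
have tp := tpi_gt0 R.
have tI : 0 <= tpi <= tpi by rewrite lexx ltW.
have zI : 0 <= (0 : R) <= tpi by rewrite lexx ltW.
have n1 : `|x - tpi| < d.
  clear hd; case/andP: xI => ? ?; case/andP: yI => ? ?.
  by rewrite ler0_norm; lra.
have n2 : `|0 - y| < d.
  clear hd; case/andP: xI => ? ?; case/andP: yI => ? ?.
  by rewrite ler0_norm; lra.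
apply: le_trans (cabs_tri _ (Pw tpi) _) _; rewrite (splitr e); apply: lerD.
  exact: (hd _ _ xI tI n1).
rewrite Pw_tpi; exact: (hd _ _ zI yI n2).
Qed.

(** The form required by [trig_approx]: modulo 2 pi, either the points are close and uniform
    continuity applies, or 1 - cos(u - s) is bounded below and the sup bound on P suffices. *)
Lemma Pw_modulus e : 0 < e -> exists M, forall u s,
  cabs (Pw u - Pw s) <= e + M * (1 - cos (u - s)).
Proof.
move=> e0; have e2 : 0 < e / 2 by rewrite divr_gt0.
have [d d0 hd] := Pw_unif_cont e2.
have pi0 := pi_gt0 R.
(* With d' <= pi, cosine decreases on [d', pi], and reflection at pi covers the rest of
   [d', 2 pi - d']. *)
pose d' := Num.min d pi; have d'0 : 0 < d' by rewrite lt_min d0 pi0.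
have [dd dpi] : d' <= d /\ d' <= pi by rewrite !ge_min !lexx orbT.
have Pb x : cabs (Pw x) <= majB.
  have [u [j [/cell_itv uI ->]]] := real_cell x; rewrite Pw_period.
  apply: (@cvgr_to_le _ (\oo) _ _ (fun N => cabs (zsum N (fun k => Tk w k u))) _ majB).
    apply/cvgrPdist_le => r r0; move/cvgrPdist_le : (cvg_Pw_cell uI) => /(_ _ r0).
    apply: filterS => N; rewrite sub0r normrN ger0_norm ?cabs_ge0 // => h.
    apply: le_trans h; move: (zsum N _) (Pw u) => z p.
    have h1 := cabsD (z - p) p; have h2 := cabsD (p - z) z.
    rewrite !subrK in h1 h2; rewrite [cabs (p - z)]cabs_sub in h2.
    by rewrite ler_norml; apply/andP; split; lra.
  apply: nearW => N; apply: le_trans (cabs_zsum _ _) _; apply: le_trans (zsum_maj_le N).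
  by apply: ler_zsum => k; exact: cabs_Tk.
have cd : 0 < 1 - cos d'.
  rewrite subr_gt0; apply: cos_lt1; first by rewrite gt_eqF.
  by rewrite gtr0_norm //; lra.
have cosle t : d' <= t <= tpi - d' -> 1 - cos d' <= 1 - cos t.
  move=> /andP[t1 t2]; rewrite lerD2l lerN2.
  have [tp|tp] := leP t pi.
    have [->//|td] := eqVneq t d'.
    apply: ltW; rewrite ltr_cos ?in_itv /=; first by rewrite lt_def td.
      by apply/andP; split; lra.
    by apply/andP; split; lra.
  have -> : cos t = cos (tpi - t).
    by rewrite -[RHS]cosN opprB -[in LHS](subrK tpi t) mulr_natl cosD2pi.
  have [<-//|td] := eqVneq d' (tpi - t).
  apply: ltW; rewrite ltr_cos ?in_itv /=; first by rewrite lt_def eq_sym td /=; lra.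
    by apply/andP; split; lra.
  by apply/andP; split; lra.
exists (2 * majB / (1 - cos d')) => u s.
have [u' [j [/cell_itv uI ->]]] := real_cell u.
have [s' [l [/cell_itv sI ->]]] := real_cell s.
rewrite !Pw_period.
have -> : cos (u' + tpi * j%:~R - (s' + tpi * l%:~R)) = cos (u' - s').
  have -> : u' + tpi * j%:~R - (s' + tpi * l%:~R) = (u' - s') + tpi * (j - l)%:~R.
    by rewrite intrB; ring.
  by have /(congr1 (@complex.Re R)) := ce_period (u' - s') (j - l).
have maj0 := majB_gt0.
have M0 : 0 <= 2 * majB / (1 - cos d').
  by rewrite divr_ge0 ?ltW // mulr_gt0.
have Mc0 t : 0 <= 2 * majB / (1 - cos d') * (1 - cos t).
  by rewrite mulr_ge0 // subr_ge0 cos_le1.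
have small e' (z : R) t : e' <= e -> z <= e' -> z <= e + 2 * majB / (1 - cos d') * (1 - cos t).
  by move=> h1 h2; have := Mc0 t; move: (_ * (1 - cos t)) => q; lra.
have [us|us] := ltP `|u' - s'| d'.
  apply: (@small (e / 2)); first by lra.
  by apply: hd => //; exact: lt_le_trans us dd.
have [us2|us2] := leP `|u' - s'| (tpi - d').
  have h : 1 - cos d' <= 1 - cos (u' - s').
    by rewrite -(cos_norm (u' - s')); apply: cosle; rewrite us.
  apply: (@le_trans _ _ (2 * majB)).
    apply: le_trans (cabsD _ _) _; rewrite cabsN.
    by rewrite mulr_natl mulr2n; apply: lerD.
  apply: (@le_trans _ _ (2 * majB / (1 - cos d') * (1 - cos (u' - s')))); last by rewrite lerDr ltW.
  have MB : 0 < 2 * majB by rewrite mulr_gt0.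
  by rewrite mulrAC ler_pdivlMr // (ler_pM2l MB).
apply: (small e _ _ (lexx e)).
by apply: (Pw_wrap dd hd).
Qed.

(** Near each point |P| stays above half its value there; compactness yields one bound for the
    period, and periodicity extends it to the line. *)
Lemma Pw_lower_bound : (forall u, 0 <= u <= tpi -> Pw u != 0) ->
  exists2 c, 0 < c & forall x, c <= cabs (Pw x).
Proof.
move=> Pn0.
have : \forall c \near (0 : R)^'+, K `<=` (fun x => c <= cabs (Pw x)).
  apply: (near_K (P := fun c x => c <= cabs (Pw x))) => x /KE xI.
  have Px : 0 < cabs (Pw x) by rewrite cabs_gt0 Pn0.
  have Px2 : 0 < cabs (Pw x) / 2 by rewrite divr_gt0.
  exists ([set y | 0 <= y <= tpi -> cabs (Pw y - Pw x) <= cabs (Pw x) / 2],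
          [set c | c < cabs (Pw x) / 2]) => /=.
    by split; [exact: Pw_cont|exact: nbhs_right_lt].
  case=> y c [/= hy hc] /KE yI; have := hy yI; rewrite cabs_sub => h.
  have := cabsD (Pw x - Pw y) (Pw y); rewrite subrK => h2.
  apply: (le_trans (ltW hc)); rewrite -(lerD2l (cabs (Pw x) / 2)) -splitr.
  by apply: (le_trans h2); rewrite lerD2r.
move=> h; have : \forall c \near (0 : R)^'+, 0 < c /\ K `<=` (fun x => c <= cabs (Pw x)).
  near=> c; split; first by near: c; exact: nbhs_right_gt.
  by near: c.
move=> /filter_ex [c [c0 hc]]; exists c => // x.
have [u [j [/cell_itv uI ->]]] := real_cell x; rewrite Pw_period.
exact: (hc u (proj2 (KE u) uI)).
Unshelve. all: by end_near. Qed.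
End Symbol.

(** * Non-vanishing of the periodized symbol *)

Lemma zsum_split (V : nmodType) N (f : int -> V) :
  zsum N f = \sum_(n < N.+1) f n%:Z + \sum_(n < N) f (- n.+1%:Z).
Proof.
elim: N => [|N IH]; first by rewrite zsum0 big_ord_recl !big_ord0 !addr0.
rewrite zsumS IH [in RHS]big_ord_recr [X in _ = _ + X]big_ord_recr /=.
rewrite [RHS]addrACA [LHS]addrAC [LHS]addrC; congr (_ + _); exact: addrC.
Qed.

Section Nonvanishing.
Variables (R : realType) (w : R[i]).
Local Notation C := R[i].
Local Notation Re := complex.Re.
Local Notation tpi := (2%:R * pi : R).
Hypothesis a1 : 1 < Re w.

Lemma cvg_cabsD (u v : nat -> C) l l' : cabs (u n - l) @[n --> \oo] --> (0 : R) ->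
  cabs (v n - l') @[n --> \oo] --> (0 : R) -> cabs (u n + v n - (l + l')) @[n --> \oo] --> (0 : R).
Proof.
move=> hu hv; have h := cvgD hu hv; rewrite addr0 in h.
apply: (@squeeze_cvgr _ _ _ _ (fun=> 0) (fun n => cabs (u n - l) + cabs (v n - l'))).
- by apply: nearW => n; rewrite cabs_ge0 /= opprD addrACA; exact: cabsD.
- exact: cvg_cst.
- exact: h.
Qed.

Lemma cvg_cabsMl (c : C) (u : nat -> C) l : cabs (u n - l) @[n --> \oo] --> (0 : R) ->
  cabs (c * u n - c * l) @[n --> \oo] --> (0 : R).
Proof.
move=> hu; have h := cvgM (cvg_cst (cabs c)) hu; rewrite mulr0 in h.
rewrite (_ : (fun n => _) = (fun n => cabs c * cabs (u n - l))); first exact: h.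
by apply/funext => n; rewrite -mulrBr cabsM.
Qed.

(** [Xi] vanishes at the nonzero multiples of 2 pi. This settles the ends of the period, which
    correspond to al = 0 and 1 and are outside the range of the zeta condition. *)
Lemma Pw_0 : Pw w 0 = 1.
Proof.
have zI : 0 <= (0 : R) <= tpi by rewrite lexx ltW ?tpi_gt0.
apply: (cvg_cabs_unique (cvg_Pw_cell a1 zI)).
rewrite (_ : (fun N => _) = (fun=> 0)); first exact: cvg_cst.
apply/funext => N; rewrite (@zsum_single _ _ _ 0) /= => [|k k0].
  rewrite /Tk /Phi /rr /theta mul0r mulr0 addr0 /sinc eqxx normr1 ltr01 ltxx subr0 ln1.
  by rewrite rC0 !mulr0 cexp0 mulr1 subrr cabs0.
rewrite /Tk /rr mul0r add0r /sinc sin_pik mul0r mulf_eq0 intr_eq0 (negPf k0) orbF gt_eqF ?pi_gt0 //.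
by rewrite normr0 /Phi ltxx mul0r.
Qed.

Section Interior.
Variable u : R.
Hypothesis uI : 0 < u < tpi.

Let uI' : 0 <= u <= tpi. Proof. by case/andP: uI => /ltW -> /ltW ->. Qed.
Let al : R := u / tpi.
Let s : R := sin (u / 2).
Let s0 : 0 < s.
Proof. by apply: sin_gt0_pi; case/andP: uI => h1 h2; apply/andP; split; lra. Qed.
Let alI : 0 < al < 1.
Proof.
case/andP: uI => h1 h2; rewrite divr_gt0 ?tpi_gt0 //=.
by rewrite ltr_pdivrMr ?tpi_gt0 // mul1r.
Qed.
(** The factor (sin(u / 2) / pi)^w e^(-i w u / 2) common to all terms. *)
Let E : C := cexp (w * rC (ln (s / pi))) * cexp (w * (cI R * rC (- (u / 2)))).
Let E0 : E != 0. Proof. by rewrite mulf_neq0 // cexp_neq0. Qed.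
Let epi : C := cexp (cI R * rC pi * w).

(** |sin(u / 2 + pi k)| does not depend on k, so only the denominator pi b varies. *)
Let Tk_form k (b : R) : 0 < b -> `|u / 2 + pi * k%:~R| = pi * b ->
  Tk w k u = cexp (w * rC (ln (s / pi))) * cexp (- w * rC (ln b)) * cexp (w * (cI R * rC (theta k u))).
Proof.
move=> b0 e; have pi0 := pi_gt0 R.
have pb : 0 < pi * b by rewrite mulr_gt0.
have rE : rr k u = s / pi / b.
  rewrite /rr; set y := u / 2 + _ in e *.
  have y0 : y != 0 by rewrite -normr_gt0 e.
  rewrite /sinc (negPf y0) normrM normfV e.
  have -> : `|sin y| = s.
    rewrite /y sinD sin_pik mulr0 addr0 normrM (gtr0_norm s0).
    have -> : `|cos (pi * k%:~R)| = 1 :> R by apply/eqP; rewrite -sqr_norm_eq1 cos_pik_sqr.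
    by rewrite mulr1.
  by rewrite invfM mulrA.
have sp : 0 < s / pi by rewrite divr_gt0.
rewrite /Tk /Phi rE divr_gt0 // ln_div ?posrE //; congr (_ * _).
by rewrite -cexpD; congr cexp; rewrite rCD rCN; ring.
Qed.

Let Tk_pos n : Tk w n%:Z u = E * cexp (- w * rC (ln (al + n%:R))).
Proof.
have pi0 := pi_gt0 R; case/andP: alI => al0 _.
rewrite (@Tk_form _ (al + n%:R)).
- by rewrite /theta /= sub0r /E; ring.
- by rewrite ltr_wpDr.
- have e : u / 2 + pi * n%:R = pi * (al + n%:R).
    by rewrite /al; move: (pi : R) pi0 => q q0; field; rewrite gt_eqF.
  rewrite [X in `|X|](_ : _ = pi * (al + n%:R)); last exact: e.
  by rewrite gtr0_norm // mulr_gt0 // ltr_wpDr // ler0n.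
Qed.

Let Tk_neg n : Tk w (- n.+1%:Z) u = E * epi * cexp (- w * rC (ln (1 - al + n%:R))).
Proof.
have pi0 := pi_gt0 R; case/andP: alI => al0 al1.
have p0 : 0 < 1 - al + n%:R by rewrite ltr_wpDr // subr_gt0.
rewrite (@Tk_form _ (1 - al + n%:R)) //.
- have -> : cexp (w * (cI R * rC (theta (- n.+1%:Z) u))) = epi * cexp (w * (cI R * rC (- (u / 2)))).
    by rewrite /theta /= rCD -cexpD; congr cexp; ring.
  by rewrite /E; ring.
- have e : u / 2 + pi * (- n.+1%:Z)%:~R = - (pi * (1 - al + n%:R)).
    rewrite mulrNz -[_%:~R]/(n.+1%:R) -[n.+1%:R]natr1 /al.
    by move: (pi : R) pi0 => q q0; field; rewrite gt_eqF.
  by rewrite e normrN gtr0_norm // mulr_gt0.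
Qed.

Lemma Pw_hurwitz : Pw w u = E * (hurwitz w al + epi * hurwitz w (1 - al)).
Proof.
pose h (d : R) n := cexp (- w * rC (ln (d + n%:R))) : C.
have c1 : cabs (\sum_(n < N.+1) h al n - hurwitz w al) @[N --> \oo] --> (0 : R).
  (* Extended by 0 to the other integers, the Hurwitz terms inherit a multiple of the majorant of
     [Tk], hence converge. *)
  pose f k := if (0 <= k)%R then E^-1 * Tk w k u else 0.
  have fE N : zsum N f = \sum_(n < N.+1) h al n.
    have f0 i : f (- i.+1%:Z) = 0  by rewrite /f (_ : (0 <= - i.+1%:Z) = false) //; lia.
    rewrite zsum_split [X in _ + X = _](_ : _ = 0) ?addr0; last by apply: big1 => i _; exact: f0.
    by apply: eq_bigr => n _; rewrite /f /= Tk_pos mulKf.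
  have fm k : cabs (f k) <= (cabs E)^-1 * maj w k.
    rewrite /f; case: ifP => _.
      by rewrite [leLHS]cabsM [cabs _^-1]cabsV ler_wpM2l ?invr_ge0 ?cabs_ge0 // cabs_Tk.
    by rewrite cabs0 mulr_ge0 ?invr_ge0 ?cabs_ge0 ?maj_ge0.
  have m0 k : 0 <= (cabs E)^-1 * maj w k by rewrite mulr_ge0 ?invr_ge0 ?cabs_ge0 ?maj_ge0.
  have mB N : zsum N (fun k => (cabs E)^-1 * maj w k) <= (cabs E)^-1 * majB w.
    by rewrite zsumMl ler_wpM2l ?invr_ge0 ?cabs_ge0 // zsum_maj_le.
  have := cvg_zsum_clim m0 mB fm; set l := clim _ => cl.
  have cl' : cabs (\sum_(n < N.+1) h al n - l) @[N --> \oo] --> (0 : R).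
    by under eq_fun do rewrite -fE.
  suff -> : hurwitz w al = l by [].
  (* A symmetric sum has N + 1 nonnegative indices, one more than the N-th partial sum of
     [hurwitz]. *)
  apply: cvg_clim_eq; rewrite -cvg_shiftS; exact: cl'.
have c2 : cabs (\sum_(n < N) h (1 - al) n - hurwitz w (1 - al)) @[N --> \oo] --> (0 : R).
  pose f k := if (k < 0)%R then (E * epi)^-1 * Tk w k u else 0.
  have Ee0 : E * epi != 0 by rewrite mulf_neq0 // cexp_neq0.
  have fE N : zsum N f = \sum_(n < N) h (1 - al) n.
    have f0 i : f i%:Z = 0 by rewrite /f (_ : (i%:Z < 0) = false) //; lia.
    rewrite zsum_split [X in X + _ = _](_ : _ = 0) ?add0r; last by apply: big1 => i _; exact: f0.
    by apply: eq_bigr => n _; rewrite /f (_ : (- n.+1%:Z < 0) = true); [rewrite Tk_neg mulKf|lia].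
  have fm k : cabs (f k) <= (cabs (E * epi))^-1 * maj w k.
    rewrite /f; case: ifP => _.
      by rewrite [leLHS]cabsM [cabs _^-1]cabsV ler_wpM2l ?invr_ge0 ?cabs_ge0 // cabs_Tk.
    by rewrite cabs0 mulr_ge0 ?invr_ge0 ?cabs_ge0 ?maj_ge0.
  have m0 k : 0 <= (cabs (E * epi))^-1 * maj w k by rewrite mulr_ge0 ?invr_ge0 ?cabs_ge0 ?maj_ge0.
  have mB N : zsum N (fun k => (cabs (E * epi))^-1 * maj w k) <= (cabs (E * epi))^-1 * majB w.
    by rewrite zsumMl ler_wpM2l ?invr_ge0 ?cabs_ge0 // zsum_maj_le.
  have := cvg_zsum_clim m0 mB fm; set l := clim _ => cl.
  have cl' : cabs (\sum_(n < N) h (1 - al) n - l) @[N --> \oo] --> (0 : R).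
    by under eq_fun do rewrite -fE.
  suff -> : hurwitz w (1 - al) = l by [].
  by apply: cvg_clim_eq; exact: cl'.
apply: (cvg_cabs_unique (cvg_Pw_cell a1 uI')).
have cc := cvg_cabsMl E (cvg_cabsD c1 (cvg_cabsMl epi c2)).
rewrite (_ : (fun N => _) = (fun N => cabs (E * (\sum_(n < N.+1) h al n +
  epi * \sum_(n < N) h (1 - al) n) - E * (hurwitz w al + epi * hurwitz w (1 - al))))).
  exact: cc.
apply/funext => N; congr (cabs (_ - _)).
rewrite zsum_split mulrDr !mulr_sumr; congr (_ + _).
  by apply: eq_bigr => n _; rewrite Tk_pos.
by apply: eq_bigr => n _; rewrite Tk_neg mulrA.
Qed.

Lemma Pw_interior_neq0 :
  (forall b : R, 0 < b < 1 -> hurwitz w b + cexp (- (cI R * rC pi * w)) * hurwitz w (1 - b) != 0) ->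
  Pw w u != 0.
Proof.
move=> hw; rewrite Pw_hurwitz mulf_neq0 //.
case/andP: alI => h1 h2.
have b01 : 0 < 1 - al < 1 by apply/andP; split; lra.
(* The assumption carries e^(-i pi w): taken at 1 - al and multiplied by e^(i pi w), it becomes the
   factor of [Pw_hurwitz]. *)
have := hw _ b01; rewrite subKr cexpN -/epi.
have e0 : epi != 0 by exact: cexp_neq0.
apply: contra => /eqP h; apply/eqP.
by apply: (mulfI e0); rewrite mulr0 mulrDr mulVKf // addrC.
Qed.
End Interior.

Hypothesis hw : forall b : R, 0 < b < 1 ->
  hurwitz w b + cexp (- (cI R * rC pi * w)) * hurwitz w (1 - b) != 0.

Lemma Pw_neq0 x : Pw w x != 0.
Proof.
have [v [j [/cell_itv /andP[v0 v1] ->]]] := real_cell x; rewrite Pw_period //.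
have [->|vn0] := eqVneq v 0; first by rewrite Pw_0 oner_eq0.
have [->|vn1] := eqVneq v tpi.
  by have := Pw_period a1 0 1; rewrite add0r mulr1 => ->; rewrite Pw_0 oner_eq0.
by apply: Pw_interior_neq0 => //; rewrite !lt_def vn0 v0 eq_sym vn1.
Qed.

Lemma scalar_cardinal_series (a : int -> C) (A : R) (g : R -> C) :
  (forall N, zsum N (fun k => cmod2 (a k)) <= A) ->
  (forall t, cabs (zsum N (fun k => a k * ft (Fw w) (t - k%:~R)) - g t) @[N --> \oo] --> (0 : R)) ->
  forall e, 0 < e -> exists N0, forall N, (N0 <= N)%N -> forall t M,
  zsum M (fun m => cmod2 (g (t + m%:~R) -
    zsum N (fun k => g k%:~R * ft (fun x => Fw w x * (Pw w x)^-1) (t + m%:~R - k%:~R)))) <= e.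
Proof.
move=> aA ag e e0.
have [c c0 Pc] := Pw_lower_bound a1 (fun u _ => Pw_neq0 u).
apply: (cardinal_series_cvg (majB_gt0 a1) c0 (adm_Fw a1) (cmeas_Pw a1) Pc (Pw_period a1)
  (fun x _ => cvg_Pw a1 x) (trig_approx (fun e e0 => Pw_modulus a1 e0)) aA ag e0).
Qed.
End Nonvanishing.

(** * Complex quaternions *)

Section ComplexQuaternions.
Variable R : realType.
Local Notation C := R[i].
Local Notation HC := (HC R).
Implicit Types (p r : HC) (x y : C).

Lemma ord4_ind (P : 'I_4 -> Prop) : P (inord 0) -> P (inord 1) -> P (inord 2) -> P (inord 3) ->
  forall i, P i.
Proof.
move=> h0 h1 h2 h3 i; rewrite -(inord_val i); case: i => -[|[|[|[|n]]]] //.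
Qed.

Lemma hc_mk (p0 p1 p2 p3 : C) : (hc (mkHC p0 p1 p2 p3) 0 = p0) * (hc (mkHC p0 p1 p2 p3) 1 = p1) *
  (hc (mkHC p0 p1 p2 p3) 2 = p2) * (hc (mkHC p0 p1 p2 p3) 3 = p3).
Proof. by rewrite /hc /mkHC !mxE !inordK. Qed.

Lemma hcP p r : hc p 0 = hc r 0 -> hc p 1 = hc r 1 -> hc p 2 = hc r 2 -> hc p 3 = hc r 3 -> p = r.
Proof.
move=> h0 h1 h2 h3; apply/matrixP => i j; rewrite ord1.
by elim/ord4_ind: j.
Qed.

Lemma hcD p r n : hc (p + r) n = hc p n + hc r n. Proof. by rewrite /hc mxE. Qed.
Lemma hcZ x p n : hc (x *: p) n = x * hc p n. Proof. by rewrite /hc mxE. Qed.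

Lemma hmulDl p p' r : hmul (p + p') r = hmul p r + hmul p' r.
Proof. by apply: hcP; rewrite hcD /hmul !hc_mk !hcD; ring. Qed.

Lemma hmul_zsum N (F : int -> HC) r : hmul (zsum N F) r = zsum N (fun k => hmul (F k) r).
Proof.
have h0 : hmul (0 : HC) r = 0.
  by apply: hcP; rewrite /hmul !hc_mk /hc !mxE; ring.
by rewrite /zsum; elim/big_ind2 : _ => [|? ? ? ? <- <-|//]; rewrite ?hmulDl.
Qed.

Lemma hnormE p : hnorm p ^+ 2 = \sum_(i < 4) cmod2 (p ord0 i).
Proof. by rewrite sqr_sqrtr // sumr_ge0 // => i _; exact: cmod2_ge0. Qed.

Lemma hnorm_ge0 p : 0 <= hnorm p. Proof. exact: sqrtr_ge0. Qed.

Lemma cabs_le_hnorm p i : cabs (p ord0 i) <= hnorm p.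
Proof.
rewrite ler_sqrt ?sumr_ge0 // => [|j _]; last exact: cmod2_ge0.
by rewrite (bigD1 i) //= lerDl sumr_ge0 // => j _; exact: cmod2_ge0.
Qed.

Lemma zsum_hnorm_le m (D : int -> HC) (d1 d2 : 'I_4 -> int -> C) :
  (forall j i, D j ord0 i = d1 i j + d2 i j) ->
  zsum m (fun j => hnorm (D j) ^+ 2) <=
  \sum_(i < 4) (2 * zsum m (fun j => cmod2 (d1 i j)) + 2 * zsum m (fun j => cmod2 (d2 i j))).
Proof.
move=> DE; under eq_bigr => i _ do rewrite -!zsumMl -zsumD.
rewrite /zsum exchange_big /=; apply: ler_sum => j _; rewrite hnormE; apply: ler_sum => i _.
by rewrite DE; exact: cmod2D_le.
Qed.

Lemma hnorm_sub p r : hnorm (p - r) = hnorm (r - p).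
Proof.
congr Num.sqrt; apply: eq_bigr => i _; rewrite !mxE -cmod2N; congr cmod2.
by rewrite opprB.
Qed.

Lemma cabs_hmul_le p r rho i : (forall j, cabs (r ord0 j) <= rho) ->
  cabs (hmul p r ord0 i) <= 4%:R * (hnorm p * rho).
Proof.
move=> hr.
have h m n : cabs (hc p m * hc r n) <= hnorm p * rho.
  by rewrite cabsM; apply: ler_pM; rewrite ?cabs_ge0 //; [exact: cabs_le_hnorm|exact: hr].
have t x y z t' : cabs x <= hnorm p * rho -> cabs y <= hnorm p * rho -> cabs z <= hnorm p * rho ->
    cabs t' <= hnorm p * rho -> cabs (x + y + z + t') <= 4%:R * (hnorm p * rho).
  move: (hnorm p * rho) => B hx hy hz ht.
  have h1 := cabsD (x + y + z) t'; have h2 := cabsD (x + y) z; have h3 := cabsD x y.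
  lra.
have e n (p0 p1 p2 p3 : C) : mkHC p0 p1 p2 p3 ord0 (inord n) = hc (mkHC p0 p1 p2 p3) n :> C by [].
by elim/ord4_ind: i; rewrite /hmul e hc_mk; apply: t; rewrite ?cabsN; exact: h.
Qed.

Section UnitVector.
Variables (n1 n2 n3 : R).
Hypothesis n123 : n1 ^+ 2 + n2 ^+ 2 + n3 ^+ 2 = 1.

(* x e_+ + y e_-, where e_+- = (1 -+ i v) / 2 are the orthogonal idempotents
   attached to the real unit vector v = n1 e1 + n2 e2 + n3 e3, v^2 = -1. *)
Definition hidem x y : HC :=
  mkHC ((x + y) / 2%:R) (rC n1 * ((x - y) / (2%:R * cI R)))
       (rC n2 * ((x - y) / (2%:R * cI R))) (rC n3 * ((x - y) / (2%:R * cI R))).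

Let cI2 : cI R * cI R = -1. Proof. by apply: cext; rewrite !cE /=; ring. Qed.
Let cIV : (2%:R * cI R)^-1 = - cI R / 2%:R.
Proof.
have h2 : (2%:R : C) != 0 by rewrite pnatr_eq0.
have hI : cI R != 0 by rewrite eq_complex /= oner_eq0 andbF.
apply: (mulfI (_ : 2%:R * cI R != 0)); first by rewrite mulf_neq0.
rewrite divff ?mulf_neq0 //.
have -> : 2%:R * cI R * (- cI R / 2%:R) = - (cI R * cI R) * (2%:R / 2%:R) by ring.
by rewrite cI2 opprK divff // mulr1.
Qed.
Let N123 : rC n1 * rC n1 + rC n2 * rC n2 + rC n3 * rC n3 = 1 :> C.
Proof. by rewrite -!rCM -!rCD -!expr2 n123. Qed.

Let hidemE x y : hidem x y = mkHC ((x + y) / 2%:R) (- (cI R * rC n1) * (x - y) / 2%:R)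
  (- (cI R * rC n2) * (x - y) / 2%:R) (- (cI R * rC n3) * (x - y) / 2%:R).
Proof. by rewrite /hidem cIV; congr mkHC; ring. Qed.

Let J123 : (cI R * rC n1) ^+ 2 + (cI R * rC n2) ^+ 2 + (cI R * rC n3) ^+ 2 = -1.
Proof.
have -> : (cI R * rC n1) ^+ 2 + (cI R * rC n2) ^+ 2 + (cI R * rC n3) ^+ 2 =
   (cI R * cI R) * (rC n1 * rC n1 + rC n2 * rC n2 + rC n3 * rC n3) by ring.
by rewrite cI2 N123 mulr1.
Qed.

Lemma hidem_linear x y i : hidem x y ord0 i = x * hidem 1 0 ord0 i + y * hidem 0 1 ord0 i.
Proof.
have e n (p0 p1 p2 p3 : C) : mkHC p0 p1 p2 p3 ord0 (inord n) = hc (mkHC p0 p1 p2 p3) n :> C by [].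
by elim/ord4_ind: i; rewrite /hidem !e !hc_mk; ring.
Qed.

Lemma hmul_hidem p x y : hmul p (hidem x y) = x *: hmul p (hidem 1 0) + y *: hmul p (hidem 0 1).
Proof. by apply: hcP; rewrite hcD !hcZ /hidem /hmul !hc_mk; ring. Qed.

Lemma hmul_hidemE p x y i :
  hmul p (hidem x y) ord0 i = x * hmul p (hidem 1 0) ord0 i + y * hmul p (hidem 0 1) ord0 i.
Proof. by rewrite hmul_hidem !mxE. Qed.

Lemma hmul_hidem1 p : hmul p (hidem 1 0) + hmul p (hidem 0 1) = p.
Proof. by rewrite !hidemE; apply: hcP; rewrite hcD /hmul !hc_mk; field. Qed.

(** Coordinatewise this only uses j1^2 + j2^2 + j3^2 = -1 for the coordinates j of i v;
    associativity of [hmul] is not invoked. *)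
Lemma hmulA_hidem p x y x' y' : hmul (hmul p (hidem x y)) (hidem x' y') = hmul p (hidem (x * x') (y * y')).
Proof.
rewrite !hidemE; move: J123; move: (cI R * rC n1) (cI R * rC n2) (cI R * rC n3) => j1 j2 j3 j123.
have j1E : j1 ^+ 2 = -1 - j2 ^+ 2 - j3 ^+ 2 by rewrite -j123; ring.
by apply: hcP; rewrite /hmul !hc_mk; field: j1E.
Qed.

Lemma hidem_mul x y x' y' : hmul (hidem x y) (hidem x' y') = hidem (x * x') (y * y').
Proof.
rewrite !hidemE; move: J123; move: (cI R * rC n1) (cI R * rC n2) (cI R * rC n3) => j1 j2 j3 j123.
have j1E : j1 ^+ 2 = -1 - j2 ^+ 2 - j3 ^+ 2 by rewrite -j123; ring.
by apply: hcP; rewrite /hmul !hc_mk; field: j1E.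
Qed.

(** The quadratic form in the denominator of [hinv] takes the value x y, and quaternion conjugation
    exchanges x and y. *)
Lemma hidem_inv x y : x != 0 -> y != 0 -> hinv (hidem x y) = hidem x^-1 y^-1.
Proof.
move=> x0 y0; rewrite !hidemE; move: J123.
move: (cI R * rC n1) (cI R * rC n2) (cI R * rC n3) => j1 j2 j3 j123.
rewrite /hinv !hc_mk.
have -> : ((x + y) / 2%:R) ^+ 2 + (- j1 * (x - y) / 2%:R) ^+ 2 + (- j2 * (x - y) / 2%:R) ^+ 2 +
  (- j3 * (x - y) / 2%:R) ^+ 2 = x * y.
  have -> : ((x + y) / 2%:R) ^+ 2 + (- j1 * (x - y) / 2%:R) ^+ 2 + (- j2 * (x - y) / 2%:R) ^+ 2 +
    (- j3 * (x - y) / 2%:R) ^+ 2 = ((x + y) / 2%:R) ^+ 2 +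
    (j1 ^+ 2 + j2 ^+ 2 + j3 ^+ 2) * ((x - y) / 2%:R) ^+ 2 by ring.
  by rewrite j123; field.
by congr mkHC; field; rewrite x0 y0.
Qed.
End UnitVector.
End ComplexQuaternions.

(** * Reduction of the quaternionic series to scalar ones *)

Section Assembly.
Variables (R : realType) (Rs : set R[i]).
Local Notation C := R[i].
Local Notation Re := complex.Re.
Local Notation tpi := (2%:R * pi : R).
Hypothesis hRs : standing_assumption Rs.
Variable q : HR R.
Hypothesis hq : QR Rs q.

Let nv := qvnorm q.
Let nv0 : nv != 0. Proof. by case: hq. Qed.
Let n (j : nat) : R := qv q j / nv.
Let w1 : C := Complex (qSc q) nv.
Let w2 : C := Complex (qSc q) (- nv).
Let hw1 : Rs w1. Proof. by case: hq. Qed.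
Let hw2 : Rs w2. Proof. by case: hRs => _ h _; apply/(h w2); rewrite /cconj /= opprK. Qed.
Let a1 : 1 < Re w1. Proof. by case: hRs => h _ _; exact: h hw1. Qed.
Let a2 : 1 < Re w2. Proof. by case: hRs => h _ _; exact: h hw2. Qed.

Let n123 : n 1 ^+ 2 + n 2 ^+ 2 + n 3 ^+ 2 = 1.
Proof.
have e : nv ^+ 2 = qv q 1 ^+ 2 + qv q 2 ^+ 2 + qv q 3 ^+ 2.
  by rewrite sqr_sqrtr // !addr_ge0 // sqr_ge0.
by rewrite /n !exprMn -!mulrDl -e -exprMn divff // expr1n.
Qed.

Let M := hidem (n 1) (n 2) (n 3).
Let F1 := Fw w1. Let F2 := Fw w2. Let P1 := Pw w1. Let P2 := Pw w2.
Let L1 x := F1 x * (P1 x)^-1. Let L2 x := F2 x * (P2 x)^-1.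

(** Cosine and sine of |v| log z are the half-sum and the half-difference over i of e^(+-i |v| log
    z), matching the coordinates of [hidem]. *)
Lemma Bhat_hidem xi : Bhat q xi = M (F1 xi) (F2 xi).
Proof.
rewrite /Bhat /hpow /F1 /F2 /Fw /cpw; case: eqVneq => _.
  by apply: hcP; rewrite /M /hidem !hc_mk /hc mxE; ring.
set L := clog _.
have e1 : cexp (w1 * L) = cpowr (Xi xi) (qSc q) * cexp (cI R * (rC nv * L)).
  rewrite /cpowr -cexpD -/L; congr cexp.
  have -> : w1 = rC (qSc q) + cI R * rC nv by apply: cext; rewrite !cE /=; ring.
  ring.
have e2 : cexp (w2 * L) = cpowr (Xi xi) (qSc q) * cexp (- (cI R * (rC nv * L))).
  rewrite /cpowr -cexpD -/L; congr cexp.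
  have -> : w2 = rC (qSc q) - cI R * rC nv by apply: cext; rewrite !cE /=; ring.
  ring.
by rewrite /M /hidem e1 e2 /ccos /csin -/nv; congr mkHC; rewrite /n; ring.
Qed.

Lemma invFT_hidem (G1 G2 : R -> C) K1 K2 t : adm G1 K1 -> adm G2 K2 ->
  invFT (fun xi => M (G1 xi) (G2 xi)) t = M (ft G1 t) (ft G2 t).
Proof.
move=> aG1 aG2; apply/matrixP => i0 i; rewrite ord1 mxE [RHS]hidem_linear.
set A := hidem _ _ _ 1 0 _ _; set B := hidem _ _ _ 0 1 _ _.
have -> : cint (fun xi => M (G1 xi) (G2 xi) ord0 i * cexp (cI R * rC (xi * t))) =
    cintS setT (fun xi => A * (G1 xi * ce (xi * t)) + B * (G2 xi * ce (xi * t))).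
  rewrite -[LHS]/(cintS setT _); congr cintS; apply/funext => xi.
  by rewrite cexp_ce [M _ _ _ _]hidem_linear -/A -/B; ring.
have i1 := adm_cinteg_ce t aG1; have i2 := adm_cinteg_ce t aG2.
rewrite cintS_add //; [|exact: cinteg_Zl..].
by rewrite !cintS_Zl // /ft; ring.
Qed.

Lemma Bq_hidem t : Bq q t = M (ft F1 t) (ft F2 t).
Proof.
have E : Bhat q = (fun xi => M (F1 xi) (F2 xi)) by apply/funext => xi; exact: Bhat_hidem.
by rewrite /Bq E; exact: (invFT_hidem t (adm_Fw a1) (adm_Fw a2)).
Qed.

Let hn1 b : 0 < b < 1 -> hurwitz w1 b + cexp (- (cI R * rC pi * w1)) * hurwitz w1 (1 - b) != 0.
Proof. by case: hRs => _ _ h; exact: h. Qed.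
Let hn2 b : 0 < b < 1 -> hurwitz w2 b + cexp (- (cI R * rC pi * w2)) * hurwitz w2 (1 - b) != 0.
Proof. by case: hRs => _ _ h; exact: h. Qed.

(** [hlim] acts on coordinates, and each coordinate is a fixed linear combination of the two scalar
    periodizations. *)
Lemma Per_hidem xi : Per q xi = M (P1 xi) (P2 xi).
Proof.
apply/matrixP => i0 i; rewrite ord1 mxE [RHS]hidem_linear.
set A := hidem _ _ _ 1 0 _ _; set B := hidem _ _ _ 0 1 _ _.
apply: cvg_clim_eq.
have c := cvg_cabsD (cvg_cabsMl A (cvg_Pw a1 xi)) (cvg_cabsMl B (cvg_Pw a2 xi)).
rewrite (_ : (fun N => _) = (fun N => cabs (A * zsum N (fun k => Fw w1 (xi + tpi * k%:~R)) +
  B * zsum N (fun k => Fw w2 (xi + tpi * k%:~R)) - (A * Pw w1 xi + B * Pw w2 xi)))).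
  exact: c.
apply/funext => N; congr (cabs (_ - _)); last by rewrite mulrC [B * _]mulrC.
rewrite /symsum summxE -!zsumMl -zsumD; apply: eq_bigr => k _.
by rewrite Bhat_hidem [LHS]hidem_linear mulrC [X in _ + X]mulrC.
Qed.

Lemma Lq_hidem t : Lq q t = M (ft L1 t) (ft L2 t).
Proof.
have [c1 c10 b1] := Pw_lower_bound a1 (fun u _ => Pw_neq0 a1 hn1 u).
have [c2 c20 b2] := Pw_lower_bound a2 (fun u _ => Pw_neq0 a2 hn2 u).
have aL1 : adm L1 (majB w1 / c1) := adm_div (adm_Fw a1) (cmeas_Pw a1) c10 b1.
have aL2 : adm L2 (majB w2 / c2) := adm_div (adm_Fw a2) (cmeas_Pw a2) c20 b2.
have E : (fun xi => hmul (Bhat q xi) (hinv (Per q xi))) = (fun xi => M (L1 xi) (L2 xi)).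
  apply/funext => xi; rewrite Bhat_hidem Per_hidem hidem_inv //; [|exact: Pw_neq0..].
  exact: hidem_mul.
by rewrite /Lq E; exact: (invFT_hidem t aL1 aL2).
Qed.

Variable f : R -> HC R.
Hypothesis hf : inH q f.

Let component (G : R -> C) (x y : C) i :=
  forall e, 0 < e -> exists N0, forall N, (N0 <= N)%N -> forall t m,
  zsum m (fun j => cmod2 (hmul (f (t + j%:~R)) (M x y) ord0 i -
    zsum N (fun k => hmul (f k%:~R) (M x y) ord0 i * ft G (t + j%:~R - k%:~R)))) <= e.

(* Right multiplication by an idempotent [M x y] turns the expansion of [f] into four
   scalar expansions with respect to a single complex-order B-spline. *)
Let component_cvg (w x y : C) i : 1 < Re w ->
  (forall b : R, 0 < b < 1 -> hurwitz w b + cexp (- (cI R * rC pi * w)) * hurwitz w (1 - b) != 0) ->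
  (forall t p, hmul (hmul p (Bq q t)) (M x y) = ft (Fw w) t *: hmul p (M x y)) ->
  component (fun xi => Fw w xi * (Pw w xi)^-1) x y i.
Proof.
move=> aw hw hB; case: hf => a [[A aA] af].
pose rho := \sum_(j < 4) cabs (M x y ord0 j).
have hrho j : cabs (M x y ord0 j) <= rho.
  by rewrite /rho (bigD1 j) //= lerDl sumr_ge0 // => l _; exact: cabs_ge0.
have cb p := cabs_hmul_le p i hrho.
have rho0 : 0 <= rho by apply: sumr_ge0 => j _; exact: cabs_ge0.
pose al k := hmul (a k) (M x y) ord0 i.
have alA N : zsum N (fun k => cmod2 (al k)) <= (4%:R * rho) ^+ 2 * A.
  apply: (@le_trans _ _ (zsum N (fun k => (4%:R * rho) ^+ 2 * hnorm (a k) ^+ 2))).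
    apply: ler_zsum => k; rewrite -exprMn; apply: cmod2_le.
    by apply: le_trans (cb _) _; rewrite mulrA [leRHS]mulrAC.
  by rewrite zsumMl ler_wpM2l ?sqr_ge0 //; exact: aA.
apply: (scalar_cardinal_series aw hw alA (g := fun t => hmul (f t) (M x y) ord0 i)) => t.
have hfN N : zsum N (fun k => al k * ft (Fw w) (t - k%:~R)) - hmul (f t) (M x y) ord0 i =
    hmul (symsum N (fun k => hmul (a k) (Bq q (t - k%:~R))) - f t) (M x y) ord0 i.
  have hB' (u v : HC R) : hmul (u - v) (M x y) = hmul u (M x y) - hmul v (M x y).
    by apply/eqP; rewrite eq_sym subr_eq -hmulDl subrK.
  rewrite hB' [RHS]mxE [X in _ = _ + X]mxE; congr (_ - _).
  rewrite -[symsum _ _]/(zsum N (fun k => hmul (a k) (Bq q (t - k%:~R)))) hmul_zsum.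
  rewrite /zsum summxE; apply: eq_bigr => k _.
  by rewrite hB mxE mulrC.
under eq_fun do rewrite hfN.
have := cvgM (cvg_cst (4%:R * rho)) (af t); rewrite mulr0 => c.
apply: (@squeeze_cvgr _ _ _ _ (fun=> 0) (fun N => 4%:R * rho *
  hnorm (symsum N (fun k => hmul (a k) (Bq q (t - k%:~R))) - f t))).
- apply: nearW => N; rewrite cabs_ge0 /=; apply: le_trans (cb _) _.
  by rewrite mulrA [leRHS]mulrAC.
- exact: cvg_cst.
- exact: c.
Qed.

Let comp1 i : component L1 1 0 i.
Proof.
apply: component_cvg => // t p.
by rewrite Bq_hidem /M hmulA_hidem // hmul_hidem mulr1 mulr0 scale0r addr0.
Qed.

Let comp2 i : component L2 0 1 i.
Proof.
apply: component_cvg => // t p.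
by rewrite Bq_hidem /M hmulA_hidem // hmul_hidem mulr1 mulr0 scale0r add0r.
Qed.

Lemma hnorm_error e : 0 < e -> exists N0, forall N, (N0 <= N)%N -> forall t m,
  zsum m (fun j => hnorm (f (t + j%:~R) - cardinal_sum q f N (t + j%:~R)) ^+ 2) <= e.
Proof.
(* Four coordinates, each with two scalar errors doubled by the squared triangle inequality: 4 (2 +
   2) = 16. *)
move=> e0; have e1 : 0 < e / 16%:R by rewrite divr_gt0.
have e4 : e / 4%:R = 2 * (e / 16%:R) + 2 * (e / 16%:R) by lra.
have p2 : 0 <= 2 :> R by [].
have [N1 h1] := choice (fun i => comp1 i e1); have [N2 h2] := choice (fun i => comp2 i e1).
exists (maxn (\max_i N1 i) (\max_i N2 i)) => N; rewrite geq_max => /andP[/bigmax_leqP l1 /bigmax_leqP l2] t m.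
pose D1 s i := hmul (f s) (M 1 0) ord0 i - zsum N (fun k => hmul (f k%:~R) (M 1 0) ord0 i * ft L1 (s - k%:~R)).
pose D2 s i := hmul (f s) (M 0 1) ord0 i - zsum N (fun k => hmul (f k%:~R) (M 0 1) ord0 i * ft L2 (s - k%:~R)).
have DE s i : (f s - cardinal_sum q f N s) ord0 i = D1 s i + D2 s i.
  rewrite /D1 /D2 addrACA -opprD -zsumD mxE [X in _ + X]mxE; congr (_ - _).
    by rewrite -[in LHS](hmul_hidem1 (n 1) (n 2) (n 3) (f s)) mxE.
  rewrite /cardinal_sum /symsum summxE; apply: eq_bigr => k _.
  by rewrite Lq_hidem hmul_hidemE; congr (_ + _); exact: mulrC.
apply: (le_trans (zsum_hnorm_le m (d1 := fun i j => D1 (t + j%:~R) i)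
  (d2 := fun i j => D2 (t + j%:~R) i) (fun j i => DE _ _))).
apply: (@le_trans _ _ (\sum_(i < 4) (e / 4%:R))).
  apply: ler_sum => i _; have b1 := h1 i N (l1 i isT) t m; have b2 := h2 i N (l2 i isT) t m.
  by rewrite e4; exact: (lerD (ler_wpM2l p2 b1) (ler_wpM2l p2 b2)).
by rewrite sumr_const card_ord -[leLHS]mulr_natr divfK.
Qed.
End Assembly.

Lemma cvg_integral_cells0 (R : realType) (psi : nat -> R -> R) : (forall N x, 0 <= psi N x) ->
  (forall e, 0 < e -> exists N0, forall N, (N0 <= N)%N -> forall t m,
     zsum m (fun j => psi N (t + j%:~R)) <= e) ->
  (\int[lebesgue_measure]_t (psi N t)%:E)%E @[N --> \oo] --> 0%E.
Proof.
move=> psi0 h.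
have b e : 0 < e -> \forall N \near \oo, (0 <= \int[lebesgue_measure]_t (psi N t)%:E <= e%:E)%E.
  move=> e0; have [N0 hN0] := h e e0; exists N0 => // N /= NN.
  apply/andP; split; first by apply: integral_ge0 => x _; rewrite lee_fin.
  (* Cells of length 1, matching the integer translates. *)
  rewrite -[e]mulr1; apply: integral_cells_le_cst => //; first exact: ltW.
  move=> x m; apply: le_trans (hN0 N NN x m).
  by rewrite (@eq_zsum _ _ _ (fun j => psi N (x + j%:~R))) // => k _; rewrite mul1r.
apply/fine_cvgP; split.
  apply: filterS (b 1 ltr01) => N /andP[h1 h2].
  by rewrite ge0_fin_numE // (le_lt_trans h2) // ltry.
apply/cvgrPdist_le => e e0; apply: filterS (b e e0) => N /andP[h1 h2] /=.
rewrite sub0r normrN ger0_norm; last exact: fine_ge0.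
have fn : (\int[lebesgue_measure]_t (psi N t)%:E \is a fin_num)%E.
  by rewrite ge0_fin_numE // (le_lt_trans h2) // ltry.
by rewrite -lee_fin fineK.
Qed.

Theorem mainTheorem14 (R : realType) (Rs : set R[i])
  (hRs : standing_assumption Rs) (q : HR R) (hq : QR Rs q)
  (f : R -> HC R) (hf : inH q f) :
  [/\ (* convergence in L^2(R, H_C) *)
      (fun N : nat => (\int[lebesgue_measure]_t
          ((hnorm (f t - cardinal_sum q f N t)) ^+ 2)%:E)%E) @ \oo --> 0%E,
      (* pointwise convergence *)
      (forall t : R, hcvg (fun N => cardinal_sum q f N t) (f t)) &
      (* uniform convergence on compact subsets of R *)
      (forall K : set R, compact K ->
         forall eps : R, 0 < eps -> exists N0 : nat, forall N : nat, (N0 <= N)%N ->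
           forall t : R, K t -> hnorm (f t - cardinal_sum q f N t) < eps)].
Proof.
have err := hnorm_error hRs hq hf.
have unif eps : 0 < eps -> exists N0 : nat, forall N : nat, (N0 <= N)%N ->
    forall t, hnorm (f t - cardinal_sum q f N t) < eps.
  move=> e0; have e2 : 0 < (eps / 2) ^+ 2 by rewrite exprn_gt0 // divr_gt0.
  have [N0 h] := err _ e2; exists N0 => N NN t.
  (* The single term j = 0 of the sum over translates bounds the error at t, with N0 independent of
     t. *)
  have := h N NN t 0%N; rewrite zsum0 addr0 => le2.
  have e20 : 0 <= eps / 2 by rewrite divr_ge0 // ltW.
  have le1 : hnorm (f t - cardinal_sum q f N t) <= eps / 2.
    by rewrite -(@ler_pXn2r _ 2) // nnegrE hnorm_ge0.
  by apply: (le_lt_trans le1); rewrite ltr_pdivrMr // ltr_pMr // ltr1n.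
split.
- by apply: cvg_integral_cells0 => [N x|]; [exact: sqr_ge0|exact: err].
- move=> t; apply/cvgrPdist_le => e e0; have [N0 h] := unif e e0.
  exists N0 => // N /= NN; rewrite sub0r normrN ger0_norm ?hnorm_ge0 // hnorm_sub.
  by apply: ltW; exact: h.
- move=> K _ e e0; have [N0 h] := unif e e0.
  by exists N0 => N NN t _; exact: h.
Qed.
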